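(* Let $p>3$ be prime and $s_p=\frac1{24}(p^2-1)$. Then the function $$\prod_{n=1}^\infty(1-q^{pn})\;\sum_{n=\lceil s_p/p\rceil}^\infty\left(\sum_{k=0}^{p-1}N(k,p,pn-s_p)\,\zeta_p^k\right)q^n$$ is a weakly holomorphic modular form of weight $1$ on the group $\Gamma_1(p)$.
   Context: Here $q=\exp(2\pi i z)$ with $z$ in the upper half plane and $\zeta_p=\exp(2\pi i/p)$. The rank of a partition is its largest part minus its number of parts, and $N(r,t,n)$ denotes the number of partitions of $n$ with rank congruent to $r$ modulo $t$. A weakly holomorphic modular form is holomorphic on the upper half plane, transforms as a modular form, and is allowed poles at the cusps. *)

(* Defs.v *)
From HB Require Import structures.
From mathcomp Require Import all_boot all_order all_algebra.
From mathcomp Require Import all_classical all_reals all_analysis.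
From mathcomp Require Import complex.

Set Implicit Arguments.
Unset Strict Implicit.
Unset Printing Implicit Defensive.

Import Order.TTheory GRing.Theory Num.Theory.
Import numFieldNormedType.Exports.

Local Open Scope classical_set_scope.
Local Open Scope ring_scope.
Local Open Scope complex_scope.

Definition is_partition (n : nat) (s : seq nat) : bool :=
  [&& sorted geq s, 0%N \notin s & sumn s == n].

(* The list is weakly decreasing, so its head is the largest part.  The empty
   partition gets rank 0. *)
Definition rank (s : seq nat) : int := (head 0%N s)%:Z - (size s)%:Z.

(* A partition of n has at most n parts, each at most n, so the bounded
   sequences below include every partition of n, each exactly once. *)
Definition rank_count (r t n : nat) : nat :=
  #|[pred s : {bseq n of 'I_n.+1} |
      let l := [seq nat_of_ord i | i <- s] in
      is_partition n l && (rank l == r%:Z %[mod t%:Z])%Z]|.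

(* The division is exact when p > 3 is prime. *)
Definition sp (p : nat) : nat := ((p ^ 2 - 1) %/ 24)%N.

(* The ceiling of m / d. *)
Definition ceil_div (m d : nat) : nat :=
  `|Num.ceil (m%:R / d%:R : rat)|%N.

Section ComplexAnalysis.
Variable R : realType.
Local Notation C := R[i].

(* The library puts the topology of the numeric field C on its alias C^o. *)
Definition cexp (z : C) : C :=
  (expR (complex.Re z))%:C *
  (cos (complex.Im z) +i* sin (complex.Im z)).

(* The function exp (2 pi i z / h). *)
Definition qexp (h : nat) (z : C) : C :=
  cexp (2 * (pi : R)%:C * 'i%C * z / h%:R).

(* The number exp (2 pi i / t). *)
Definition zeta (t : nat) : C := cexp (2 * (pi : R)%:C * 'i%C / t%:R).

Definition upper_half_plane : set C := [set z | 0 < complex.Im z].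

Definition holomorphic_on (D : set C) (f : C -> C) : Prop :=
  forall z, D z -> derivable (f : C^o -> C^o) z 1.

Definition SL2Z : set 'M[int]_2 := [set g | \det g = 1].

Definition Gamma1 (N : nat) : set 'M[int]_2 :=
  [set g | [/\ \det g = 1,
               (g 0%R 0%R = 1 %[mod N%:Z])%Z,
               (g 1%R 1%R = 1 %[mod N%:Z])%Z &
               (g 1%R 0%R = 0 %[mod N%:Z])%Z]].

Definition automorphy (g : 'M[int]_2) (z : C) : C :=
  (g 1 0)%:~R * z + (g 1 1)%:~R.

Definition moebius (g : 'M[int]_2) (z : C) : C :=
  ((g 0 0)%:~R * z + (g 0 1)%:~R) / automorphy g z.

Definition slash (k : int) (f : C -> C) (g : 'M[int]_2) (z : C) : C :=
  automorphy g z ^ (- k) * f (moebius g z).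

(* f (z) is the sum of a_j exp (2 pi i j z / h) over all integers j >= m, for
   some m, possibly negative; a n below is the coefficient of index m + n. *)
Definition meromorphic_at_infinity (h : nat) (f : C -> C) : Prop :=
  exists (m : int) (a : nat -> C), forall z, upper_half_plane z ->
    (fun M : nat =>
       (\sum_(0 <= n < M) a n * qexp h z ^ (m + n%:Z) : C^o)) @ \oo
    --> (f z : C^o).

(* Conjugates of Gamma1 N in SL2Z contain the translation by N, whence the
   expansions in exp (2 pi i z / N) at all cusps.  Functions on the upper half
   plane are total here; their values elsewhere are irrelevant. *)
Definition weakly_holomorphic_modular_form_Gamma1
    (N : nat) (k : int) (f : C -> C) : Prop :=
  [/\ holomorphic_on upper_half_plane f,
      forall g z, Gamma1 N g -> upper_half_plane z ->
        f (moebius g z) = automorphy g z ^ k * f z &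
      forall g, SL2Z g -> meromorphic_at_infinity N (slash k f g)].

Definition infinite_sum (m : nat) (u : nat -> C) : C :=
  limn (fun M : nat => (\sum_(m <= n < M) u n : C^o)).

Definition infinite_prod (m : nat) (u : nat -> C) : C :=
  limn (fun M : nat => (\prod_(m <= n < M) u n : C^o)).

End ComplexAnalysis.

(* Main.v *)
Require Import Defs.
From HB Require Import structures.
From mathcomp Require Import all_boot all_order all_algebra.
From mathcomp Require Import all_classical all_reals all_analysis.
From mathcomp Require Import complex ring lra zify.

Set Implicit Arguments.
Unset Strict Implicit.
Unset Printing Implicit Defensive.

Import Order.TTheory GRing.Theory Num.Theory.
Import numFieldNormedType.Exports.

Local Open Scope classical_set_scope.
Local Open Scope ring_scope.
Local Open Scope complex_scope.

(** Write e(u) = exp (2 pi i u), q = e(z), w = e(1/p), s = (p^2 - 1)/24, and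
    (x;q) for the infinite product of the 1 - x q^n, n >= 0.  The function F of
    the theorem turns out to be a constant multiple of a finite sum of quotients
    of Klein forms, of weight 1, which the group permutes.

    Rank generating function.  Removing the first column of a partition and
    adding one part (Dyson's map) relates the numbers of partitions with rank at
    least r for different r.  Iterating the relation yields Euler's pentagonal
    number theorem ([pentagonal]) and the formula [rank_gf]: the sum over n of
    x^n times the sum of w^rank over partitions of n is (1 - w) A(w;x) / (x;x),
    where A(u;x) is the sum over all integers n of
    (-1)^n x^(n(3n+1)/2) / (1 - u x^n).  Selecting the exponents congruent to -s
    modulo p amounts to averaging over x_j = e((z+j)/p), so F is, up to a
    constant, (q^p;q^p) times the sum over j of E_j A(w;x_j), with
    E_j = x_j^s / (x_j;x_j) ([Ff_Ap]).

    Dissection.  The series A(u;x) is quasi-periodic under u -> x^p u up to a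
    combination of theta constants, each of which is 0 or c x^(-d) (x;x) with
    24 d + 1 = (2i+1)^2 for some i ([Ap_shift], [Wv_eval]).  Since
    24 (s - d) = p^2 - (2i+1)^2, summing x_j^(s-d) over j gives 0 unless p
    divides 2i+1, and in that case the combination
    Phi(u) = sum_j E_j (w A(uw;x_j) - A(u/w;x_j)) carries the factor
    w^(-i) - w^(i+1) = 0.  Thus Phi is exactly quasi-periodic under u -> q u
    ([Phif_shift]).  A theta product H with the inverse multiplier makes H Phi
    invariant, so its residues in a fundamental annulus add up to 0.  The pole
    of H at 1 contributes the sum of the E_j A(w;x_j), and the poles of Phi
    contribute values of H at the points x_j^k w^(+-1) ([dissection]).  These
    are theta values at p-torsion points, and F becomes a constant times a
    finite sum of functions [Gs] ([Ff_Gs]).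

    Modularity.  The theta function satisfies the inversion formula [th_S],
    because the quotient of its two sides is doubly periodic and without poles,
    hence constant.  So Klein forms have weight -1 and SL2(Z) acts on their
    index vectors ([kl_SL2]).  In each [Gs] the powers of the theta functions
    and the phase are balanced so that [Gs] has weight 1 and depends on its
    vectors modulo p only ([Gs_perV], [Gs_perW], [Gs_perE], [Gs_SL2]).  A matrix
    with rows (a,b), (c,d) in Gamma_1(p) sends the vector (1,j) to (1,j+b)
    modulo p and fixes (0,1), so it permutes the summands.  Any matrix of
    SL2(Z) sends [Gs] to another function of the same kind, each of which is a
    power of e(-z/2p^2) times a power series in e(z/2p^2) ([cuspU_Gs]);
    invariance under z -> z + p leaves powers of e(z/p) only ([cuspU_mero]).

    Holomorphy enters as locally uniform approximation by polynomials or Laurent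
    polynomials, and contour integrals as means over N-th roots of unity with N
    tending to infinity. *)

Notation nrm := ComplexField.Normc.normc.

(** * Norm and limits of complex sequences *)
Section Base.
Variable R : realType.
Local Notation C := R[i].
Implicit Types (z w : C).

Lemma normE z : `|z| = (nrm z)%:C. Proof. by []. Qed.
Lemma nrm_ge0 z : 0 <= nrm z.
Proof. by case: z => a b /=; rewrite sqrtr_ge0. Qed.
Hint Resolve nrm_ge0 : core.
Lemma nrm0 : nrm (0 : C) = 0. Proof. exact: ComplexField.Normc.normc0. Qed.
Lemma nrm1 : nrm (1 : C) = 1. Proof. exact: ComplexField.Normc.normc1. Qed.
Lemma nrmM z w : nrm (z * w) = nrm z * nrm w.
Proof. exact: ComplexField.Normc.normcM. Qed.
Lemma nrmV z : nrm z^-1 = (nrm z)^-1.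
Proof. exact: ComplexField.Normc.normcV. Qed.
Lemma nrmN z : nrm (- z) = nrm z.
Proof. by apply: complexI; rewrite -!normE normrN. Qed.
Lemma nrmX z n : nrm (z ^+ n) = nrm z ^+ n.
Proof. by elim: n => [|n IH]; rewrite ?expr0 ?nrm1 // !exprS nrmM IH. Qed.
Lemma nrmD z w : nrm (z + w) <= nrm z + nrm w.
Proof. by rewrite -lecR rmorphD -!normE ler_normD. Qed.
Lemma nrmB z w : nrm (z - w) <= nrm z + nrm w.
Proof. by rewrite -(nrmN w) nrmD. Qed.
Lemma nrmBC z w : nrm (z - w) = nrm (w - z).
Proof. by rewrite -nrmN opprB. Qed.
Lemma nrm_subl z w : nrm z - nrm w <= nrm (z - w).
Proof. by rewrite lerBlDr -{1}(subrK w z) nrmD. Qed.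
Lemma nrm_eq0 z : (nrm z == 0) = (z == 0).
Proof.
apply/eqP/eqP => [/ComplexField.Normc.eq0_normc //|->]; exact: nrm0.
Qed.
Lemma nrm_gt0 z : (0 < nrm z) = (z != 0).
Proof. by rewrite lt_def nrm_ge0 andbT nrm_eq0. Qed.
Lemma nrm_real (x : R) : nrm (x%:C) = `|x|.
Proof. by rewrite /= expr0n /= addr0 sqrtr_sqr. Qed.
Lemma nrm_nat n : nrm (n%:R : C) = n%:R.
Proof. by rewrite -(rmorph_nat (real_complex R)) nrm_real normr_nat. Qed.
Lemma nrm_sum (I : Type) (r : seq I) (P : pred I) (F : I -> C) :
  nrm (\sum_(i <- r | P i) F i) <= \sum_(i <- r | P i) nrm (F i).
Proof.
elim/big_rec2: _ => [|i y x _ le_xy]; first by rewrite nrm0.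
by apply: le_trans (nrmD _ _) _; rewrite lerD2l.
Qed.
Lemma nrm_prod (I : Type) (r : seq I) (P : pred I) (F : I -> C) :
  nrm (\prod_(i <- r | P i) F i) = \prod_(i <- r | P i) nrm (F i).
Proof. by elim/big_rec2: _ => [|i y x _ <-]; rewrite ?nrm1 ?nrmM. Qed.
Lemma Re_le_nrm z : `|complex.Re z| <= nrm z.
Proof.
case: z => a b /=; rewrite -sqrtr_sqr ler_sqrt ?addr_ge0 ?sqr_ge0 //.
by rewrite lerDl sqr_ge0.
Qed.
Lemma Im_le_nrm z : `|complex.Im z| <= nrm z.
Proof.
case: z => a b /=; rewrite -sqrtr_sqr ler_sqrt ?addr_ge0 ?sqr_ge0 //.
by rewrite lerDr sqr_ge0.
Qed.
Lemma nrm_le_ReIm z : nrm z <= `|complex.Re z| + `|complex.Im z|.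
Proof.
rewrite {1}(complexE z); apply: le_trans (nrmD _ _) _.
rewrite nrmM !nrm_real lerD2l -[leRHS]mul1r ler_wpM2r //.
by rewrite /= expr0n /= expr1n add0r sqrtr1.
Qed.

(** Convergence for the real-valued norm; together with [climP] this reduces
    all complex limits to real estimates. *)
Definition clim (u : nat -> C) (l : C) :=
  forall e : R, 0 < e -> exists N, forall n, (N <= n)%N -> nrm (u n - l) < e.

Lemma climP (u : nat -> C) (l : C) :
  clim u l <-> ((u : nat -> C^o) @ \oo --> (l : C^o)).
Proof.
split=> [cu|].
  apply/cvgrPdist_lt => -[e e'] /=; rewrite ltcE /= => /andP[/eqP -> e0].
  have [N HN] := cu _ e0; exists N => // n /= /HN.
  rewrite nrmBC => h; by rewrite -[e +i* 0]/(e%:C) normE ltcR.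
move/cvgrPdist_lt => cu e e0.
have /cu [N _ HN] : 0 < e%:C by rewrite -(rmorph0 (real_complex R)) ltcR.
by exists N => n /HN /=; rewrite normE ltcR nrmBC.
Qed.

Lemma clim_lim (u : nat -> C) (l : C) : clim u l -> limn (u : nat -> C^o) = l.
Proof. by move=> /climP h; apply/cvg_lim. Qed.

Lemma clim_uniq u l l' : clim u l -> clim u l' -> l = l'.
Proof. by move=> /clim_lim <- /clim_lim. Qed.

Lemma clim_ext u v l : (forall n, u n = v n) -> clim u l -> clim v l.
Proof. by move=> /funext ->. Qed.

Lemma clim_near N u v l : (forall n, (N <= n)%N -> u n = v n) ->
  clim u l -> clim v l.
Proof.
move=> uv cu e /cu [M HM]; exists (maxn N M) => n; rewrite geq_max => /andP[h1 h2].
by rewrite -uv // HM.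
Qed.

Lemma clim_cst l : clim (fun _ => l) l.
Proof. by move=> e e0; exists 0%N => n _; rewrite subrr nrm0. Qed.

Lemma climD u v l m : clim u l -> clim v m -> clim (fun n => u n + v n) (l + m).
Proof. by move=> /climP cu /climP cv; apply/climP; exact: (cvgD cu cv). Qed.
Lemma climM u v l m : clim u l -> clim v m -> clim (fun n => u n * v n) (l * m).
Proof. by move=> /climP cu /climP cv; apply/climP; exact: (cvgM cu cv). Qed.
Lemma climN u l : clim u l -> clim (fun n => - u n) (- l).
Proof. by move=> /climP cu; apply/climP; exact: (cvgN cu). Qed.
Lemma climB u v l m : clim u l -> clim v m -> clim (fun n => u n - v n) (l - m).
Proof. by move=> cu /climN; apply: climD. Qed.
Lemma climZ c u l : clim u l -> clim (fun n => c * u n) (c * l).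
Proof. exact/climM/clim_cst. Qed.
Lemma climV u l : l != 0 -> clim u l -> clim (fun n => (u n)^-1) l^-1.
Proof. by move=> l0 /climP cu; apply/climP; exact: (cvgV l0 cu). Qed.
Lemma clim_sum (I : Type) (r : seq I) (u : I -> nat -> C) (l : I -> C) :
  (forall i, clim (u i) (l i)) ->
  clim (fun n => \sum_(i <- r) u i n) (\sum_(i <- r) l i).
Proof.
move=> cu; elim: r => [|i r IH].
  by rewrite big_nil; apply: clim_ext (clim_cst 0) => n; rewrite big_nil.
by rewrite big_cons; apply: clim_ext (climD (cu i) IH) => n; rewrite big_cons.
Qed.
Lemma clim_prod (I : Type) (r : seq I) (u : I -> nat -> C) (l : I -> C) :
  (forall i, clim (u i) (l i)) ->
  clim (fun n => \prod_(i <- r) u i n) (\prod_(i <- r) l i).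
Proof.
move=> cu; elim: r => [|i r IH].
  by rewrite big_nil; apply: clim_ext (clim_cst 1) => n; rewrite big_nil.
by rewrite big_cons; apply: clim_ext (climM (cu i) IH) => n; rewrite big_cons.
Qed.

Lemma clim_sub (f : nat -> nat) u l : (forall N, exists M, forall n, (M <= n)%N -> (N <= f n)%N) ->
  clim u l -> clim (fun n => u (f n)) l.
Proof.
move=> hf cu e /cu [N HN]; have [M HM] := hf N.
by exists M => n /HM; apply: HN.
Qed.

Lemma clim_addn k u l : clim u l -> clim (fun n => u (n + k)%N) l.
Proof.
apply: clim_sub => N; exists N => n h; exact: leq_trans h (leq_addr _ _).
Qed.

Lemma clim_unaddn k u l : clim (fun n => u (n + k)%N) l -> clim u l.
Proof.
move=> cu e /cu [N HN]; exists (N + k)%N => n hn.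
by have := HN (n - k)%N ltac:(lia); rewrite subnK //; lia.
Qed.

Lemma clim_nrm_le u l (M : R) N : (forall n, (N <= n)%N -> nrm (u n) <= M) -> clim u l -> nrm l <= M.
Proof.
move=> hu cu; rewrite leNgt; apply/negP => hM.
have /cu [K HK] : 0 < nrm l - M by rewrite subr_gt0.
have := HK (maxn N K) (leq_maxr _ _); have := hu (maxn N K) (leq_maxl _ _).
by have := nrm_subl l (u (maxn N K)); rewrite nrmBC; lra.
Qed.

(** Domination by a null sequence replaces squeezing arguments for the complex
    norm, see [clim_null]. *)
Definition null (v : nat -> R) :=
  forall e : R, 0 < e -> exists N, forall n, (N <= n)%N -> v n < e.

Lemma clim_null u l v : null v -> (forall n, nrm (u n - l) <= v n) -> clim u l.
Proof.
move=> nv uv e /nv [N HN]; exists N => n /HN; exact: le_lt_trans.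
Qed.

Lemma nullZ (c : R) v : 0 <= c -> null v -> null (fun n => c * v n).
Proof.
move=> c0 nv e e0; have c1 : 0 < c + 1 by lra.
have /nv [N HN] : 0 < e / (c + 1) by rewrite divr_gt0.
exists N => n /HN h; have [v0|v0] := leP (v n) 0.
  by apply: le_lt_trans e0; rewrite mulr_ge0_le0.
rewrite ltr_pdivlMr // in h; nra.
Qed.

Lemma bernoulli (x : R) n : 0 <= x -> 1 + n%:R * x <= (1 + x) ^+ n.
Proof.
move=> x0; elim: n => [|n IH]; first by rewrite mul0r addr0 expr0.
rewrite exprS -natr1; have n0 : (0 : R) <= n%:R by [].
have := ler_wpM2l (_ : 0 <= 1 + x) IH; move=> /(_ ltac:(lra)); nra.
Qed.

(** Bernoulli's inequality for (1/t)^n. *)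
Lemma ngeo_bound (t : R) n : 0 <= t < 1 -> n%:R * t ^+ n <= (1 - t)^-1.
Proof.
case/andP=> t0 t1.
have [->|tn0] := eqVneq t 0.
  case: n => [|n]; first by rewrite mul0r invr_ge0; lra.
  by rewrite expr0n /= mulr0 invr_ge0 subr0.
have tp : 0 < t by rewrite lt_def tn0.
have h := @bernoulli (t^-1 - 1) n _.
have h1 : 0 <= t^-1 - 1 by rewrite subr_ge0 -[leLHS]invr1 lef_pV2 ?posrE //; lra.
have {}h := h h1; rewrite (_ : 1 + (t^-1 - 1) = t^-1) in h; last (by ring); rewrite exprVn in h.
have tn : 0 < t ^+ n by rewrite exprn_gt0.
have h2 : n%:R * (t^-1 - 1) <= (t ^+ n)^-1 by lra.
have h3 : n%:R * (t^-1 - 1) * t ^+ n <= 1.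
  by rewrite -ler_pdivlMr // div1r.
rewrite -[leRHS]mul1r ler_pdivlMr; last by lra.
apply: le_trans (_ : t * 1 <= _); last by lra.
have -> : n%:R * t ^+ n * (1 - t) = t * (n%:R * (t^-1 - 1) * t ^+ n) by field.
by rewrite ler_pM2l.
Qed.

Lemma null_geo (t : R) : 0 <= t < 1 -> null (fun n => t ^+ n).
Proof.
move=> ht e e0.
have [K hK] : exists K : nat, (1 - t)^-1 / e < K%:R.
  exists (Num.bound ((1 - t)^-1 / e)); apply: archi_boundP.
  by rewrite divr_ge0 ?invr_ge0; lra.
exists K.+1 => n hn; have := ngeo_bound n ht.
have n0 : (0 : R) < n%:R by rewrite ltr0n (leq_trans _ hn).
rewrite -ler_pdivlMl // => h; apply: le_lt_trans h _.
rewrite mulrC ltr_pdivrMr // mulrC -ltr_pdivrMr //.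
by apply: lt_le_trans hK _; rewrite ler_nat ltnW.
Qed.

Lemma sqrt_unit (t : R) : 0 <= t < 1 -> 0 <= Num.sqrt t < 1.
Proof. by move=> /andP[t0 t1]; rewrite sqrtr_ge0 -[ltRHS]sqrtr1 ltr_sqrt. Qed.

Lemma geo_sum_le (t : R) m n : 0 <= t < 1 ->
  \sum_(m <= i < n) t ^+ i <= t ^+ m / (1 - t).
Proof.
case/andP=> t0 t1; have t2 : 0 < 1 - t by lra.
have [nm|mn] := leqP n m.
  by rewrite big_geq // mulr_ge0 ?exprn_ge0 // invr_ge0 ltW.
rewrite ler_pdivlMr //.
suff -> : (\sum_(m <= i < n) t ^+ i) * (1 - t) = t ^+ m - t ^+ n.
  by rewrite lerBlDr lerDl exprn_ge0.
elim: n mn => // n IH; rewrite ltnS leq_eqVlt => /orP[/eqP<-|mn].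
  by rewrite big_nat1 exprS; ring.
by rewrite big_nat_recr ?(ltnW mn) //= mulrDl IH // exprS; ring.
Qed.

(** Completeness of the complex plane, from that of the real line applied to
    real and imaginary parts. *)
Lemma cauchy_clim u (v : nat -> R) : null v ->
  (forall m n, (m <= n)%N -> nrm (u n - u m) <= v m) ->
  exists l, clim u l.
Proof.
move=> nv hu.
have creal (f : C -> R) : (forall z, `|f z| <= nrm z) -> (forall z w, f (z - w) = f z - f w) ->
    cvgn (fun n => f (u n)).
  move=> hf fB; apply/cauchy_cvgP/cauchy_exP => e e0.
  have [N HN] := nv _ e0; exists (f (u N)).
  exists N => // n /= hn; rewrite /ball /= -fB.
  apply: le_lt_trans (hf _) _; rewrite nrmBC.
  exact: le_lt_trans (hu _ _ hn) (HN N (leqnn _)).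
have /creal cr1 := Re_le_nrm; have /creal cr2 := Im_le_nrm.
have {}cr1 := cr1 ltac:(by case=> ? ? []).
have {}cr2 := cr2 ltac:(by case=> ? ? []).
exists (limn (fun n => complex.Re (u n)) +i* limn (fun n => complex.Im (u n))) => e e0.
have e2 : 0 < e / 2 by lra.
move/cvgrPdist_lt : cr1 => /(_ _ e2) [N1 _ h1].
move/cvgrPdist_lt : cr2 => /(_ _ e2) [N2 _ h2].
exists (maxn N1 N2) => n; rewrite geq_max => /andP[/h1 /= g1 /h2 /= g2].
apply: le_lt_trans (nrm_le_ReIm _) _.
have /= -> : complex.Re (u n - (limn (fun n => complex.Re (u n)) +i* limn (fun n => complex.Im (u n)))) =
  complex.Re (u n) - limn (fun n => complex.Re (u n)) by case: (u n).
have /= -> : complex.Im (u n - (limn (fun n => complex.Re (u n)) +i* limn (fun n => complex.Im (u n)))) =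
  complex.Im (u n) - limn (fun n => complex.Im (u n)) by case: (u n).
by rewrite distrC in g1; rewrite distrC in g2; lra.
Qed.

Lemma geo_series (a : nat -> C) (M t : R) : 0 <= t < 1 -> (forall n, nrm (a n) <= M * t ^+ n) ->
  exists l, clim (fun n => \sum_(i < n) a i) l.
Proof.
move=> ht ha; case/andP: (ht) => t0 t1.
have M0 : 0 <= M by have := ha 0%N; rewrite expr0 mulr1; apply: le_trans.
have n1 : null (fun n => M / (1 - t) * t ^+ n).
  by apply: nullZ (null_geo ht); rewrite divr_ge0 //; lra.
apply: (cauchy_clim n1) => m n mn.
rewrite -!(big_mkord xpredT a) (big_cat_nat (leq0n m) mn) //= addrAC subrr add0r.
apply: le_trans (nrm_sum _ _ _) _.
apply: le_trans (_ : \sum_(m <= i < n) M * t ^+ i <= _).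
  by apply: ler_sum => i _; apply: ha.
rewrite -mulr_sumr mulrAC -mulrA ler_wpM2l //.
exact: geo_sum_le.
Qed.

Lemma geo_tail (a : nat -> C) (M t : R) l : 0 <= t < 1 -> (forall n, nrm (a n) <= M * t ^+ n) ->
  clim (fun n => \sum_(i < n) a i) l ->
  forall n, nrm (l - \sum_(i < n) a i) <= M * t ^+ n / (1 - t).
Proof.
move=> ht ha cl n; case/andP: (ht) => t0 t1.
have M0 : 0 <= M by have := ha 0%N; rewrite expr0 mulr1; apply: le_trans.
have cl2 := climB cl (clim_cst (\sum_(i < n) a i)).
apply: (clim_nrm_le (N := n) _ cl2) => k nk.
rewrite -!(big_mkord xpredT a) (big_cat_nat (leq0n n) nk) //= addrAC subrr add0r.
apply: le_trans (nrm_sum _ _ _) _.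
apply: le_trans (_ : \sum_(n <= i < k) M * t ^+ i <= _).
  by apply: ler_sum => i _; apply: ha.
by rewrite -mulr_sumr -mulrA ler_wpM2l // geo_sum_le.
Qed.
End Base.
#[export] Hint Resolve nrm_ge0 : core.

(** * The complex exponential *)
Section Exp.
Variable R : realType.
Local Notation C := R[i].
Implicit Types (z w u : C) (x y : R).

Lemma abs_sin_le y : `|sin y| <= `|y|.
Proof.
wlog y0 : y / 0 < y => [hw|].
  have [yn0|/hw //|->] := ltgtP y 0; last by rewrite sin0 normr0.
  by have := hw (- y); rewrite sinN !normrN; apply; rewrite oppr_gt0.
have d1 x : x \in `]0, y[ -> is_derive x 1 sin (cos x).
  by move=> _; exact: is_derive_sin.
have d2 : {within `[0, y], continuous (@sin R)}.
  by apply: continuous_subspaceT => x; exact: continuous_sin.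
have [c _] := MVT y0 d1 d2; rewrite sin0 !subr0 => ->; rewrite normrM ler_piMl // cos_max //.
Qed.

Lemma abs_cos_sub1 y : `|cos y - 1| <= y ^+ 2 / 2.
Proof.
have -> : y = y / 2 + y / 2 by field.
rewrite cosD; have h := cos2Dsin2 (y / 2).
have -> : cos (y / 2) * cos (y / 2) - sin (y / 2) * sin (y / 2) - 1 = - (2 * sin (y / 2) ^+ 2).
  by lra.
rewrite normrN normrM normrX normr_nat.
have := abs_sin_le (y / 2); have h0 : 0 <= `|sin (y / 2)| by [].
move=> h1; have h2 : `|sin (y / 2)| ^+ 2 <= `|y / 2| ^+ 2.
  by rewrite lerXn2r ?nnegrE.
apply: le_trans (ler_wpM2l _ h2) _ => //.
by rewrite -normrX ger0_norm ?sqr_ge0 //; lra.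
Qed.

Lemma abs_sin_sub y : `|y| <= 1 -> `|sin y - y| <= y ^+ 2.
Proof.
wlog y0 : y / 0 < y => [hw|].
  have [yn0|/hw //|->] := ltgtP y 0; last by rewrite sin0 subrr normr0 expr0n.
  move=> h; have := hw (- y); rewrite sinN -opprD !normrN sqrrN oppr_gt0; exact.
rewrite gtr0_norm // => y1.
have d1 x : x \in `]0, y[ -> is_derive x 1 (fun x => sin x - x) (cos x - 1).
  by move=> _; apply: is_deriveB.
have d2 : {within `[0, y], continuous (fun x : R => sin x - x)}.
  by apply: continuous_subspaceT => x; apply: cvgB => //; exact: continuous_sin.
have [c] := MVT y0 d1 d2; rewrite in_itv /= => /andP[c0 cy].
rewrite sin0 !subr0 => ->; rewrite normrM.
have h := abs_cos_sub1 c; rewrite (gtr0_norm y0).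
have hc : c ^+ 2 <= y ^+ 2 by rewrite lerXn2r ?nnegrE ?ltW // (lt_trans c0).
have h1 : 0 <= `|cos c - 1| by [].
nra.
Qed.

Lemma expR_sub1 x : `|x| <= 1 / 2 -> `|expR x - 1 - x| <= 2 * x ^+ 2.
Proof.
rewrite ler_norml => /andP[h1 h2].
have l1 := expR_ge1Dx x; have l2 := expR_ge1Dx (- x).
rewrite ger0_norm; last by lra.
have E0 := expR_gt0 x.
have : expR x * (1 - x) <= expR x * expR (- x) by rewrite ler_pM2l.
rewrite -expRD subrr expR0; nra.
Qed.

Lemma cexpD z w : cexp (z + w) = cexp z * cexp w.
Proof.
case: z w => a b [c d]; rewrite /cexp /= expRD cosD sinD.
by apply/eqP; rewrite eq_complex /=; apply/andP; split; apply/eqP; ring.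
Qed.

Lemma nrm_cexp z : nrm (cexp z) = expR (complex.Re z).
Proof.
rewrite /cexp nrmM nrm_real ger0_norm ?expR_ge0 //= cos2Dsin2 sqrtr1 mulr1 //.
Qed.

(** This second order estimate yields the exponential as the limit of
    (1 + z/n)^n, uniformly on bounded sets, and the derivative of e(u) at 0. *)
Lemma cexp_sub1 z : nrm z <= 1 / 2 -> nrm (cexp z - 1 - z) <= 8 * nrm z ^+ 2.
Proof.
case: z => x y hz; have := Re_le_nrm (x +i* y); have := Im_le_nrm (x +i* y).
set N := nrm _ in hz *; move=> hy hx; rewrite /= in hy hx.
have hx2 : `|x| <= 1 / 2 by lra.
have hy2 : `|y| <= 1 by lra.
have e1 := expR_sub1 hx2; have c1 := abs_cos_sub1 y; have s1 := abs_sin_sub hy2.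
have E0 := expR_gt0 x.
have N0 : 0 <= N by exact: nrm_ge0.
have x2 : x ^+ 2 <= N ^+ 2 by rewrite -(real_normK (num_real x)) lerXn2r ?nnegrE.
have y2 : y ^+ 2 <= N ^+ 2 by rewrite -(real_normK (num_real y)) lerXn2r ?nnegrE.
have x3 : x ^+ 2 <= 1 / 4 by nra.
have E2 : expR x <= 2.
  move: e1 hx2; rewrite !ler_norml => /andP[_ h] /andP[_ h']; lra.
apply: le_trans (nrm_le_ReIm _) _.
have -> : complex.Re (cexp (x +i* y) - 1 - (x +i* y)) = (expR x - 1 - x) + expR x * (cos y - 1).
  by rewrite /cexp /=; ring.
have -> : complex.Im (cexp (x +i* y) - 1 - (x +i* y)) = (expR x - 1 - x) * y + x * y + expR x * (sin y - y).
  by rewrite /cexp /=; ring.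
have t1 : `|expR x * (cos y - 1)| <= N ^+ 2.
  rewrite normrM gtr0_norm //; have : 0 <= `|cos y - 1| by []; nra.
have t2 : `|expR x * (sin y - y)| <= 2 * N ^+ 2.
  rewrite normrM gtr0_norm //; have : 0 <= `|sin y - y| by []; nra.
have t3 : `|(expR x - 1 - x) * y| <= 2 * N ^+ 2.
  rewrite normrM; have : 0 <= `|expR x - 1 - x| by []; have : 0 <= `|y| by []; nra.
have t4 : `|x * y| <= N ^+ 2.
  rewrite normrM; have : 0 <= `|x| by []; have : 0 <= `|y| by []; nra.
have := ler_normD (expR x - 1 - x) (expR x * (cos y - 1)).
have := ler_normD ((expR x - 1 - x) * y + x * y) (expR x * (sin y - y)).
have := ler_normD ((expR x - 1 - x) * y) (x * y).
lra.
Qed.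

Definition ee (u : C) : C := cexp (2 * (pi : R)%:C * 'i%C * u).

Lemma eeD u w : ee (u + w) = ee u * ee w.
Proof. by rewrite /ee mulrDr cexpD. Qed.
Lemma ee0 : ee 0 = 1.
Proof.
rewrite /ee mulr0 /cexp /= expR0 cos0 sin0 mul1r; apply/eqP.
by rewrite eq_complex /= !eqxx.
Qed.
Lemma eeN u : ee (- u) = (ee u)^-1.
Proof.
have h : ee (- u) * ee u = 1 by rewrite -eeD addNr ee0.
have nz : ee u != 0 by apply: contra_eq_neq h => ->; rewrite mulr0 eq_sym oner_neq0.
by apply: (mulIf nz); rewrite h mulVf.
Qed.
Lemma ee_neq0 u : ee u != 0.
Proof.
have h : ee (- u) * ee u = 1 by rewrite -eeD addNr ee0.
by apply: contra_eq_neq h => ->; rewrite mulr0 eq_sym oner_neq0.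
Qed.
Lemma eeB u w : ee (u - w) = ee u / ee w. Proof. by rewrite eeD eeN. Qed.
Lemma eeX u n : ee u ^+ n = ee (n%:R * u).
Proof.
elim: n => [|n IH]; first by rewrite mul0r ee0 expr0.
by rewrite exprS IH -eeD -natr1 mulrDl mul1r addrC.
Qed.
Lemma nrm_ee u : nrm (ee u) = expR (- (2 * pi * complex.Im u)).
Proof.
rewrite /ee nrm_cexp; congr expR; case: u => a b.
rewrite /= ; ring.
Qed.
Lemma ee_real x : ee x%:C = cos (2 * pi * x) +i* sin (2 * pi * x).
Proof.
rewrite /ee /cexp.
have -> : complex.Re (2 * (pi:R)%:C * 'i%C * x%:C) = 0 by rewrite /=; ring.
have -> : complex.Im (2 * (pi:R)%:C * 'i%C * x%:C) = 2 * pi * x by rewrite /=; ring.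
by rewrite expR0 mul1r.
Qed.
Lemma ee1 : ee 1 = 1.
Proof.
rewrite -(rmorph1 (real_complex R)) ee_real mulr1.
have -> : 2 * pi = pi *+ 2 :> R by rewrite mulr_natl.
by rewrite cos2pi sin2pi rmorph1.
Qed.
Lemma ee_half : ee (1 / 2) = -1.
Proof.
have -> : 1 / 2 = (2^-1 : R)%:C by rewrite div1r fmorphV rmorph_nat.
rewrite ee_real.
have -> : 2 * pi * 2^-1 = pi :> R by field.
by rewrite cospi sinpi; apply/eqP; rewrite eq_complex /= oppr0 !eqxx.
Qed.
Lemma ee_nat n : ee n%:R = 1.
Proof. by rewrite -[n%:R]mulr1 -eeX ee1 expr1n. Qed.
Lemma ee_int (n : int) : ee n%:~R = 1.
Proof.
case: n => n; first by rewrite -pmulrn ee_nat.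
by rewrite NegzE mulrNz eeN -pmulrn ee_nat invr1.
Qed.
Lemma eeDint u (n : int) : ee (u + n%:~R) = ee u.
Proof. by rewrite eeD ee_int mulr1. Qed.

(** The norm forces the imaginary part to vanish, and cos (2 pi x) = 1 leaves
    only integers. *)
Lemma ee_eq1 u : ee u = 1 -> exists n : int, u = n%:~R.
Proof.
case: u => x y h.
have pi0 := pi_gt0 R.
have y0 : y = 0.
  have := nrm_ee (x +i* y); rewrite h nrm1 -[LHS]expR0 => /expR_inj/esym e0.
  move/eqP: e0; rewrite [complex.Im _]/=; by rewrite oppr_eq0 !mulf_eq0 pnatr_eq0 (gt_eqF pi0) => /eqP.
have {}h : ee (x%:C) = 1 by rewrite -h y0.
exists (Num.floor x); rewrite y0; pose t := x - (Num.floor x)%:~R.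
have ht : ee (t%:C) = 1.
  by rewrite /t rmorphB rmorph_int -mulrN1z -[X in ee (_ - X)]opprK opprK -mulrNz eeDint.
have /andP[t0 t1] : 0 <= t < 1.
  have /andP[] := floor_itv x; rewrite /t intrD; lra.
have [t00|tn0] := eqVneq t 0.
  rewrite -(rmorph_int (real_complex R)); congr Complex.
  by apply/eqP; rewrite -subr_eq0 -/t t00.
move: ht; rewrite ee_real => -[+ _].
have -> : 2 * pi * t = pi * t + pi * t by ring.
rewrite cosD; have := cos2Dsin2 (pi * t).
have : 0 < sin (pi * t).
  have tp : 0 < t by rewrite lt_def tn0.
  by apply: sin_gt0_pi; apply/andP; split; nra.
move=> *; exfalso; nra.
Qed.
End Exp.

(** * Partitions, ranks and Dyson's map *)
Section Partitions.
Local Open Scope nat_scope.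

Definition parts n : seq (seq nat) :=
  [seq l <- [seq [seq nat_of_ord i | i <- s] | s : {bseq n of 'I_n.+1}] | is_partition n l].

Lemma size_le_sumn l : 0 \notin l -> size l <= sumn l.
Proof. elim: l => //= a l IH; rewrite inE negb_or => /andP[a0 /IH]; lia. Qed.

Lemma mem_le_sumn l a : a \in l -> a <= sumn l.
Proof. elim: l => //= b l IH; rewrite inE => /orP[/eqP ->|/IH]; lia. Qed.

Lemma mem_parts n l : (l \in parts n) = is_partition n l.
Proof.
rewrite mem_filter; case hl: (is_partition n l) => //=.
case/and3P: (hl) => _ l0 /eqP sl.
have sz : size (map (@inord n) l) <= n by rewrite size_map -sl size_le_sumn.
apply/mapP; exists (Bseq sz); rewrite ?mem_enum //=.
rewrite -map_comp -[LHS]map_id; apply/eq_in_map => a al /=.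
by rewrite inordK // ltnS -sl mem_le_sumn.
Qed.

Lemma uniq_parts n : uniq (parts n).
Proof.
apply: filter_uniq; rewrite map_inj_uniq ?enum_uniq // => s t h.
by apply: val_inj; apply: inj_map h; exact: ord_inj.
Qed.

(** The duplicate-free list [parts n] turns counts of partitions into counts on
    lists, where bijections are easier to use. *)
Lemma rank_countE r t n :
  rank_count r t n = count (fun l => (rank l == r%:Z %[mod t%:Z])%Z) (parts n).
Proof.
rewrite /rank_count cardE /enum_mem size_filter /parts count_filter count_map.
by rewrite enumT; apply: eq_count => s /=; rewrite !inE andbC.
Qed.

Lemma count_bij (T : eqType) (s s' : seq T) (P Q : pred T) (f g : T -> T) :
  uniq s -> uniq s' ->
  (forall x, x \in s -> P x -> [/\ f x \in s', Q (f x) & g (f x) = x]) ->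
  (forall x, x \in s' -> Q x -> [/\ g x \in s, P (g x) & f (g x) = x]) ->
  count P s = count Q s'.
Proof.
move=> us us' h h'.
have key (a b : seq T) (A B : pred T) (u v : T -> T) : uniq a -> uniq b ->
    (forall x, x \in a -> A x -> [/\ u x \in b, B (u x) & v (u x) = x]) -> count A a <= count B b.
  move=> ua ub H; rewrite -!size_filter -(size_map u); apply: uniq_leq_size.
    rewrite map_inj_in_uniq ?filter_uniq // => x y.
    rewrite !mem_filter => /andP[ax xa] /andP[ay ya] e.
    by have [_ _ <-] := H _ xa ax; have [_ _ <-] := H _ ya ay; rewrite e.
  move=> y /mapP[x]; rewrite !mem_filter => /andP[ax xa] ->.
  by have [-> ->] := H _ xa ax.
by apply/eqP; rewrite eqn_leq; apply/andP; split; [apply: key h|apply: key h'].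
Qed.

(** Dyson's map: delete the first column of the Ferrers diagram, that is, lower
    every part by 1, and add a part of size l + r - 1, where l is the number of
    parts.  The bound r on the rank is what makes the new part the largest. *)
Definition dyson (r : int) (l : seq nat) : seq nat :=
  let t := [seq x <- map predn l | 0 < x] in
  let h := `|((size l)%:Z + r - 1)%R|%N in if h == 0 then t else h :: t.

(** Since the new part has size k + r - 1, where k is the number of parts of the
    original partition, k can be read off, and it tells how many parts equal to 1
    were lost. *)
Definition undyson (r : int) (m : seq nat) : seq nat :=
  let k := `|((head 0 m)%:Z - r + 1)%R|%N in
  map succn (behead m) ++ nseq (k - size (behead m)) 1.

Lemma geq_trans : transitive geq.
Proof. by move=> a b c h1 h2; apply: leq_trans h2 h1. Qed.

Lemma path_geq h t : path geq h t = (head 0 t <= h) && sorted geq t.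
Proof. by case: t => //= a t. Qed.

Lemma sorted_ones l : 0 \notin l -> path geq 1 l -> l = nseq (size l) 1.
Proof.
elim: l => //= a l IH; rewrite inE negb_or => /andP[a0 l0] /andP[a1 pl].
have e : a = 1 by move: a0 a1; rewrite /geq /=; lia.
by move: pl; rewrite e => /(IH l0) {1}->.
Qed.

Lemma strip_sum l : 0 \notin l -> sumn [seq x <- map predn l | 0 < x] + size l = sumn l.
Proof.
elim: l => //= a l IH; rewrite inE negb_or => /andP[a0 /IH]; case: ifP => /=; lia.
Qed.

Lemma strip_size l : size [seq x <- map predn l | 0 < x] <= size l.
Proof. by rewrite size_filter -(size_map predn l) count_size. Qed.

Lemma strip_notin0 l : 0 \notin [seq x <- map predn l | 0 < x].
Proof. by rewrite mem_filter. Qed.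

Lemma strip_sorted l : sorted geq l -> sorted geq [seq x <- map predn l | 0 < x].
Proof.
move=> sl; apply: sorted_filter; first exact: geq_trans.
by apply: homo_sorted sl => a b; rewrite /geq /=; lia.
Qed.

Lemma strip_ones n : [seq x <- map predn (nseq n 1) | 0 < x] = [::].
Proof. by elim: n. Qed.

Lemma strip_head l : 0 \notin l -> sorted geq l ->
  head 0 [seq x <- map predn l | 0 < x] = (head 0 l).-1.
Proof.
case: l => //= a l; rewrite inE negb_or => /andP[a0 l0] pl; case: ifP => //= a1.
have e : a = 1 by lia.
by rewrite e in pl *; rewrite (sorted_ones l0 pl) strip_ones.
Qed.

Lemma stripK l : 0 \notin l -> sorted geq l ->
  let t := [seq x <- map predn l | 0 < x] in
  map succn t ++ nseq (size l - size t) 1 = l.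
Proof.
elim: l => //= a l IH; rewrite inE negb_or => /andP[a0 l0] pl.
case: ifP => /= a1.
  by rewrite subSS IH ?(path_sorted pl) //; congr cons; lia.
have e : a = 1 by lia.
rewrite e in pl *; rewrite [in LHS](sorted_ones l0 pl) strip_ones /= size_nseq.
by rewrite -(sorted_ones l0 pl).
Qed.

Lemma dyson_spec (r : int) n n' l : (n'%:Z = n%:Z + r - 1)%R ->
  is_partition n l -> (rank l <= r)%R ->
  [/\ is_partition n' (dyson r l), (r - 2 <= rank (dyson r l))%R & undyson r (dyson r l) = l].
Proof.
move=> hn /and3P[sl l0 /eqP suml]; rewrite /rank => hr.
have ts := strip_sorted sl; have tsum := strip_sum l0; have tsz := strip_size l.
have thd := strip_head l0 sl; have tK := stripK l0 sl; have t0 := strip_notin0 l.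
rewrite /dyson; set t := [seq _ <- _ | _] in ts tsum tsz thd tK t0 *.
have hge : ((size l)%:Z + r - 1 >= (head 0 l).-1%:Z)%R.
  move: l0 suml hr; case: (l) => [|a l'] /=; first by lia.
  by rewrite inE negb_or => /andP[a0 _]; lia.
have hh : ((`|((size l)%:Z + r - 1)%R|%N)%:Z = (size l)%:Z + r - 1)%R by lia.
move: hh; set h := `|_|%N => hh; clearbody t h.
case: ifP => /= h0.
  have hl1 : (head 0 l).-1 = 0 by lia.
  have te : t = [::].
    by move: t0 thd; rewrite hl1; case: (t) => //= b t'; rewrite inE negb_or => /andP[b0 _]; lia.
  rewrite te /= in tsum tK *; split.
  - by apply/and3P; split=> //=; lia.
  - rewrite /rank /=; lia.
  - rewrite /undyson /=; rewrite -[RHS]tK !subn0; congr nseq; lia.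
split.
- apply/and3P; split.
  + by rewrite /= path_geq ts andbT thd; lia.
  + by rewrite inE negb_or t0 andbT; lia.
  + by apply/eqP; rewrite -[sumn (h :: t)]/(h + sumn t); move: hn hh tsum suml; move: (sumn t) (sumn l) (size l) => a b c; clear; lia.
- rewrite /rank /=; lia.
- rewrite /undyson /= -[RHS]tK; congr (_ ++ nseq _ _); congr subn.
  move: hh; move: (size l) => c; clear; lia.
Qed.

Lemma undyson_spec (r : int) n n' m : (n'%:Z = n%:Z + r - 1)%R ->
  is_partition n' m -> (r - 2 <= rank m)%R ->
  [/\ is_partition n (undyson r m), (rank (undyson r m) <= r)%R & dyson r (undyson r m) = m].
Proof.
move=> hn /and3P[sm m0 /eqP summ]; rewrite /rank => hr.
have strip_app a b : 0 \notin a -> [seq x <- map predn (map succn a ++ nseq b 1) | 0 < x] = a.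
  move=> a0; rewrite map_cat filter_cat strip_ones cats0 -map_comp map_id_in //.
  by apply/all_filterP/allP => x xa; rewrite lt0n; apply: contraNneq a0 => <-.
case: m m0 sm summ hr => [|a m] /=.
  move=> _ _ hn' hr; rewrite /undyson /dyson /= subn0.
  have e : (`|(0%:Z - r + 1)%R|%N)%:Z = (1 - r)%R by lia.
  set k := `|_|%N in e *; rewrite strip_ones size_nseq; split.
  - apply/and3P; split; [by case: (k) => //= k'; elim: k' | by elim: (k) |].
    by rewrite sumn_nseq mul1n; lia.
  - by case: (k) e => [|k'] /=; lia.
  - by rewrite (_ : `|_|%N = 0) //; lia.
rewrite inE negb_or => /andP[a0 m0] pm summ hr.
rewrite /undyson /dyson /= size_cat size_map size_nseq strip_app //.
set k := `|_|%N; have e : (k%:Z = a%:Z - r + 1)%R by rewrite /k; lia.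
have km : size m <= k by lia.
rewrite subnKC //.
have -> : `|(k%:Z + r - 1)%R|%N = a by lia.
move: pm; rewrite path_geq => /andP[hm sm].
rewrite ifN; last by lia.
split=> //.
- apply/and3P; split.
  + have : sorted geq (map succn m) by apply: homo_sorted sm => x y; rewrite /geq /=; lia.
    rewrite (sorted_pairwise geq_trans) => pw.
    rewrite (sorted_pairwise geq_trans) pairwise_cat pw /=; apply/andP; split.
      by apply/allrelP => x y /mapP[x' _ ->]; rewrite mem_nseq => /andP[_ /eqP ->].
    rewrite -(sorted_pairwise geq_trans); by case: (k - size m) => //= k'; elim: k'.
  + rewrite mem_cat negb_or mem_nseq andbF andbT; apply/negP => /mapP[] //.
  + rewrite sumn_cat sumn_nseq mul1n.
    have -> : sumn (map succn m) = sumn m + size m by elim: (m) => //= x y ->; lia.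
    lia.
- case: (m) hm km => [|b m'] /=; last by lia.
  by case: (k - 0) => [|k'] /=; lia.
Qed.

Definition cge (r : int) n := count (fun l => (r <= rank l)%R) (parts n).
Definition cle (r : int) n := count (fun l => (rank l <= r)%R) (parts n).
Definition pn n := size (parts n).

(** What is left after removing the first column has at most l parts, and the new
    largest part is l + r - 1, so the rank of the image is at least r - 2. *)
Lemma dyson_count (r : int) n n' : (n'%:Z = n%:Z + r - 1)%R -> cle r n = cge (r - 2)%R n'.
Proof.
move=> hn; apply: (@count_bij _ _ _ _ _ (dyson r) (undyson r)); rewrite ?uniq_parts // => l;
  rewrite mem_parts => hl hr.
  by have [? ? ?] := dyson_spec hn hl hr; rewrite mem_parts.
by have [? ? ?] := undyson_spec hn hl hr; rewrite mem_parts.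
Qed.

Lemma cge_cle (r : int) n : cge r n + cle (r - 1)%R n = pn n.
Proof.
rewrite /cge /cle /pn -(count_predC (fun l => (r <= rank l)%R) (parts n)).
by congr addn; apply: eq_count => l /=; lia.
Qed.

Lemma rank_bound n l : is_partition n l -> (rank l <= n%:Z - (0 < n)%:R)%R /\ (- (n%:Z - (0 < n)%:R) <= rank l)%R.
Proof.
case/and3P=> sl l0 /eqP <-; have := size_le_sumn l0; rewrite /rank.
case: l sl l0 => [|a l] /=; first by [].
rewrite inE negb_or => _ /andP[a0 l0]; have := size_le_sumn l0.
have -> : 0 < a + sumn l by lia.
lia.
Qed.

Lemma cge_small r n : (0 < r) -> n <= r -> cge r%:Z n = 0.
Proof.
move=> r0 nr; apply/eqP; rewrite -leqn0 leqNgt -has_count; apply/hasPn => l.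
rewrite mem_parts => /rank_bound[+ _]; case: (n) nr => [|k] /=; lia.
Qed.

Lemma cle_small r n : (0 < r) -> n <= r -> cle (- r%:Z)%R n = 0.
Proof.
move=> r0 nr; apply/eqP; rewrite -leqn0 leqNgt -has_count; apply/hasPn => l.
rewrite mem_parts => /rank_bound[_ +]; case: (n) nr => [|k] /=; lia.
Qed.

(** Dyson's map with bound r + 2, followed by passing to the complementary set of
    partitions of n. *)
Lemma cge_rec r n : cge r%:Z (n + r.+1) + cge (r + 3)%:Z n = pn n.
Proof.
have e := @dyson_count (r%:Z + 2)%R n (n + r.+1) ltac:(lia).
rewrite addrK in e; rewrite -e -(cge_cle (r + 3)%:Z n) addnC; congr (_ + cle _ _); lia.
Qed.

Lemma cle_rec r n : cle (- r%:Z)%R (n + r.+1) + cle (- (r + 3)%:Z)%R n = pn n.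
Proof.
rewrite (@dyson_count (- r%:Z)%R _ n); last by lia.
rewrite -(cge_cle (- r%:Z - 2)%R n); congr (_ + cle _ _); lia.
Qed.

(** The symmetry of the rank under conjugation follows from the fact that both
    sides satisfy the same recursion with the same initial values; no conjugate
    partition has to be constructed. *)
Lemma cge_conj r n : 0 < r -> cge r%:Z n = cle (- r%:Z)%R n.
Proof.
have [k] := ubnP n; elim: k n r => // k IH n r nk r0.
have [nr|rn] := leqP n r; first by rewrite cge_small ?cle_small.
have en : n = (n - r.+1) + r.+1 by lia.
have h1 := cge_rec r (n - r.+1); have h2 := cle_rec r (n - r.+1).
rewrite -en in h1 h2; have := IH (n - r.+1) (r + 3); lia.
Qed.

(** The case r = 0 of the recursion, where the symmetry of the rank rewrites
    the count of nonnegative ranks. *)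
Lemma pn_rec n : pn n.+1 + cge 3%:Z n = pn n + cge 1%:Z n.+1.
Proof.
have h0 := cge_rec 0 n; rewrite addn1 add0n in h0.
have := cge_cle 0%:Z n.+1; rewrite (@cge_conj 1) //.
have -> : (0%:Z - 1 = - 1%:Z)%R by lia.
lia.
Qed.

Definition ple N n := count (fun l => head 0 l <= N) (parts n).

Lemma ple0 n : ple 0 n = (n == 0).
Proof.
rewrite /ple; have -> : count (fun l => head 0 l <= 0) (parts n) = count (pred1 [::]) (parts n).
  apply: eq_in_count => l; rewrite mem_parts => /and3P[_ + _].
  by case: l => //= a l; rewrite inE negb_or => /andP[a0 _]; rewrite leqn0 eq_sym (negbTE a0).
rewrite count_uniq_mem ?uniq_parts // mem_parts /is_partition /= eq_sym; by case: eqP.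
Qed.

(** A partition with largest part at most N + 1 either has no part N + 1 or
    arises from adding one. *)
Lemma ple_rec N n : ple N.+1 (n + N.+1) = ple N (n + N.+1) + ple N.+1 n.
Proof.
rewrite {1 2}/ple.
have -> : ple N.+1 n = count (fun l => head 0 l == N.+1) (parts (n + N.+1)).
  apply: (@count_bij _ _ _ _ _ (cons N.+1) behead); rewrite ?uniq_parts // => l;
     rewrite mem_parts => /and3P[sl l0 /eqP suml] h.
    by split=> //; rewrite ?mem_parts //=; apply/and3P; split=> //=; rewrite ?path_geq ?h ?inE //; lia.
  case: l sl l0 suml h => //= a l; rewrite inE path_geq negb_or => /andP[h1 h2] /andP[a0 l0] h3 /eqP e.
  rewrite e in h1 h3 *; split=> //; rewrite mem_parts; apply/and3P; split=> //; lia.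
rewrite -count_predUI -[LHS]addn0; congr addn.
  by apply: eq_count => l /=; lia.
by apply/esym/eqP; rewrite -leqn0 leqNgt -has_count; apply/hasPn => l _ /=; lia.
Qed.

Lemma ple_small N n : n < N.+1 -> ple N.+1 n = ple N n.
Proof.
move=> nN; apply: eq_in_count => l; rewrite mem_parts => /and3P[_ _ /eqP e].
have : head 0 l <= sumn l by case: (l) => //= a l'; lia.
lia.
Qed.

Lemma ple_pn N n : n <= N -> ple N n = pn n.
Proof.
move=> nN; rewrite /ple /pn -[RHS]count_predT; apply: eq_in_count => l; rewrite mem_parts => /and3P[_ _ /eqP e].
have : head 0 l <= sumn l by case: (l) => //= a l'; lia.
rewrite /=; lia.
Qed.

End Partitions.

(** * Infinite products (x;q) *)
Lemma prim_prod (F : fieldType) (w y : F) m : m.-primitive_root w ->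
  \prod_(k < m) (1 - y * w ^+ k) = 1 - y ^+ m.
Proof.
move=> pw; have [->|y0] := eqVneq y 0.
  rewrite big1 => [|i _]; last by rewrite mul0r subr0.
  by rewrite expr0n gtn_eqF ?(prim_order_gt0 pw) // subr0.
have h : \prod_(i < m) (y^-1 - w ^+ i) = y^-1 ^+ m - 1.
  have := congr1 (fun p : {poly F} => p.[y^-1]) (factor_Xn_sub_1 pw).
  rewrite big_mkord horner_prod hornerD hornerN hornerXn hornerC => <-.
  by apply: eq_bigr => i _; rewrite hornerXsubC.
transitivity (y ^+ m * (y^-1 ^+ m - 1)); last by rewrite exprVn mulrBr mulfV ?expf_neq0 // mulr1.
rewrite -h -[m in y ^+ m]card_ord -prodr_const -big_split /=.
by apply: eq_bigr => i _; rewrite mulrBr mulfV.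
Qed.

Section Products.
Variable R : realType.
Local Notation C := R[i].
Implicit Types (x q : C) (t K th : R) (a : nat -> C).

Definition poch_ub t K : R := expR (K / (1 - t)).

Lemma geo_sum_le0 t n : 0 <= t < 1 -> \sum_(i < n) t ^+ i <= (1 - t)^-1.
Proof. by move=> ht; have := geo_sum_le 0 n ht; rewrite expr0 div1r big_mkord. Qed.

Lemma prod_bound a t K n : 0 <= t < 1 -> (forall i, nrm (a i) <= K * t ^+ i) ->
  nrm (\prod_(i < n) (1 - a i)) <= poch_ub t K.
Proof.
move=> ht ha; case/andP: (ht) => t0 t1.
have K0 : 0 <= K by have := ha 0%N; rewrite expr0 mulr1; apply: le_trans.
rewrite nrm_prod; apply: (@le_trans _ _ (expR (\sum_(i < n) K * t ^+ i))); last first.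
  rewrite ler_expR -mulr_sumr ler_wpM2l // geo_sum_le0 //.
rewrite expR_sum; apply: ler_prod => i _; rewrite nrm_ge0 /=.
apply: le_trans (nrmB _ _) _; rewrite nrm1.
by apply: le_trans (expR_ge1Dx _); rewrite lerD2l.
Qed.

Lemma prod_cauchy a t K m n : 0 <= t < 1 -> (forall i, nrm (a i) <= K * t ^+ i) -> (m <= n)%N ->
  nrm (\prod_(i < n) (1 - a i) - \prod_(i < m) (1 - a i)) <= poch_ub t K * K / (1 - t) * t ^+ m.
Proof.
move=> ht ha mn; case/andP: (ht) => t0 t1.
have K0 : 0 <= K by have := ha 0%N; rewrite expr0 mulr1; apply: le_trans.
have B0 : 0 <= poch_ub t K by exact: expR_ge0.
apply: (@le_trans _ _ (poch_ub t K * K * \sum_(m <= i < n) t ^+ i)); last first.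
  by rewrite -!mulrA ler_wpM2l // ler_wpM2l // mulrC geo_sum_le.
elim: n mn => [|n IH].
  by rewrite leqn0 => /eqP ->; rewrite subrr nrm0 big_geq // mulr0.
rewrite leq_eqVlt => /orP[/eqP ->|]; first by rewrite subrr nrm0 big_geq // mulr0.
rewrite ltnS => mn; rewrite big_nat_recr //= mulrDr.
rewrite big_ord_recr /= (_ : _ - _ = (\prod_(i < n) (1 - a i) - \prod_(i < m) (1 - a i)) + - ((\prod_(i < n) (1 - a i)) * a n)); last by ring.
apply: le_trans (nrmD _ _) _; apply: lerD; first exact: IH.
rewrite nrmN nrmM -mulrA; apply: ler_pM => //; exact: prod_bound.
Qed.

Lemma prod_clim a t K : 0 <= t < 1 -> (forall i, nrm (a i) <= K * t ^+ i) ->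
  exists l, clim (fun n => \prod_(i < n) (1 - a i)) l.
Proof.
move=> ht ha; case/andP: (ht) => t0 t1.
have K0 : 0 <= K by have := ha 0%N; rewrite expr0 mulr1; apply: le_trans.
apply: (@cauchy_clim _ _ (fun m => poch_ub t K * K / (1 - t) * t ^+ m)).
  apply: nullZ (null_geo ht); rewrite divr_ge0 ?mulr_ge0 ?expR_ge0 //; lra.
by move=> m n; exact: prod_cauchy.
Qed.

Lemma prod_tail a t K l n : 0 <= t < 1 -> (forall i, nrm (a i) <= K * t ^+ i) ->
  clim (fun n => \prod_(i < n) (1 - a i)) l ->
  nrm (l - \prod_(i < n) (1 - a i)) <= poch_ub t K * K / (1 - t) * t ^+ n.
Proof.
move=> ht ha cl; apply: (clim_nrm_le (N := n) _ (climB cl (clim_cst _))) => k nk.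
exact: prod_cauchy.
Qed.

Definition poch_lb t th : R := expR (- (th / (1 - th) / (1 - t))).

(** The bound 1 - y >= exp (- y / (1 - y)) makes the partial products bounded
    below uniformly, so that 1/(x;q) is a uniform limit as well. *)
Lemma prod_lower a t th n : 0 <= t < 1 -> th < 1 -> (forall i, nrm (a i) <= th * t ^+ i) ->
  poch_lb t th <= nrm (\prod_(i < n) (1 - a i)).
Proof.
move=> ht th1 ha; case/andP: (ht) => t0 t1.
have th0 : 0 <= th by have := ha 0%N; rewrite expr0 mulr1; apply: le_trans.
have d0 : 0 < 1 - th by lra.
rewrite nrm_prod; apply: (@le_trans _ _ (expR (\sum_(i < n) - (th / (1 - th) * t ^+ i)))).
  rewrite ler_expR sumrN lerN2 -mulr_sumr ler_wpM2l ?geo_sum_le0 //.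
  by rewrite divr_ge0 // ltW.
rewrite expR_sum; apply: ler_prod => i _; rewrite expR_ge0 /=.
have tb : th * t ^+ i <= th by rewrite ler_piMr // exprn_ile1 // ltW.
apply: (@le_trans _ _ (1 - th * t ^+ i)); last first.
  by have := nrm_subl 1 (a i); have := ha i; rewrite nrm1; lra.
set b := th * t ^+ i in tb *.
have b0 : 0 <= b by rewrite mulr_ge0 ?exprn_ge0.
rewrite expRN -[leRHS]invrK lef_pV2 ?posrE ?expR_gt0 ?invr_gt0 //; last by lra.
have -> : th / (1 - th) * t ^+ i = b / (1 - th) by rewrite /b mulrAC.
apply: le_trans (expR_ge1Dx _).
apply: (@le_trans _ _ (1 + b / (1 - b))).
  by rewrite [leRHS](_ : _ = (1 - b)^-1) //; field; lra.
rewrite lerD2l ler_wpM2l // lef_pV2 ?posrE ?subr_gt0 //; last exact: le_lt_trans tb th1.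
by rewrite lerD2l lerN2.
Qed.

Definition pochn x q n : C := \prod_(i < n) (1 - x * q ^+ i).
Definition poch x q : C := limn (fun n => (pochn x q n : C^o)).

Lemma poch_term x q t K i : nrm q <= t -> nrm x <= K -> nrm (x * q ^+ i) <= K * t ^+ i.
Proof.
by move=> hq hx; rewrite nrmM nrmX ler_pM ?exprn_ge0 // lerXn2r ?nnegrE // (le_trans _ hq).
Qed.

Lemma nrm_itv q : nrm q < 1 -> 0 <= nrm q < 1.
Proof. by rewrite nrm_ge0. Qed.

Lemma poch_clim x q : nrm q < 1 -> clim (pochn x q) (poch x q).
Proof.
move=> q1; have [l cl] := prod_clim (nrm_itv q1) (fun i => poch_term i (lexx (nrm q)) (lexx (nrm x))).
by rewrite /poch (clim_lim cl).
Qed.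

Lemma poch_tail x q t K n : 0 <= t < 1 -> nrm q <= t -> nrm x <= K ->
  nrm (poch x q - pochn x q n) <= poch_ub t K * K / (1 - t) * t ^+ n.
Proof.
move=> ht hq hx; apply: (prod_tail (a := fun i => x * q ^+ i)) => // [i|]; first exact: poch_term.
by apply: poch_clim; case/andP: ht => _; apply: le_lt_trans.
Qed.

Lemma pochn_lower x q t th n : 0 <= t < 1 -> nrm q <= t -> nrm x <= th -> th < 1 ->
  poch_lb t th <= nrm (pochn x q n).
Proof. by move=> ht hq hx h1; apply: (prod_lower (a := fun i => x * q ^+ i)) => // i; exact: poch_term. Qed.

Lemma clim_nrm_ge (u : nat -> C) l (M : R) : (forall n, M <= nrm (u n)) -> clim u l -> M <= nrm l.
Proof.
move=> hu cu; rewrite leNgt; apply/negP => hM.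
have /cu [K HK] : 0 < M - nrm l by rewrite subr_gt0.
by have := HK K (leqnn _); have := hu K; have := nrm_subl (u K) l; lra.
Qed.

Lemma poch_lower x q t th : 0 <= t < 1 -> nrm q <= t -> nrm x <= th -> th < 1 ->
  poch_lb t th <= nrm (poch x q).
Proof.
move=> ht hq hx h1; have q1 : nrm q < 1 by case/andP: ht => _; apply: le_lt_trans.
by apply: (clim_nrm_ge _ (poch_clim x q1)) => n; exact: pochn_lower.
Qed.

Lemma pochn_split x q m n : pochn x q (m + n) = pochn x q m * pochn (x * q ^+ m) q n.
Proof.
rewrite /pochn big_split_ord /=; congr (_ * _).
by apply: eq_bigr => i _; rewrite exprD mulrA.
Qed.

Lemma poch_split x q m : nrm q < 1 -> poch x q = pochn x q m * poch (x * q ^+ m) q.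
Proof.
move=> q1; apply: (clim_uniq (clim_addn m (poch_clim x q1))).
apply: clim_ext (climZ (pochn x q m) (poch_clim (x * q ^+ m) q1)) => n.
by rewrite addnC pochn_split.
Qed.

Lemma poch_rec x q : nrm q < 1 -> poch x q = (1 - x) * poch (x * q) q.
Proof. by move=> q1; rewrite (poch_split x 1 q1) /pochn big_ord1 expr0 mulr1 expr1. Qed.

Lemma poch_neq0 x q : nrm q < 1 -> (forall n, x * q ^+ n != 1) -> poch x q != 0.
Proof.
move=> q1 hx; have hq := nrm_itv q1.
have [N HN] : exists N, nrm x * nrm q ^+ N < 1 / 2.
  have h2 : (0 : R) < 1 / 2 by lra.
  by have [N HN] := nullZ (nrm_ge0 x) (null_geo hq) h2; exists N; apply: HN.
rewrite (poch_split x N q1) mulf_neq0 //.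
  apply/prodf_neq0 => i _; by rewrite subr_eq0 eq_sym.
rewrite -nrm_gt0; apply: lt_le_trans (expR_gt0 _) (poch_lower (th := 1 / 2) hq (lexx _) _ _).
  by rewrite nrmM nrmX ltW.
lra.
Qed.

Lemma poch_eq0 x q n : nrm q < 1 -> x * q ^+ n = 1 -> poch x q = 0.
Proof.
move=> q1 e; rewrite (poch_split x n.+1 q1) /pochn big_ord_recr /= e subrr.
by rewrite mulr0 mul0r.
Qed.

(** Split the exponents into residue classes modulo m. *)
Lemma poch_res x q m : nrm q < 1 -> (0 < m)%N ->
  poch x q = \prod_(k < m) poch (x * q ^+ k) (q ^+ m).
Proof.
move=> q1 m0; have qm : nrm (q ^+ m) < 1 by rewrite nrmX exprn_ilt1 // -lt0n.
have c1 := clim_prod (index_enum 'I_m) (fun k : 'I_m => poch_clim (x * q ^+ k) qm).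
apply: clim_uniq c1; apply: clim_ext (clim_sub (f := fun n => (n * m)%N) _ (poch_clim x q1)).
  move=> n; rewrite /pochn exchange_big /= /=.
  elim: n => [|n IH]; first by rewrite mul0n !big_ord0.
  rewrite mulSnr big_split_ord /= IH big_ord_recr /=; congr (_ * _).
  by apply: eq_bigr => i _; rewrite -mulrA -exprM -exprD mulnC addnC.
move=> N; exists N => n nN; apply: leq_trans nN _; by rewrite leq_pmulr.
Qed.

(** Factorwise, this is the factorization of 1 - y^m over the m-th roots of
    unity. *)
Lemma poch_prim (w x q : C) m : nrm q < 1 -> m.-primitive_root w ->
  \prod_(k < m) poch (x * w ^+ k) q = poch (x ^+ m) (q ^+ m).
Proof.
move=> q1 pw; have m0 := prim_order_gt0 pw.
have qm : nrm (q ^+ m) < 1 by rewrite nrmX exprn_ilt1 // -lt0n.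
have c1 := clim_prod (index_enum 'I_m) (fun k : 'I_m => poch_clim (x * w ^+ k) q1).
apply: (clim_uniq c1); apply: clim_ext (poch_clim _ qm) => n.
rewrite /pochn exchange_big /=; apply: eq_bigr => i _.
rewrite -exprM mulnC exprM -exprMn -(prim_prod _ pw); apply: eq_bigr => k _.
by rewrite mulrAC.
Qed.

End Products.

(** * Uniform closures of algebras of functions *)
Section Closure.
Variables (R : realType) (T : Type).
Local Notation C := R[i].
Variables (S : T -> Prop) (gen : (T -> C) -> Prop).

(** Taking for [gen] the identity, or the identity and the inverse, gives the
    polynomials, respectively the Laurent polynomials. *)
Inductive alg : (T -> C) -> Prop :=
| alg_cst c : alg (fun _ => c)
| alg_gen f : gen f -> alg f
| alg_add f g : alg f -> alg g -> alg (fun x => f x + g x)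
| alg_mul f g : alg f -> alg g -> alg (fun x => f x * g x).

Definition bddS (f : T -> C) := exists M : R, forall x, S x -> nrm (f x) <= M.
(** Uniform approximability on [S] plays the part of holomorphy: it is stable
    under the operations that build theta functions, and everything needed from
    complex analysis can be proved for polynomials first and then passed to the
    limit. *)
Definition unif (f : T -> C) :=
  forall e : R, 0 < e -> exists g, alg g /\ forall x, S x -> nrm (f x - g x) <= e.

Hypothesis gen_bdd : forall f, gen f -> bddS f.

Lemma bdd_gt0 f : bddS f -> exists M : R, 0 < M /\ forall x, S x -> nrm (f x) <= M.
Proof.
case=> M HM; exists (`|M| + 1); split; first by rewrite ltr_wpDl.
by move=> x /HM h; have := ler_norm M; lra.
Qed.

Lemma alg_bdd f : alg f -> bddS f.
Proof.
elim=> [c|g /gen_bdd //|g h _ [M HM] _ [N HN]|g h _ [M HM] _ [N HN]].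
- by exists (nrm c).
- by exists (M + N) => x Sx; apply: le_trans (nrmD _ _) _; apply: lerD; auto.
- by exists (M * N) => x Sx; rewrite nrmM ler_pM //; auto.
Qed.

Lemma unif_alg f : alg f -> unif f.
Proof. by move=> af e e0; exists f; split=> // x _; rewrite subrr nrm0 ltW. Qed.

Lemma unif_cst c : unif (fun _ => c).
Proof. exact/unif_alg/alg_cst. Qed.

Lemma unif_gen f : gen f -> unif f.
Proof. by move=> gf; apply/unif_alg/alg_gen. Qed.

Lemma unif_bdd f : unif f -> bddS f.
Proof.
move=> /(_ 1 ltr01) [g [/alg_bdd [M HM] hg]]; exists (M + 1) => x Sx.
by have := hg x Sx; have := HM x Sx; have := nrm_subl (f x) (g x); lra.
Qed.

Lemma unif_ext f g : (forall x, S x -> f x = g x) -> unif f -> unif g.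
Proof. by move=> fg uf e /uf [h [ah hh]]; exists h; split=> // x Sx; rewrite -fg ?hh. Qed.

Lemma unif_lim f : (forall e : R, 0 < e -> exists g, unif g /\ forall x, S x -> nrm (f x - g x) <= e) ->
  unif f.
Proof.
move=> uf e e0; have e2 : 0 < e / 2 by lra.
have [g [ug hg]] := uf _ e2; have [h [ah hh]] := ug _ e2.
exists h; split=> // x Sx; have -> : f x - h x = (f x - g x) + (g x - h x) by ring.
by apply: le_trans (nrmD _ _) _; have := hg x Sx; have := hh x Sx; lra.
Qed.

Lemma unifD f g : unif f -> unif g -> unif (fun x => f x + g x).
Proof.
move=> uf ug e e0; have e2 : 0 < e / 2 by lra.
have [f' [af hf]] := uf _ e2; have [g' [ag hg]] := ug _ e2.
exists (fun x => f' x + g' x); split; first exact: alg_add.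
move=> x Sx; have -> : f x + g x - (f' x + g' x) = (f x - f' x) + (g x - g' x) by ring.
by apply: le_trans (nrmD _ _) _; have := hf x Sx; have := hg x Sx; lra.
Qed.

Lemma unifM f g : unif f -> unif g -> unif (fun x => f x * g x).
Proof.
move=> uf ug; have [M [M0 HM]] := bdd_gt0 (unif_bdd uf).
apply: unif_lim => e e0; have e1 : 0 < e / M by rewrite divr_gt0.
have [g' [ag hg]] := ug _ e1; exists (fun x => f x * g' x); split; last first.
  move=> x Sx; rewrite -mulrBr nrmM.
  by have := ler_pM (nrm_ge0 _) (nrm_ge0 _) (HM _ Sx) (hg _ Sx); rewrite mulrCA divff ?gt_eqF // mulr1.
have [N [N0 HN]] := bdd_gt0 (alg_bdd ag).
move=> d d0; have d1 : 0 < d / N by rewrite divr_gt0.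
have [f' [af hf]] := uf _ d1; exists (fun x => f' x * g' x); split; first exact: alg_mul.
move=> x Sx; rewrite -mulrBl nrmM.
by have := ler_pM (nrm_ge0 _) (nrm_ge0 _) (hf _ Sx) (HN _ Sx); rewrite divfK ?gt_eqF.
Qed.

Lemma unifN f : unif f -> unif (fun x => - f x).
Proof. by move=> uf; apply: unif_ext (unifM (unif_cst (-1)) uf) => x _; rewrite mulN1r. Qed.

Lemma unifB f g : unif f -> unif g -> unif (fun x => f x - g x).
Proof. by move=> uf ug; apply: unifD => //; apply: unifN. Qed.

Lemma unifX f n : unif f -> unif (fun x => f x ^+ n).
Proof.
move=> uf; elim: n => [|n IH]; first exact: unif_cst.
by apply: unif_ext (unifM uf IH) => x _; rewrite exprS.
Qed.

Lemma unif_prod (I : Type) (r : seq I) (f : I -> T -> C) : (forall i, unif (f i)) ->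
  unif (fun x => \prod_(i <- r) f i x).
Proof.
move=> uf; elim: r => [|i r IH].
  by apply: unif_ext (unif_cst 1) => x _; rewrite big_nil.
by apply: unif_ext (unifM (uf i) IH) => x _; rewrite big_cons.
Qed.

Lemma unif_sum (I : Type) (r : seq I) (f : I -> T -> C) : (forall i, unif (f i)) ->
  unif (fun x => \sum_(i <- r) f i x).
Proof.
move=> uf; elim: r => [|i r IH].
  by apply: unif_ext (unif_cst 0) => x _; rewrite big_nil.
by apply: unif_ext (unifD (uf i) IH) => x _; rewrite big_cons.
Qed.

Lemma sub1_neq0 (z : C) (th : R) : nrm z <= th -> th < 1 -> 1 - z != 0.
Proof. by move=> h h1; rewrite -nrm_gt0; have := nrm_subl 1 z; rewrite nrm1; lra. Qed.

(** Geometric series. *)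
Lemma unif_inv1 f (th : R) : th < 1 -> (forall x, S x -> nrm (f x) <= th) -> unif f ->
  unif (fun x => (1 - f x)^-1).
Proof.
move=> th1 hf uf; case: (pselect (exists x, S x)) => [[x0 Sx0]|noS]; last first.
  by apply: unif_ext (unif_cst 0) => x Sx; case: noS; exists x.
have th0 : 0 <= th by apply: le_trans (hf _ Sx0).
have ht : 0 <= th < 1 by rewrite th0.
have d0 : 0 < 1 - th by lra.
apply: unif_lim => e e0.
have [N HN] := nullZ (ltW (etrans (invr_gt0 _) d0)) (null_geo ht) e0.
exists (fun x => \sum_(i < N) f x ^+ i); split.
  by apply: unif_sum => i; apply: unifX.
move=> x Sx; have nz := sub1_neq0 (hf _ Sx) th1.
have -> : (1 - f x)^-1 - \sum_(i < N) f x ^+ i = f x ^+ N / (1 - f x).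
  have e1 : (1 - f x) * \sum_(i < N) f x ^+ i = 1 - f x ^+ N.
    by rewrite -[1 - f x]opprB mulNr -subrX1 opprB.
  by apply: (mulIf nz); rewrite mulrBl mulVf // divfK // mulrC e1 opprB addrC subrK.
apply: le_trans (ltW (HN N (leqnn _))); rewrite nrmM nrmV nrmX mulrC.
apply: ler_pM; rewrite ?invr_ge0 ?exprn_ge0 ?nrm_ge0 //.
  rewrite lef_pV2 ?posrE ?nrm_gt0 //; have := nrm_subl 1 (f x); have := hf _ Sx; rewrite nrm1; lra.
by apply: lerXn2r (hf _ Sx); rewrite nnegrE ?nrm_ge0.
Qed.

Lemma unif_pochn g q n : unif g -> unif q -> unif (fun x => pochn (g x) (q x) n).
Proof.
move=> ug uq; apply: unif_prod => i; apply: unifB; first exact: unif_cst.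
by apply: unifM => //; apply: unifX.
Qed.

Lemma unif_poch g q (t : R) : 0 <= t < 1 -> (forall x, S x -> nrm (q x) <= t) -> unif g -> unif q ->
  unif (fun x => poch (g x) (q x)).
Proof.
move=> ht hq ug uq; have [K [K0 HK]] := bdd_gt0 (unif_bdd ug).
apply: unif_lim => e e0; case/andP: (ht) => t0 t1.
have c0 : 0 <= poch_ub t K * K / (1 - t) by rewrite divr_ge0 ?mulr_ge0 ?expR_ge0 ?ltW //; lra.
have [N HN] := nullZ c0 (null_geo ht) e0.
exists (fun x => pochn (g x) (q x) N); split; first exact: unif_pochn.
move=> x Sx; apply: le_trans (ltW (HN N (leqnn _))).
by apply: poch_tail => //; auto.
Qed.

(** The approximations [g] are only required to have approximable inverses, which
    is the situation of infinite products: the partial products are handled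
    factor by factor. *)
Lemma unif_inv f (c : R) : 0 < c -> (forall x, S x -> c <= nrm (f x)) ->
  (forall e : R, 0 < e -> exists g, [/\ unif (fun x => (g x)^-1), (forall x, S x -> c <= nrm (g x)) &
     forall x, S x -> nrm (f x - g x) <= e]) -> unif (fun x => (f x)^-1).
Proof.
move=> c0 hc H; apply: unif_lim => e e0.
have [g [ug gc fg]] := H (e * c ^+ 2) ltac:(by rewrite mulr_gt0 ?exprn_gt0).
exists (fun x => (g x)^-1); split=> // x Sx.
have f0 : f x != 0 by rewrite -nrm_gt0; apply: lt_le_trans c0 (hc _ Sx).
have g0 : g x != 0 by rewrite -nrm_gt0; apply: lt_le_trans c0 (gc _ Sx).
have -> : (f x)^-1 - (g x)^-1 = (g x - f x) / (f x * g x) by field; apply/andP.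
rewrite nrmM nrmV nrmM nrmBC ler_pdivrMr ?mulr_gt0 ?nrm_gt0 //.
apply: le_trans (fg _ Sx) _; rewrite (ler_wpM2l (ltW e0)) // expr2.
by apply: ler_pM; rewrite ?(ltW c0) ?hc ?gc.
Qed.

Lemma unif_pochV g q (t th : R) : 0 <= t < 1 -> (forall x, S x -> nrm (q x) <= t) ->
  th < 1 -> (forall x, S x -> nrm (g x) <= th) -> unif g -> unif q ->
  unif (fun x => (poch (g x) (q x))^-1).
Proof.
move=> ht hq th1 hg ug uq; case/andP: (ht) => t0 t1.
apply: (@unif_inv _ (poch_lb t th)); first exact: expR_gt0.
  by move=> x Sx; apply: poch_lower; auto.
move=> e e0.
have c0 : 0 <= poch_ub t `|th| * `|th| / (1 - t) by rewrite divr_ge0 ?mulr_ge0 ?expR_ge0 //; lra.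
have [N HN] := nullZ c0 (null_geo ht) e0.
exists (fun x => pochn (g x) (q x) N); split.
- apply: unif_ext (unif_prod (index_enum 'I_N) (f := fun i x => (1 - g x * q x ^+ i)^-1) _) => [x _|i].
    by rewrite /pochn prodfV.
  apply: (@unif_inv1 (fun x => g x * q x ^+ i) th) => // [x Sx|]; last by apply: unifM => //; apply: unifX.
  rewrite nrmM nrmX; apply: le_trans (hg _ Sx); rewrite ler_piMr // exprn_ile1 //.
  by apply: le_trans (hq _ Sx) _; lra.
- by move=> x Sx; apply: pochn_lower; auto.
- move=> x Sx; apply: le_trans (ltW (HN N (leqnn _))).
  apply: poch_tail => //; auto; apply: le_trans (hg _ Sx) (ler_norm _).
Qed.

End Closure.

(** * Functions on the unit disc as power series *)
Section PowerSeries.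
Variable R : realType.
Local Notation C := R[i].
Implicit Types (x z w : C).

Lemma rt_natE (n : nat) : n%:R = (n%:R : R)%:C :> C.
Proof. by rewrite rmorph_nat. Qed.

Lemma ee_prim N : (0 < N)%N -> N.-primitive_root (ee (N%:R^-1 : C)).
Proof.
move=> N0; have Nz : N%:R != 0 :> C by rewrite pnatr_eq0 -lt0n.
rewrite /primitive_root_of_unity N0 /=; apply/forallP => i; apply/eqP.
rewrite unity_rootE eeX; apply/eqP/eqP => [h|->]; last by rewrite mulfV // ee1.
have [k hk] := ee_eq1 h; have hi := ltn_ord i.
have : (i.+1%:Z = k * N%:Z)%R.
  have e : i.+1%:R = k%:~R * N%:R :> C by rewrite -hk divfK.
  by apply/eqP; rewrite -(eqr_int C) intrM -!pmulrn e.
by case: (k) => [[|[|k']]|k']; nia.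
Qed.

Lemma prim_nrm w N : N.-primitive_root w -> nrm w = 1.
Proof.
move=> pw; have := prim_expr_order pw => /(congr1 (fun z => nrm z)); rewrite nrmX nrm1.
by move=> /eqP; rewrite (pexpr_eq1 (prim_order_gt0 pw)) ?nrm_ge0 // => /eqP.
Qed.

Lemma geo_root (y : C) N : y ^+ N = 1 -> y != 1 -> \sum_(k < N) y ^+ k = 0.
Proof.
move=> yN y1; have h := subrX1 y N; rewrite yN subrr in h.
by move/esym/eqP: h; rewrite mulf_eq0 subr_eq0 (negbTE y1) => /eqP.
Qed.

Lemma prim_sum w N i j : N.-primitive_root w -> (i < N)%N -> (j < N)%N ->
  \sum_(k < N) w ^+ (k * i) / w ^+ (k * j) = if i == j then N%:R else 0.
Proof.
move=> pw iN jN; have w0 : w != 0 by rewrite -nrm_gt0 (prim_nrm pw).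
have -> : \sum_(k < N) w ^+ (k * i) / w ^+ (k * j) = \sum_(k < N) (w ^+ i / w ^+ j) ^+ k.
  by apply: eq_bigr => k _; rewrite exprMn exprVn -!exprM ![(k * _)%N]mulnC.
case: eqP => [->|/eqP ij].
  rewrite divff ?expf_neq0 //; under eq_bigr do rewrite expr1n.
  by rewrite sumr_const card_ord.
apply: geo_root.
  by rewrite exprMn exprVn -!exprM ![(_ * N)%N]mulnC !exprM (prim_expr_order pw) !expr1n divr1.
apply: contra ij => /eqP h; have : w ^+ i = w ^+ j by rewrite -[RHS]mul1r -h divfK // expf_neq0.
by move/eqP; rewrite (eq_prim_root_expr pw) !modn_small.
Qed.

(** The discrete form of Cauchy's formula for coefficients, exact as soon as N
    exceeds the degree. *)
Lemma coef_mean (p : {poly C}) x w n N : N.-primitive_root w -> (size p <= N)%N -> (n < N)%N ->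
  \sum_(k < N) p.[x * w ^+ k] / w ^+ (k * n) = N%:R * (p`_n * x ^+ n).
Proof.
move=> pw pN nN.
transitivity (\sum_(k < N) \sum_(i < N) p`_i * x ^+ i * (w ^+ (k * i) / w ^+ (k * n))).
  apply: eq_bigr => k _; rewrite (@horner_coef_wide _ N) // mulr_suml.
  by apply: eq_bigr => i _; rewrite exprMn -exprM !mulrA.
rewrite exchange_big /= (bigD1 (Ordinal nN)) //= [X in _ + X]big1 => [|i /eqP hi].
  by rewrite -mulr_sumr (prim_sum pw) // eqxx addr0 mulrC.
rewrite -mulr_sumr (prim_sum pw) // ifN ?mulr0 //; apply/eqP => hin; apply: hi.
exact: val_inj.
Qed.

(** Cauchy's estimate. *)
Lemma coef_bound (p : {poly C}) (r e : R) n : 0 < r -> (forall x, nrm x = r -> nrm p.[x] <= e) ->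
  nrm p`_n * r ^+ n <= e.
Proof.
move=> r0 hp; pose N := (size p + n.+1)%N.
have N0 : (0 < N)%N by rewrite /N addnS.
have pw := ee_prim N0; set w := ee _ in pw.
have nN : (n < N)%N by rewrite /N; lia.
have : nrm (N%:R * (p`_n * r%:C ^+ n)) <= N%:R * e.
  rewrite -(coef_mean r%:C pw (leq_addr _ _) nN); apply: le_trans (nrm_sum _ _ _) _.
  apply: le_trans (_ : \sum_(k < N) e <= _); last by rewrite sumr_const card_ord mulr_natl.
  apply: ler_sum => k _; rewrite nrmM nrmV nrmX (prim_nrm pw) expr1n invr1 mulr1.
  by apply: hp; rewrite nrmM nrmX (prim_nrm pw) expr1n mulr1 nrm_real gtr0_norm.
rewrite nrmM nrm_nat ler_pM2l ?ltr0n // nrmM nrmX nrm_real gtr0_norm //.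
Qed.

Definition gid (f : C -> C) := f = id.
Definition disc (r : R) x := nrm x <= r.
(** The class of holomorphic functions on the open unit disc. *)
Definition discU (f : C -> C) := forall r : R, 0 < r < 1 -> unif (disc r) gid f.

Lemma gid_bdd r : forall f, gid f -> bddS (disc r) f.
Proof. by move=> f ->; exists r. Qed.

Lemma alg_poly f : alg gid f -> exists p : {poly C}, forall x, f x = p.[x].
Proof.
elim=> [c|g ->|g h _ [p hp] _ [q hq]|g h _ [p hp] _ [q hq]].
- by exists c%:P => x; rewrite hornerC.
- by exists 'X => x; rewrite hornerX.
- by exists (p + q) => x; rewrite hornerD hp hq.
- by exists (p * q) => x; rewrite hornerM hp hq.
Qed.

(** The first clause says that the radius of convergence is at least 1. *)
Definition has_ps (f : C -> C) (a : nat -> C) :=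
  (forall r : R, 0 < r < 1 -> exists M, forall n, nrm (a n) * r ^+ n <= M) /\
  (forall x, nrm x < 1 -> clim (fun n => \sum_(i < n) a i * x ^+ i) (f x)).

Lemma null_inv : null (fun k : nat => (k.+1%:R)^-1 : R).
Proof.
move=> e e0; exists (Num.bound e^-1) => n hn.
rewrite -[ltRHS]invrK ltf_pV2 ?posrE ?invr_gt0 ?ltr0n //.
have := archi_boundP (ltW (etrans (invr_gt0 _) e0)) => h.
by apply: lt_le_trans h _; rewrite ler_nat; apply: leq_trans hn _.
Qed.

(** If polynomials p_k approximate f within 1/(k+1) on discs exhausting the unit
    disc, Cauchy's estimate makes their n-th coefficients a Cauchy sequence; the
    limits are the coefficients of f. *)
Lemma ps_exists f : discU f -> exists a, has_ps f a.
Proof.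
move=> uf; pose rho (k : nat) : R := 1 - (k.+2%:R)^-1.
have rho01 k : 0 < rho k < 1.
  rewrite /rho; have : (0 : R) < (k.+2%:R)^-1 by rewrite invr_gt0 ltr0n.
  have : ((k.+2%:R)^-1 : R) < 1 by rewrite invf_lt1 ?ltr0n // ltr1n.
  by move: (k.+2%:R^-1 : R) => v v1 v0; apply/andP; split; lra.
have /choice [p hp] : forall k, exists p : {poly C}, forall x, nrm x <= rho k ->
    nrm (f x - p.[x]) <= (k.+1%:R)^-1.
  move=> k.
  have [|g [ag hg]] := uf _ (rho01 k) (k.+1%:R)^-1; first by rewrite invr_gt0 ltr0n.
  have [p hp] := alg_poly ag; exists p => x hx; rewrite -hp; exact: hg.
have invle k l : (k <= l)%N -> (l.+1%:R)^-1 <= (k.+1%:R)^-1 :> R.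
  by move=> kl; rewrite lef_pV2 ?posrE ?ltr0n // ler_nat.
have rho_le k l : (k <= l)%N -> rho k <= rho l.
  move=> kl; rewrite /rho lerD2l lerN2; have : (k.+1 <= l.+1)%N by [].
  exact: invle.
(* On a circle inside both discs, p_l - p_k is at most 1/(l+1) + 1/(k+1). *)
have hkl n k l (r : R) : 0 < r -> (k <= l)%N -> r <= rho k -> nrm ((p l)`_n - (p k)`_n) * r ^+ n <= 2 * (k.+1%:R)^-1.
  move=> r0 kl rk; rewrite -coefB; apply: coef_bound => // x hx.
  have -> : (p l - p k).[x] = (f x - (p k).[x]) - (f x - (p l).[x]) by rewrite hornerD hornerN; ring.
  apply: le_trans (nrmB _ _) _.
  have := hp k x ltac:(by rewrite hx); have := hp l x ltac:(by rewrite hx (le_trans rk) // rho_le).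
  have := invle _ _ kl; move: (k.+1%:R^-1 : R) (l.+1%:R^-1 : R) => v v'; lra.
have hh : (2^-1 : R) <= rho 0 by rewrite /rho -[0.+2]/2%N; lra.
have /choice [a ha] : forall n, exists l, clim (fun k => (p k)`_n) l.
  move=> n; apply: (@cauchy_clim _ _ (fun k => 2 / (2^-1) ^+ n * (k.+1%:R)^-1)).
    by apply: nullZ null_inv; rewrite divr_ge0 // exprn_ge0.
  move=> k l kl; have h0 : (0 : R) < 2^-1 by [].
  have := hkl n k l _ h0 kl (le_trans hh (rho_le _ _ (leq0n k))).
  by rewrite -ler_pdivlMr ?exprn_gt0 // mulrAC.
have hak n k (r : R) : 0 < r -> r <= rho k -> nrm (a n - (p k)`_n) * r ^+ n <= 2 * (k.+1%:R)^-1.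
  move=> r0 rk; rewrite -ler_pdivlMr ?exprn_gt0 //.
  apply: (clim_nrm_le (N := k) _ (climB (ha n) (clim_cst _))) => l kl.
  by rewrite ler_pdivlMr ?exprn_gt0 // hkl.
have rhoK (r : R) : r < 1 -> exists K, r <= rho K.
  move=> r1; have d0 : 0 < 1 - r by lra.
  have [K hK] := null_inv d0; exists K; have := hK K.+1 (leqnSn _); rewrite /rho.
  by move: (K.+2%:R^-1 : R) => v; lra.
exists a; split=> [r /andP[r0 r1]|x x1].
  have [K hK] := rhoK r r1.
  have [M HM] : exists M, forall n, nrm (p K)`_n * r ^+ n <= M.
    exists (\sum_(i < size (p K)) nrm (p K)`_i * r ^+ i) => n.
    have [hn|hn] := ltnP n (size (p K)).
      rewrite (bigD1 (Ordinal hn)) //= lerDl; apply: sumr_ge0 => i _.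
      by rewrite mulr_ge0 ?exprn_ge0 // ltW.
    rewrite nth_default // nrm0 mul0r; apply: sumr_ge0 => i _.
    by rewrite mulr_ge0 ?exprn_ge0 // ltW.
  exists (M + 2 * (K.+1%:R)^-1) => n; have := HM n; have := hak n K r r0 hK.
  have := nrmD (a n - (p K)`_n) (p K)`_n; rewrite subrK => h h1 h2.
  have rn : 0 <= r ^+ n by rewrite exprn_ge0 // ltW.
  have h3 := ler_wpM2r rn h; rewrite mulrDl in h3.
  by apply: le_trans h3 _; rewrite addrC; apply: lerD.
move=> e e0; pose r := (1 + nrm x) / 2; have x0 := nrm_ge0 x.
have r0 : 0 < r by rewrite /r; lra.
have r1 : r < 1 by rewrite /r; lra.
have xr : nrm x < r by rewrite /r; lra.
pose t := nrm x / r; have t0 : 0 <= t by rewrite divr_ge0 // ltW.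
have t1 : t < 1 by rewrite ltr_pdivrMr // mul1r.
have ht : 0 <= t < 1 by rewrite t0.
have [K hK] := rhoK r r1.
have c0 : 0 <= 1 + 2 / (1 - t) by rewrite addr_ge0 // divr_ge0 //; lra.
have [L hL] := nullZ c0 null_inv e0.
(* For this k the coefficients differ by at most 2/(k+1) r^(-i), whence the
   factor 1 + 2 / (1 - t) with t = |x| / r. *)
pose k := maxn K L; have rk : r <= rho k by apply: le_trans hK (rho_le _ _ (leq_maxl _ _)).
exists (size (p k)) => n hn; apply: le_lt_trans (hL k (leq_maxr _ _)).
have -> : \sum_(i < n) a i * x ^+ i - f x =
   \sum_(i < n) (a i - (p k)`_i) * x ^+ i - (f x - (p k).[x]).
  have -> : \sum_(i < n) (a i - (p k)`_i) * x ^+ i = \sum_(i < n) a i * x ^+ i - (p k).[x].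
    by rewrite (horner_coef_wide _ hn) -sumrB; apply: eq_bigr => i _; rewrite mulrBl.
  by rewrite opprB addrA subrK.
apply: le_trans (nrmB _ _) _; rewrite mulrDl mul1r addrC.
apply: lerD; first by apply: hp; rewrite (le_trans (ltW xr)).
apply: le_trans (nrm_sum _ _ _) _.
apply: le_trans (_ : \sum_(i < n) 2 * (k.+1%:R)^-1 * t ^+ i <= _).
  apply: ler_sum => i _; rewrite nrmM nrmX.
  have -> : nrm x = r * t by rewrite /t mulrC divfK // gt_eqF.
  by rewrite exprMn mulrA ler_wpM2r ?exprn_ge0 // hak.
have k0 : (0 : R) <= 2 * (k.+1%:R)^-1 by rewrite mulr_ge0 // invr_ge0.
by rewrite -mulr_sumr [leRHS]mulrAC ler_wpM2l // geo_sum_le0.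
Qed.

End PowerSeries.

Lemma mul_shuffle (F : comPzRingType) (a b c d e : F) : a * b * (c * (d * e)) = c * d * a * (e * b).
Proof. ring. Qed.

(** * Means over roots of unity and residues *)
Section Means.
Variable R : realType.
Local Notation C := R[i].
Implicit Types (x b : C) (f g : C -> C).

Definition glaur (f : C -> C) := f = id \/ f = (fun x => x^-1).
Definition ann (r1 r2 : R) x := r1 <= nrm x <= r2.

Lemma glaur_bdd r1 r2 : 0 < r1 -> forall f, glaur f -> bddS (ann r1 r2) f.
Proof.
move=> r10 f [] ->; first by exists r2 => x /andP[].
exists r1^-1 => x /andP[h _]; rewrite nrmV lef_pV2 ?posrE //; exact: lt_le_trans h.
Qed.

(** As N tends to infinity, this becomes the integral of f(y) dy / (2 pi i y) over
    the circle of radius |x|. *)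
Definition mean N f x : C := N%:R^-1 * \sum_(k < N) f (x * ee (N%:R^-1) ^+ k).

Lemma root_nrm N k : nrm (ee (N%:R^-1 : C) ^+ k) = 1.
Proof.
case: N => [|N]; first by rewrite invr0 ee0 expr1n nrm1.
by rewrite nrmX (prim_nrm (ee_prim R (ltn0Sn N))) expr1n.
Qed.

Lemma mean_ext N f g x : (forall y, nrm y = nrm x -> f y = g y) -> mean N f x = mean N g x.
Proof.
move=> fg; congr (_ * _); apply: eq_bigr => k _; apply: fg.
by rewrite nrmM root_nrm mulr1.
Qed.
Lemma meanD N f g x : mean N (fun x => f x + g x) x = mean N f x + mean N g x.
Proof. by rewrite /mean big_split mulrDr. Qed.
Lemma meanZ N c f x : mean N (fun x => c * f x) x = c * mean N f x.
Proof. by rewrite /mean -mulr_sumr mulrCA. Qed.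
Lemma mean_sum (I : Type) (r : seq I) N (f : I -> C -> C) x :
  mean N (fun x => \sum_(i <- r) f i x) x = \sum_(i <- r) mean N (f i) x.
Proof.
rewrite /mean exchange_big /= mulr_sumr; apply: eq_bigr => i _; by [].
Qed.
Lemma mean_bound N f x (M : R) : (forall y, nrm y = nrm x -> nrm (f y) <= M) -> 0 <= M ->
  nrm (mean N f x) <= M.
Proof.
move=> hf M0; case: N => [|N]; first by rewrite /mean invr0 mul0r nrm0.
rewrite /mean nrmM nrmV nrm_nat ler_pdivrMl ?ltr0n //.
apply: le_trans (nrm_sum _ _ _) _.
apply: le_trans (_ : \sum_(k < N.+1) M <= _); last by rewrite sumr_const card_ord mulr_natl.
by apply: ler_sum => k _; apply: hf; rewrite nrmM root_nrm mulr1.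
Qed.

Lemma alg_laur f : alg glaur f -> exists (k : nat) (p : {poly C}), forall x, x != 0 -> f x = x ^- k * p.[x].
Proof.
elim=> [c|g [] ->|g h _ [k [p hp]] _ [l [q hq]]|g h _ [k [p hp]] _ [l [q hq]]].
- by exists 0%N, c%:P => x x0; rewrite hornerC expr0 invr1 mul1r.
- by exists 0%N, 'X => x x0; rewrite hornerX expr0 invr1 mul1r.
- by exists 1%N, 1%:P => x x0; rewrite hornerC mulr1 expr1.
- exists (k + l)%N, ('X^l * p + 'X^k * q) => x x0.
  rewrite hp // hq // hornerD !hornerM !hornerXn exprD; field.
  by apply/andP; split; rewrite expf_neq0.
- exists (k + l)%N, (p * q) => x x0.
  rewrite hp // hq // hornerM exprD; field.
  by apply/andP; split; rewrite expf_neq0.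
Qed.

(** Only the constant term of a Laurent polynomial survives, as soon as N exceeds
    all exponents in absolute value.  In particular the mean does not depend on
    the radius. *)
Lemma alg_mean f : alg glaur f -> exists (c : C) (M : nat), forall N x, (M <= N)%N -> x != 0 -> mean N f x = c.
Proof.
move=> /alg_laur [k [p hp]]; exists p`_k, (size p + k).+1 => N x hN x0.
have N0 : (0 < N)%N by apply: leq_trans hN.
have pw := ee_prim R N0; set w := ee _ in pw.
have w0 : w != 0 by exact: ee_neq0.
have Nz : N%:R != 0 :> C by rewrite pnatr_eq0 -lt0n.
apply: (mulfI Nz); rewrite /mean mulrA mulfV // mul1r -/w.
transitivity (\sum_(i < N) \sum_(j < N) p`_j * x ^+ j / x ^+ k * (w ^+ (i * j) / w ^+ (i * k))).
  apply: eq_bigr => i _; rewrite hp ?mulf_neq0 ?expf_neq0 //.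
  rewrite (@horner_coef_wide _ N); last by lia.
  rewrite mulr_sumr; apply: eq_bigr => j _.
  rewrite !exprMn !invfM -!exprM.
  exact: mul_shuffle.
rewrite exchange_big /=.
have kN : (k < N)%N by lia.
rewrite (bigD1 (Ordinal kN)) //= [X in _ + X]big1 => [|i /eqP hi].
  by rewrite -mulr_sumr (prim_sum pw) // eqxx addr0 mulfK ?expf_neq0 // mulrC.
rewrite -mulr_sumr (prim_sum pw) // ifN ?mulr0 //; apply/eqP => hin; apply: hi.
exact: val_inj.
Qed.

(** Laurent polynomials can be divided by x - b, which splits the pole off a
    quotient. *)
Lemma alg_div f b : b != 0 -> alg glaur f ->
  exists m, alg glaur m /\ forall x, x != 0 -> f x - f b = (1 - x / b) * m x.
Proof.
move=> b0; elim=> [c|g [] ->|g h ag [m [am hm]] ah [m' [am' hm']]|g h ag [m [am hm]] ah [m' [am' hm']]].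
- by exists (fun _ => 0); split; [exact: alg_cst|move=> x x0; rewrite subrr mulr0].
- exists (fun _ => - b); split; [exact: alg_cst|move=> x x0; field; exact: b0].
- exists (fun x => x^-1); split; first by apply: alg_gen; right.
  move=> x x0; field; by apply/andP.
- exists (fun x => m x + m' x); split; first exact: alg_add.
  by move=> x x0; rewrite mulrDr -hm // -hm' //; ring.
- exists (fun x => m x * h x + g b * m' x); split.
    by apply: alg_add; apply: alg_mul => //; exact: alg_cst.
  move=> x x0; have -> : g x * h x - g b * h b = (g x - g b) * h x + g b * (h x - h b) by ring.
  by rewrite hm // hm' //; ring.
Qed.

(** This exact value tends to 1 inside the circle of radius |b| and to 0
    outside. *)
Lemma mean_pole N x b : (0 < N)%N -> b != 0 -> (x / b) ^+ N != 1 ->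
  mean N (fun x => (1 - x / b)^-1) x = (1 - (x / b) ^+ N)^-1.
Proof.
move=> N0 b0; set y := x / b => yN.
have pw := ee_prim R N0; set w := ee _ in pw.
have Nz : N%:R != 0 :> C by rewrite pnatr_eq0 -lt0n.
have d0 : 1 - y ^+ N != 0 by rewrite subr_eq0 eq_sym.
apply: (mulfI Nz); rewrite /mean mulrA mulfV // mul1r -/w.
transitivity (\sum_(k < N) \sum_(i < N) y ^+ i * (w ^+ (k * i) / w ^+ (k * 0)) / (1 - y ^+ N)).
  apply: eq_bigr => k _; rewrite -mulr_suml.
  have -> : x * w ^+ k / b = y * w ^+ k by rewrite /y mulrAC.
  have e : (y * w ^+ k) ^+ N = y ^+ N by rewrite exprMn -exprM mulnC exprM (prim_expr_order pw) expr1n mulr1.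
  have d1 : 1 - y * w ^+ k != 0.
    apply: contraNneq d0 => /eqP; rewrite subr_eq0 eq_sym => /eqP h.
    by rewrite -e h expr1n subrr.
  apply: (mulfI d1); rewrite mulfV // mulrA.
  have -> : \sum_(i < N) y ^+ i * (w ^+ (k * i) / w ^+ (k * 0)) = \sum_(i < N) (y * w ^+ k) ^+ i.
    by apply: eq_bigr => i _; rewrite muln0 expr0 divr1 [(y * _) ^+ _]exprMn exprM.
  have h := subrX1 (y * w ^+ k) N; rewrite e in h.
  by rewrite -[1 - y * w ^+ k]opprB mulNr -h opprB mulfV.
rewrite exchange_big /= (bigD1 (Ordinal N0)) //= [X in _ + X]big1 => [|i /eqP hi].
  by rewrite -mulr_suml -mulr_sumr (prim_sum pw) // eqxx addr0 expr0 mul1r.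
rewrite -mulr_suml -mulr_sumr (prim_sum pw) // ifN ?mulr0 ?mul0r //.
by apply/eqP => hin; apply: hi; exact: val_inj.
Qed.

Lemma clim_geo0 (y : C) : nrm y < 1 -> clim (fun n => y ^+ n) 0.
Proof.
move=> y1; apply: clim_null (null_geo (nrm_itv y1)) _ => n.
by rewrite subr0 nrmX.
Qed.

Lemma pole_in x b : b != 0 -> nrm x < nrm b -> clim (fun N => mean N (fun x => (1 - x / b)^-1) x) 1.
Proof.
move=> b0 xb; have y1 : nrm (x / b) < 1 by rewrite nrmM nrmV ltr_pdivrMr ?mul1r // nrm_gt0.
have cl : clim (fun n => (1 - (x / b) ^+ n)^-1) 1.
  rewrite -[X in clim _ X]invr1 -[in X in clim _ X](subr0 1); apply: climV; first by rewrite subr0 oner_neq0.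
  exact: climB (clim_cst 1) (clim_geo0 y1).
apply: (clim_near (N := 1%N) _ cl) => N N1.
rewrite mean_pole //; apply/eqP => /(congr1 (fun z => nrm z)); rewrite nrmX nrm1 => h.
have : nrm (x / b) ^+ N < 1 by rewrite exprn_ilt1 // -lt0n.
by rewrite h ltxx.
Qed.

Lemma pole_out x b : b != 0 -> nrm b < nrm x -> clim (fun N => mean N (fun x => (1 - x / b)^-1) x) 0.
Proof.
move=> b0 bx; have x0 : x != 0 by rewrite -nrm_gt0; apply: le_lt_trans bx.
have y1 : nrm (b / x) < 1 by rewrite nrmM nrmV ltr_pdivrMr ?mul1r // nrm_gt0.
have cl : clim (fun n => (b / x) ^+ n / ((b / x) ^+ n - 1)) 0.
  rewrite -[X in clim _ X](mul0r (0 - 1)^-1); apply: climM; first exact: clim_geo0.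
  apply: climV; first by rewrite sub0r oppr_eq0 oner_neq0.
  exact: climB (clim_geo0 y1) (clim_cst 1).
apply: (clim_near (N := 1%N) _ cl) => N N1.
have lt1 : nrm (b / x) ^+ N < 1 by rewrite exprn_ilt1 // -lt0n.
have n1 : (b / x) ^+ N != 1.
  by apply/eqP => /(congr1 (fun z => nrm z)); rewrite nrmX nrm1 => h; rewrite h ltxx in lt1.
have xb : (x / b) ^+ N = ((b / x) ^+ N)^-1 by rewrite -exprVn invfM invrK mulrC.
have z0 : (b / x) ^+ N != 0 by rewrite expf_neq0 // mulf_neq0 ?invr_eq0.
have z1 : (b / x) ^+ N - 1 != 0 by rewrite subr_eq0.
rewrite mean_pole // xb; first by field; apply/andP; split.
by rewrite -subr_eq0 (_ : _ - 1 = - ((b / x) ^+ N - 1) / (b / x) ^+ N); [rewrite mulf_neq0 ?oppr_eq0 ?invr_eq0 | field].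
Qed.

(** The residue theorem for one simple pole.  Writing f(x) = f(b) +
    (1 - x/b) m(x) for approximating Laurent polynomials, m contributes equally
    to both circles, and the remaining term is given by [pole_in] and
    [pole_out]. *)
Lemma jump (r1 r2 : R) f xi xo b : 0 < r1 -> r1 <= r2 -> unif (ann r1 r2) glaur f ->
  nrm xi = r1 -> nrm xo = r2 -> b != 0 -> nrm b != r1 -> nrm b != r2 ->
  clim (fun N => mean N (fun x => f x / (1 - x / b)) xo - mean N (fun x => f x / (1 - x / b)) xi)
    (- (if r1 < nrm b < r2 then f b else 0)).
Proof.
move=> r10 r12 uf hi ho b0 b1 b2 e e0.
have xi0 : xi != 0 by rewrite -nrm_gt0 hi.
have xo0 : xo != 0 by rewrite -nrm_gt0 ho; apply: lt_le_trans r12.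
pose d (x : C) : R := `|1 - nrm x / nrm b|.
have bp : 0 < nrm b by rewrite nrm_gt0.
have dP x : nrm x != nrm b -> 0 < d x.
  move=> h; rewrite normr_gt0 subr_eq0; apply: contra h => /eqP h.
  by rewrite -[eqbRHS]mul1r h divfK // gt_eqF.
have di : 0 < d xi by apply: dP; rewrite hi eq_sym.
have do0 : 0 < d xo by apply: dP; rewrite ho eq_sym.
have dlow x y : nrm y = nrm x -> d x <= nrm (1 - y / b).
  move=> yx; rewrite /d -yx ler_norml; have h1 := nrm_subl 1 (y / b).
  have h2 := nrm_subl (y / b) 1; rewrite nrmBC in h2.
  rewrite nrm1 nrmM nrmV in h1; rewrite nrm1 nrmM nrmV in h2.
  by apply/andP; split; lra.
pose A := (d xi)^-1 + (d xo)^-1 + 1.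
have A0 : 0 < A by rewrite !addr_gt0 ?invr_gt0.
have eA : 0 < e / 3 / A by rewrite !divr_gt0.
have [g [ag hg]] := uf _ eA.
have [m [am hm]] := alg_div b0 ag.
have [c [M0 hc]] := alg_mean am.
pose J := if r1 < nrm b < r2 then 1 else 0 : C.
have cJ : clim (fun N => mean N (fun x => (1 - x / b)^-1) xo - mean N (fun x => (1 - x / b)^-1) xi) (- J).
  rewrite /J; have [rb|br] := ltrP r1 (nrm b) => /=; last first.
    have br' : nrm b < r1 by rewrite lt_neqAle b1.
    rewrite -[X in clim _ X](_ : 0 - 0 = - 0); last by rewrite subrr oppr0.
    by apply: climB; apply: pole_out; rewrite ?hi ?ho //; apply: lt_le_trans r12.
  have [rb2|br2] := ltrP (nrm b) r2.
    rewrite -[X in clim _ X](_ : 0 - 1 = - 1); last by rewrite sub0r.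
    by apply: climB; [apply: pole_out; rewrite ?ho | apply: pole_in; rewrite ?hi].
  have br' : r2 < nrm b by rewrite lt_neqAle eq_sym b2.
  rewrite -[X in clim _ X](_ : 1 - 1 = - 0); last by rewrite subrr oppr0.
  by apply: climB; apply: pole_in; rewrite ?hi ?ho //; apply: le_lt_trans r12 _.
have e3 : 0 < e / 3 by lra.
have [M1 hM1] := climZ (g b) cJ e3.
exists (maxn M0 M1) => N; rewrite geq_max => /andP[hM0 /hM1 h1].
have dec x : x != 0 -> nrm x != nrm b -> mean N (fun x => f x / (1 - x / b)) x =
   mean N (fun x => (f x - g x) / (1 - x / b)) x + (g b * mean N (fun x => (1 - x / b)^-1) x + c).
  move=> x0 xb; rewrite -(hc N x hM0 x0) -meanZ -!meanD; apply: mean_ext => y yx.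
  have y0 : y != 0 by rewrite -nrm_gt0 yx nrm_gt0.
  have nz : 1 - y / b != 0.
    by rewrite -nrm_gt0; apply: lt_le_trans (dlow _ _ yx); apply: dP.
  have ef : f y = (f y - g y) + m y * (1 - y / b) + g b by rewrite [m y * _]mulrC -hm //; ring.
  rewrite [in LHS]ef !mulrDl mulfK //; ring.
rewrite !dec ?hi ?ho // 1?eq_sym //.
set E1 := mean N _ xo; set E2 := mean N (fun x => (f x - g x) / _) xi.
have E1b : nrm E1 <= e / 3 / A / d xo.
  apply: mean_bound; last by rewrite ltW // divr_gt0.
  move=> y yx; rewrite nrmM nrmV; apply: ler_pM; rewrite ?invr_ge0 ?nrm_ge0 //.
    by apply: hg; rewrite /ann yx ho r12 lexx.
  by rewrite lef_pV2 ?posrE ?dlow //; apply: lt_le_trans (dlow _ _ yx).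
have E2b : nrm E2 <= e / 3 / A / d xi.
  apply: mean_bound; last by rewrite ltW // divr_gt0.
  move=> y yx; rewrite nrmM nrmV; apply: ler_pM; rewrite ?invr_ge0 ?nrm_ge0 //.
    by apply: hg; rewrite /ann yx hi r12 lexx.
  by rewrite lef_pV2 ?posrE ?dlow //; apply: lt_le_trans (dlow _ _ yx).
pose F : C := if r1 < nrm b < r2 then f b - g b else 0.
have Fb : nrm F <= e / 3 / A.
  rewrite /F; case: ifP => [/andP[h2 h3]|_]; last by rewrite nrm0 ltW.
  by apply: hg; rewrite /ann !ltW.
have Fe : (if r1 < nrm b < r2 then f b else 0) = F + g b * J.
  by rewrite /F /J; case: ifP => _; ring.
rewrite Fe; set m1 := mean N _ xo in h1 *; set m2 := mean N _ xi in h1 *.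
have -> : E1 + (g b * m1 + c) - (E2 + (g b * m2 + c)) - - (F + g b * J) =
   (g b * (m1 - m2) - g b * - J) + (E1 - E2 + F) by ring.
have t1 := nrmD (g b * (m1 - m2) - g b * - J) (E1 - E2 + F).
have t2 := nrmD (E1 - E2) F; have t3 := nrmB E1 E2.
have t4 : e / 3 / A / d xo + e / 3 / A / d xi + e / 3 / A = e / 3.
  have -> : e / 3 / A / d xo + e / 3 / A / d xi + e / 3 / A = e / 3 / A * A by rewrite /A; ring.
  by rewrite divfK // gt_eqF.
lra.
Qed.

End Means.

(** * Convergent power series *)
Section Psum.
Variable R : realType.
Local Notation C := R[i].
Implicit Types (x : C) (a b : nat -> C).

(** Equivalently, the power series with coefficients [a] converges on the open
    unit disc. *)
Definition gro a := forall r : R, 0 < r < 1 -> exists M, forall n, nrm (a n) * r ^+ n <= M.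
Definition psum a x : C := limn (fun n => (\sum_(i < n) a i * x ^+ i : C^o)).

Lemma mid_lt (y : R) : 0 <= y < 1 -> [/\ 0 < (1 + y) / 2, (1 + y) / 2 < 1 & 0 <= y / ((1 + y) / 2) < 1].
Proof.
case/andP=> y0 y1; split; [lra|lra|apply/andP; split].
  by rewrite divr_ge0 //; lra.
by rewrite ltr_pdivrMr ?mul1r; lra.
Qed.

Lemma gro_term a x (M : R) : nrm x < 1 -> (forall n, nrm (a n) * ((1 + nrm x) / 2) ^+ n <= M) ->
  forall n, nrm (a n * x ^+ n) <= M * (nrm x / ((1 + nrm x) / 2)) ^+ n.
Proof.
move=> x1 ha n; have [r0 r1 ht] := mid_lt (nrm_itv x1).
set r := (1 + nrm x) / 2 in r0 r1 ht ha *; set t := nrm x / r in ht *.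
case/andP: ht => t0 _.
have xe : nrm x = r * t by rewrite /t mulrC divfK // gt_eqF.
by rewrite nrmM nrmX xe exprMn mulrA ler_wpM2r ?exprn_ge0.
Qed.

Lemma gro_mid a x : nrm x < 1 -> gro a -> exists M, forall n, nrm (a n) * ((1 + nrm x) / 2) ^+ n <= M.
Proof.
by move=> x1 ga; have [r0 r1 _] := mid_lt (nrm_itv x1); apply: ga; rewrite r0.
Qed.

Lemma psum_clim a x : nrm x < 1 -> gro a -> clim (fun n => \sum_(i < n) a i * x ^+ i) (psum a x).
Proof.
move=> x1 ga; have [M HM] := gro_mid x1 ga.
have [_ _ ht] := mid_lt (nrm_itv x1).
have [l cl] := geo_series ht (gro_term x1 HM).
by rewrite /psum (clim_lim cl).
Qed.

Lemma psum_eq a x l : clim (fun n => \sum_(i < n) a i * x ^+ i) l -> psum a x = l.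
Proof. exact: clim_lim. Qed.

Lemma psum_bound a x (M : R) N : nrm x < 1 -> (forall n, nrm (a n) * ((1 + nrm x) / 2) ^+ n <= M) ->
  (forall n, (n < N)%N -> a n = 0) -> gro a ->
  nrm (psum a x) <= M * (nrm x / ((1 + nrm x) / 2)) ^+ N / (1 - nrm x / ((1 + nrm x) / 2)).
Proof.
move=> x1 HM a0 ga; have [_ _ ht] := mid_lt (nrm_itv x1).
have := geo_tail ht (gro_term x1 HM) (psum_clim x1 ga) N.
by rewrite big1 ?subr0 // => i _; rewrite a0 // mul0r.
Qed.

Lemma groD a b : gro a -> gro b -> gro (fun n => a n + b n).
Proof.
move=> ga gb r hr; have [M HM] := ga r hr; have [N HN] := gb r hr; case/andP: hr => r0 r1.
exists (M + N) => n; have rn : 0 <= r ^+ n by rewrite exprn_ge0 // ltW.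
have := ler_wpM2r rn (nrmD (a n) (b n)); rewrite mulrDl => h.
by apply: le_trans h _; apply: lerD.
Qed.
Lemma groZ c a : gro a -> gro (fun n => c * a n).
Proof.
move=> ga r hr; have [M HM] := ga r hr; exists (nrm c * M) => n.
by rewrite nrmM -mulrA ler_wpM2l.
Qed.
Lemma gro_le a b : (forall n, nrm (b n) <= nrm (a n)) -> gro a -> gro b.
Proof.
move=> h ga r hr; have [M HM] := ga r hr; exists M => n; case/andP: hr => r0 r1.
by apply: le_trans (HM n); rewrite ler_wpM2r // exprn_ge0 // ltW.
Qed.
Lemma gro_sum (I : Type) (s : seq I) (a : I -> nat -> C) : (forall i, gro (a i)) ->
  gro (fun n => \sum_(i <- s) a i n).
Proof.
move=> ga; elim: s => [|i s IH].
  by move=> r hr; exists 0 => n; rewrite big_nil nrm0 mul0r.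
move=> r hr; have [M HM] := groD (ga i) IH hr; exists M => n; by rewrite big_cons.
Qed.

Lemma psumD a b x : nrm x < 1 -> gro a -> gro b -> psum (fun n => a n + b n) x = psum a x + psum b x.
Proof.
move=> x1 ga gb; apply: psum_eq; apply: clim_ext (climD (psum_clim x1 ga) (psum_clim x1 gb)) => n.
by rewrite -big_split; apply: eq_bigr => i _; rewrite mulrDl.
Qed.
Lemma psumZ c a x : nrm x < 1 -> gro a -> psum (fun n => c * a n) x = c * psum a x.
Proof.
move=> x1 ga; apply: psum_eq; apply: clim_ext (climZ c (psum_clim x1 ga)) => n.
by rewrite mulr_sumr; apply: eq_bigr => i _; rewrite mulrA.
Qed.
Lemma psum_sum (I : Type) (s : seq I) (a : I -> nat -> C) x : nrm x < 1 -> (forall i, gro (a i)) ->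
  psum (fun n => \sum_(i <- s) a i n) x = \sum_(i <- s) psum (a i) x.
Proof.
move=> x1 ga; elim: s => [|i s IH].
  rewrite big_nil; apply: psum_eq; apply: clim_ext (clim_cst 0) => n.
  by rewrite big1 // => j _; rewrite big_nil mul0r.
rewrite big_cons -IH -psumD //; last exact: gro_sum.
by congr psum; apply/funext => n; rewrite big_cons.
Qed.

Definition shift k a n := if (n < k)%N then 0 else a (n - k)%N : C.
Lemma gro_shift k a : gro a -> gro (shift k a).
Proof.
move=> ga r hr; have [M HM] := ga r hr; case/andP: hr => r0 r1.
have M0 : 0 <= M by apply: le_trans (HM 0%N); rewrite expr0 mulr1 nrm_ge0.
exists M => n; rewrite /shift; case: ltnP => h; first by rewrite nrm0 mul0r.
rewrite -{2}(subnK h) exprD mulrA; apply: le_trans (HM (n - k)%N).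
by apply: ler_piMr; rewrite ?mulr_ge0 ?exprn_ge0 ?exprn_ile1 ?nrm_ge0 // ltW.
Qed.
Lemma psum_shift k a x : nrm x < 1 -> gro a -> psum (shift k a) x = x ^+ k * psum a x.
Proof.
move=> x1 ga; apply: clim_uniq (climZ (x ^+ k) (psum_clim x1 ga)).
apply: clim_ext (clim_addn k (psum_clim x1 (gro_shift k ga))) => n.
rewrite -(big_mkord xpredT (fun i => shift k a i * x ^+ i)) (big_cat_nat (leq0n k) (leq_addl _ _)) /=.
rewrite big_nat_cond big1 ?add0r; last by move=> i /andP[/andP[_ h] _]; rewrite /shift h mul0r.
rewrite -{1}[k]add0n big_addn addnK big_mkord mulr_sumr; apply: eq_bigr => i _.
by rewrite /shift ltnNge leq_addl /= addnK exprD mulrC mulrA [x ^+ i * _]mulrC mulrAC mulrC mulrA.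
Qed.
End Psum.

(** * Generating functions of partitions and the pentagonal number theorem *)
Section PartGF.
Variable R : realType.
Local Notation C := R[i].
Implicit Types (x : C).

Lemma ple_recS N n : ple N.+1 n = (ple N n + (if n < N.+1 then 0 else ple N.+1 (n - N.+1)))%N.
Proof.
case: ltnP => h; first by rewrite addn0 ple_small.
by rewrite -{1 2}(subnK h) ple_rec.
Qed.

(** Induction on N by the recursion for [ple]; truncating the sum only loses
    nonnegative terms.  The resulting bound is uniform in N. *)
Lemma ple_sum (t : R) N M : 0 < t < 1 ->
  (\prod_(i < N) (1 - t ^+ i.+1)) * \sum_(n < M) (ple N n)%:R * t ^+ n <= 1.
Proof.
case/andP=> t0 t1; elim: N => [|N IH].
  rewrite big_ord0 mul1r; case: M => [|M]; first by rewrite big_ord0.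
  rewrite big_ord_recl ple0 eqxx mul1r expr0 big1 ?addr0 // => i _.
  by rewrite ple0 mul0r.
rewrite big_ord_recr /= -mulrA; apply: le_trans IH.
have f0 i : 0 <= 1 - t ^+ i.+1 by rewrite subr_ge0 exprn_ile1 // ltW.
apply: ler_wpM2l; first by apply: prodr_ge0 => i _.
set S := \sum_(n < M) (ple N.+1 n)%:R * t ^+ n.
suff : S <= \sum_(n < M) (ple N n)%:R * t ^+ n + t ^+ N.+1 * S by lra.
have eS : S = \sum_(n < M) (ple N n)%:R * t ^+ n +
   \sum_(n < M) (if (n < N.+1)%N then 0 else (ple N.+1 (n - N.+1))%:R) * t ^+ n.
  rewrite -big_split; apply: eq_bigr => n _; rewrite /= ple_recS natrD mulrDl.
  by case: ifP.
rewrite {1}eS lerD2l -(big_mkord xpredT (fun n => (if (n < N.+1)%N then 0 else (ple N.+1 (n - N.+1))%:R) * t ^+ n)).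
have [MN|NM] := leqP M N.+1.
  have S0 : 0 <= S by apply: sumr_ge0 => i _; rewrite mulr_ge0 ?exprn_ge0 // ltW.
  rewrite big_nat_cond big1; first by rewrite mulr_ge0 ?exprn_ge0 // ltW.
  by move=> i /andP[/andP[_ h] _]; rewrite (leq_trans h MN) mul0r.
rewrite (big_cat_nat (leq0n N.+1) (ltnW NM)) /= [X in X + _]big_nat_cond big1 ?add0r; last first.
  by move=> i /andP[/andP[_ h] _]; rewrite h mul0r.
rewrite -{1}[N.+1]add0n big_addn big_mkord mulr_sumr /S.
rewrite -(big_mkord xpredT (fun n => t ^+ N.+1 * ((ple N.+1 n)%:R * t ^+ n))).
rewrite -[leLHS](big_mkord xpredT (fun i => (if (i + N.+1 < N.+1)%N then 0 else (ple N.+1 (i + N.+1 - N.+1))%:R) * t ^+ (i + N.+1))).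
rewrite [leRHS](big_cat_nat (leq0n (M - N.+1)) (leq_subr _ _)) /=.
rewrite -[leLHS]addr0; apply: lerD.
  apply: ler_sum => i _; rewrite ltnNge leq_addl /= addnK exprD mulrCA mulrA [t ^+ i * _]mulrC.
  by rewrite [leLHS]mulrC.
by apply: sumr_ge0 => i _; rewrite !mulr_ge0 ?exprn_ge0 // ltW.
Qed.

Lemma ple_growth (t : R) : 0 < t < 1 -> exists B : R, forall N n, (ple N n)%:R * t ^+ n <= B.
Proof.
move=> ht; case/andP: (ht) => t0 t1; exists (poch_lb t t)^-1 => N n.
have l0 : 0 < poch_lb t t by exact: expR_gt0.
have hl : poch_lb t t <= \prod_(i < N) (1 - t ^+ i.+1).
  have h := @prod_lower R (fun i => (t ^+ i.+1)%:C) t t N _ t1 _.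
  have {}h := h ltac:(by rewrite ltW) ltac:(by move=> i; rewrite nrm_real ger0_norm ?exprn_ge0 ?exprS // ltW).
  apply: le_trans h _; rewrite nrm_prod; apply: ler_prod => i _.
  rewrite nrm_ge0 andTb (_ : 1 - (t ^+ i.+1)%:C = (1 - t ^+ i.+1)%:C); last by rewrite rmorphB rmorph1.
  rewrite nrm_real ger0_norm //.
  by rewrite subr_ge0 exprn_ile1 // ltW.
have hs := ple_sum N n.+1 ht.
have S0 : 0 <= \sum_(i < n.+1) (ple N i)%:R * t ^+ i.
  by apply: sumr_ge0 => i _; rewrite mulr_ge0 ?exprn_ge0 // ltW.
rewrite -[leRHS]mul1r ler_pdivlMr //; apply: le_trans hs; rewrite mulrC.
have h1 : (ple N n)%:R * t ^+ n <= \sum_(i < n.+1) (ple N i)%:R * t ^+ i.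
  by rewrite big_ord_recr /= lerDr; apply: sumr_ge0 => i _; rewrite mulr_ge0 ?exprn_ge0 // ltW.
apply: ler_pM => //; first exact: ltW.
by rewrite mulr_ge0 ?exprn_ge0 // ltW.
Qed.

Definition pc n : C := (pn n)%:R.
Definition Xc r n : C := (cge r%:Z n)%:R.
Definition plc N n : C := (ple N n)%:R.

Lemma gro_pc : gro pc.
Proof.
move=> t ht; have [B HB] := ple_growth ht; exists B => n.
by rewrite nrm_nat -(ple_pn (leqnn n)).
Qed.
Lemma gro_le_pc (a : nat -> C) : (forall n, nrm (a n) <= (pn n)%:R) -> gro a.
Proof. by move=> h; apply: gro_le gro_pc => n; rewrite nrm_nat. Qed.
Lemma gro_plc N : gro (plc N).
Proof. by apply: gro_le_pc => n; rewrite nrm_nat ler_nat count_size. Qed.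
Lemma gro_Xc r : gro (Xc r).
Proof. by apply: gro_le_pc => n; rewrite nrm_nat ler_nat count_size. Qed.

Definition Pgf x := psum pc x.
Definition Xgf r x := psum (Xc r) x.

Lemma plc_prod N x : nrm x < 1 -> psum (plc N) x * pochn x x N = 1.
Proof.
move=> x1; elim: N => [|N IH].
  rewrite /pochn big_ord0 mulr1; apply: psum_eq.
  apply: (clim_near (N := 1%N) _ (clim_cst 1)) => n n1; case: n n1 => // n _.
  rewrite big_ord_recl /plc ple0 eqxx mul1r expr0 big1 ?addr0 // => i _.
  by rewrite ple0 mul0r.
rewrite /pochn big_ord_recr /= mulrCA -[RHS]IH [RHS]mulrC /pochn; congr (_ * _).
have e : psum (plc N.+1) x = psum (plc N) x + x ^+ N.+1 * psum (plc N.+1) x.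
  rewrite -(psum_shift _ x1 (gro_plc _)) -(psumD x1 (gro_plc _)); last exact/gro_shift/gro_plc.
  congr psum; apply/funext => n; rewrite /plc ple_recS natrD /shift; congr (_ + _).
  by case: ifP.
by rewrite mulrBr mulr1 {1}e -exprS mulrC; ring.
Qed.

(** The limit N -> infinity in [plc_prod]; the growth bound of [ple_growth] does
    not depend on N, and coefficients below N have already stabilized. *)
Lemma Pgf_poch x : nrm x < 1 -> Pgf x * poch x x = 1.
Proof.
move=> x1; have [M HM] := gro_mid x1 gro_pc.
have [_ _ ht] := mid_lt (nrm_itv x1); case/andP: (ht) => t0 t1.
have cP : clim (fun N => psum (plc N) x) (Pgf x).
  set t := nrm x / ((1 + nrm x) / 2) in ht t0 t1.
  have M0 : 0 <= M by apply: le_trans (HM 0%N); rewrite expr0 mulr1 nrm_ge0.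
  apply: (@clim_null _ _ _ (fun N => M / (1 - t) * t ^+ N)).
    by apply: nullZ (null_geo ht); rewrite divr_ge0 //; lra.
  move=> N; rewrite mulrAC /t.
  have -> : psum (plc N) x - Pgf x = psum (fun n => plc N n + -1 * pc n) x.
    by rewrite psumD ?psumZ ?mulN1r //; [exact: gro_pc|exact: gro_plc|apply: groZ; exact: gro_pc].
  have hle n : nrm (plc N n + -1 * pc n) <= (pn n)%:R.
    rewrite mulN1r nrmBC /plc /pc -natrB; first by rewrite nrm_nat ler_nat leq_subr.
    by rewrite count_size.
  apply: psum_bound => // [n|n nN|].
  - apply: le_trans (HM n); rewrite ler_wpM2r ?exprn_ge0 //.
      by have [h _ _] := mid_lt (nrm_itv x1); rewrite ltW.
    by rewrite nrm_nat.
  - by rewrite /plc ple_pn ?(ltnW nN) // mulN1r subrr.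
  - exact: gro_le_pc.
apply: (clim_uniq (climM cP (poch_clim x x1))).
by apply: clim_ext (clim_cst 1) => N; rewrite plc_prod.
Qed.

Lemma Xgf_rec r x : nrm x < 1 -> (0 < r)%N -> Xgf r x = x ^+ r.+1 * (Pgf x - Xgf (r + 3) x).
Proof.
move=> x1 r0; have -> : Pgf x - Xgf (r + 3) x = psum (fun n => pc n + -1 * Xc (r + 3) n) x.
  by rewrite psumD ?psumZ ?mulN1r //; [exact: gro_Xc|exact: gro_pc|apply: groZ; exact: gro_Xc].
rewrite -psum_shift //; last by apply: groD; [exact: gro_pc|apply: groZ; exact: gro_Xc].
congr psum; apply/funext => n; rewrite /shift; case: ltnP => h.
  by rewrite /Xc cge_small.
rewrite mulN1r /pc /Xc -(cge_rec r (n - r.+1)) subnK // natrD addrK //.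
Qed.

Lemma Pgf_rec x : nrm x < 1 -> Pgf x = 1 + x * Pgf x - x * Xgf 3 x + Xgf 1 x.
Proof.
move=> x1.
have g1 := gro_shift 1 gro_pc; have g3 := gro_shift 1 (gro_Xc 3).
have e1 := psum_shift 1 x1 gro_pc; have e3 := psum_shift 1 x1 (gro_Xc 3).
rewrite expr1 in e1; rewrite expr1 in e3; rewrite -/(Pgf x) in e1; rewrite -/(Xgf 3 x) in e3.
pose d (n : nat) : C := if n is 0 then 1 else 0.
have gd : gro d by move=> r /andP[r0 r1]; exists 1; case=> [|n]; rewrite /d ?nrm0 ?mul0r // nrm1 mul1r expr0.
have ed : psum d x = 1.
  apply: psum_eq; apply: (clim_near (N := 1%N) _ (clim_cst 1)) => n n1; case: n n1 => // n _.
  by rewrite big_ord_recl /= mul1r expr0 big1 ?addr0 // => i _; rewrite mul0r.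
have gX := gro_Xc 1.
rewrite -e1 -e3 -ed -mulN1r -psumZ // -psumD // -psumD //; last 2 first.
- by apply: groD.
- exact: groZ.
rewrite -psumD //; last by apply: groD; [exact: groD|exact: groZ].
congr psum; apply/funext => -[|n]; rewrite /d /shift /pc /Xc /=.
  by rewrite cge_small // /pn; have := ple_pn (leqnn 0); rewrite ple0 /pn => <-; rewrite mulr0 !addr0.
rewrite subn1 /= add0r mulN1r.
have := pn_rec n => /(congr1 (fun k => k%:R : C)); rewrite !natrD => h.
by rewrite addrAC -h addrK.
Qed.

(** The pentagonal numbers k(3k-1)/2; the recursive form matches the iteration
    step of [Xgf_iter]. *)
Fixpoint pe (k : nat) : nat := if k is k'.+1 then (pe k' + 3 * k' + 1)%N else 0%N.

Lemma peE k : ((pe k).*2 + k = 3 * k ^ 2)%N.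
Proof. elim: k => //= k IH; nia. Qed.
Lemma pe_ge k : (k <= pe k)%N.
Proof. elim: k => //= k IH; lia. Qed.

Definition Xpart K r x : C := \sum_(k < K) (-1) ^+ k * x ^+ (pe k.+1 + k.+1 * r).

(** The recursion [Xgf_rec] raises r by 3 and multiplies by x^(r+1); the sums of
    these exponents are pentagonal numbers plus multiples of r. *)
Lemma Xgf_iter K r x : nrm x < 1 -> (0 < r)%N ->
  Xgf r x = Pgf x * Xpart K r x + (-1) ^+ K * x ^+ (pe K + K * r) * Xgf (r + 3 * K) x.
Proof.
move=> x1 r0; elim: K => [|K IH].
  have -> : (pe 0 + 0 * r = 0)%N by [].
  by rewrite /Xpart big_ord0 mulr0 add0r !expr0 !mul1r muln0 addn0.
rewrite IH Xgf_rec //; last by lia.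
rewrite /Xpart big_ord_recr /=.
have -> : (r + 3 * K + 3 = r + 3 * K.+1)%N by lia.
have -> : (pe K + 3 * K + 1 + K.+1 * r = (pe K + K * r) + (r + 3 * K).+1)%N by lia.
rewrite (exprD x (pe K + K * r)) (exprS (-1) K); ring.
Qed.

Lemma Xgf_bound x : nrm x < 1 -> exists B, 0 <= B /\ forall r, (0 < r)%N -> nrm (Xgf r x) <= B * nrm x ^+ r.
Proof.
move=> x1; have [M HM] := gro_mid x1 gro_pc.
have [h0 _ ht] := mid_lt (nrm_itv x1); case/andP: (ht) => t0 t1.
set t := nrm x / _ in ht t0 t1.
have M0 : 0 <= M by apply: le_trans (HM 0%N); rewrite expr0 mulr1 nrm_ge0.
exists (M / (1 - t)); split; first by rewrite divr_ge0 //; lra.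
move=> r r0; rewrite Xgf_rec // nrmM nrmX mulrC.
apply: ler_pM; rewrite ?exprn_ge0 //; last first.
  by rewrite exprS ler_piMl ?exprn_ge0 // ltW.
have -> : Pgf x - Xgf (r + 3) x = psum (fun n => pc n + -1 * Xc (r + 3) n) x.
  by rewrite psumD ?psumZ ?mulN1r //; [exact: gro_Xc|exact: gro_pc|apply: groZ; exact: gro_Xc].
have hle n : nrm (pc n + -1 * Xc (r + 3) n) <= (pn n)%:R.
  rewrite mulN1r /Xc /pc -natrB; first by rewrite nrm_nat ler_nat leq_subr.
  by rewrite count_size.
have -> : M / (1 - t) = M * t ^+ 0 / (1 - t) by rewrite expr0 mulr1.
apply: psum_bound => // [n|].
  apply: le_trans (HM n); rewrite ler_wpM2r ?exprn_ge0 ?(ltW h0) //.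
  by rewrite nrm_nat.
exact: gro_le_pc.
Qed.

(** Inserting the iterated recursion for the generating functions of ranks at
    least 1 and at least 3 into [Pgf_rec] shows that the partition generating
    function times the pentagonal series is 1.  Comparing with [Pgf_poch] gives
    Euler's theorem. *)
Lemma pentagonal x : nrm x < 1 ->
  clim (fun K => 1 + \sum_(k < K) (-1) ^+ k.+1 * (x ^+ pe k.+1 + x ^+ (pe k.+1 + k.+1))) (poch x x).
Proof.
move=> x1; have hP := Pgf_poch x1; have [B [B0 HB]] := Xgf_bound x1.
have P0 : Pgf x != 0 by apply: contra_eq_neq hP => ->; rewrite mul0r eq_sym oner_neq0.
have -> : poch x x = (Pgf x)^-1 * 1 by rewrite mulr1 -[RHS]mulr1 -hP mulKf.
pose S K := 1 + \sum_(k < K) (-1) ^+ k.+1 * (x ^+ pe k.+1 + x ^+ (pe k.+1 + k.+1)).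
suff cl : clim (fun K => Pgf x * S K) 1.
  by apply: clim_ext (climZ (Pgf x)^-1 cl) => K; rewrite mulKf.
apply: (@clim_unaddn _ 1).
apply: (@clim_null _ _ _ (fun K => (2 * B + nrm (Pgf x)) * nrm x ^+ K)).
  by apply: nullZ (null_geo (nrm_itv x1)); rewrite addr_ge0 ?nrm_ge0 ?mulr_ge0.
move=> K; rewrite addn1.
have x0 := nrm_ge0 x; have xle := ltW x1.
have eS : S K.+1 = 1 - x + x * Xpart K 3 x - Xpart K 1 x + (-1) ^+ K.+1 * x ^+ (pe K.+1 + K.+1).
  rewrite /S; under eq_bigr do rewrite mulrDr.
  rewrite big_split /= big_ord_recl /= [X in _ + (_ + X)]big_ord_recr /=.
  have -> : \sum_(i < K) (-1) ^+ i.+1 * x ^+ (pe i + 3 * i + 1 + i.+1) = - Xpart K 1 x.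
    rewrite /Xpart -sumrN; apply: eq_bigr => i _; rewrite muln1 exprS mulN1r mulNr //.
  have -> : \sum_(i < K) (-1) ^+ (bump 0 i).+1 * x ^+ (pe (bump 0 i) + 3 * bump 0 i + 1) = x * Xpart K 3 x.
    rewrite /Xpart mulr_sumr; apply: eq_bigr => i _; rewrite /bump add1n !exprS !mulN1r opprK.
    rewrite mulrCA -exprS; congr (_ * x ^+ _); rewrite /=; lia.
  rewrite /= expr1; ring.
have e1 := Xgf_iter K x1 (ltn0Sn 0); have e3 := Xgf_iter K x1 (ltn0Sn 2).
have hr := Pgf_rec x1.
set E1 := (X in _ + X) in e1; set E3 := (X in _ + X) in e3.
have bE r : (0 < r)%N -> nrm ((-1) ^+ K * x ^+ (pe K + K * r) * Xgf (r + 3 * K) x) <= B * nrm x ^+ K.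
  move=> r0; rewrite !nrmM !nrmX nrmN nrm1 expr1n mul1r.
  have h1 : nrm x ^+ (pe K + K * r) <= 1 by rewrite exprn_ile1.
  have h2 : nrm (Xgf (r + 3 * K) x) <= B * nrm x ^+ K.
    apply: le_trans (HB _ _) _; first by lia.
    by rewrite ler_wpM2l // ler_wiXn2l //; lia.
  by rewrite -[leRHS]mul1r ler_pM ?exprn_ge0.
have b1 : nrm E1 <= B * nrm x ^+ K by exact: bE.
have b3 : nrm E3 <= B * nrm x ^+ K by exact: bE.
have -> : Pgf x * S K.+1 - 1 = E1 - x * E3 + Pgf x * ((-1) ^+ K.+1 * x ^+ (pe K.+1 + K.+1)).
  have e1' : Pgf x * Xpart K 1 x = Xgf 1 x - E1 by rewrite e1 addrK.
  have e3' : Pgf x * Xpart K 3 x = Xgf 3 x - E3 by rewrite e3 addrK.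
  have hr' : Xgf 1 x = Pgf x - 1 - x * Pgf x + x * Xgf 3 x.
    have -> : Xgf 1 x = (1 + x * Pgf x - x * Xgf 3 x + Xgf 1 x) - (1 + x * Pgf x - x * Xgf 3 x) by ring.
    by rewrite -hr; ring.
  rewrite eS; set T := _ * x ^+ (pe _ + _).
  have -> : Pgf x * (1 - x + x * Xpart K 3 x - Xpart K 1 x + T) - 1 =
    Pgf x - x * Pgf x + x * (Pgf x * Xpart K 3 x) - Pgf x * Xpart K 1 x + Pgf x * T - 1 by ring.
  rewrite e1' e3' hr'; ring.
apply: le_trans (nrmD _ _) _; rewrite mulrDl; apply: lerD.
  apply: le_trans (nrmB _ _) _; rewrite mulrDl mul1r mulrDl; apply: lerD => //.
  rewrite nrmM; apply: le_trans b3; rewrite ler_piMl //.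
rewrite nrmM ler_wpM2l // nrmM !nrmX nrmN nrm1 expr1n mul1r ler_wiXn2l //; lia.
Qed.

End PartGF.

(** * The generating function of the rank at a point of the unit circle *)
Section RankSum.
Variable R : realType.
Local Notation C := R[i].
Implicit Types (x z : C).

Lemma count_sum (T : Type) (a : pred T) (s : seq T) : (count a s)%:R = \sum_(l <- s) (a l)%:R :> C.
Proof. by rewrite -sum1_count big_mkcond natr_sum; apply: eq_bigr => l _; case: (a l). Qed.

(** The exponent of z matters only modulo p, so the classes of ranks may be
    summed rank by rank. *)
Lemma rank_count_sum z p n : (0 < p)%N -> z ^+ p = 1 ->
  \sum_(0 <= k < p) (rank_count k p n)%:R * z ^+ k = \sum_(l <- parts n) z ^ rank l.
Proof.
move=> p0 zp; have z0 : z != 0.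
  by apply: contra_eq_neq zp => ->; rewrite expr0n (gtn_eqF p0) eq_sym oner_neq0.
rewrite big_mkord; under eq_bigr do rewrite rank_countE count_sum mulr_suml.
rewrite exchange_big /=; apply: eq_bigr => l _.
have pz : (p%:Z != 0) by lia.
have m0 : (0 <= rank l %% p%:Z)%Z by rewrite modz_ge0.
have mp : (`|rank l %% p%:Z|%Z < p)%N by have := ltz_pmod (rank l) (_ : 0 < p%:Z); lia.
rewrite (bigD1 (Ordinal mp)) //= big1 => [|k /eqP hk].
  rewrite addr0 gez0_abs // modz_mod eqxx mul1r {2}(divz_eq (rank l) p%:Z).
  rewrite expfzDr // [((_ %/ _)%Z * _)%R]mulrC -exprz_exp -[z ^ p%:Z]/(z ^+ p) zp exp1rz mul1r.
  by rewrite -{2}(gez0_abs m0).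
case: eqP => [e|_]; last by rewrite mul0r.
case: hk; apply: val_inj => /=; rewrite e modz_small; last by have := ltn_ord k; lia.
by [].
Qed.

Definition rw z r : C := (z - 1) * z ^+ r + (z^-1 - 1) * z^-1 ^+ r.

Lemma sum_narrow (F : nat -> C) n a : (a <= n)%N -> \sum_(r < n) F r * (r < a)%N%:R = \sum_(r < a) F r.
Proof.
move=> an; rewrite (big_ord_widen _ F an) [RHS]big_mkcond; apply: eq_bigr => r _.
by case: ltnP => _; rewrite ?mulr1 ?mulr0.
Qed.

(** Telescoping z^k = 1 + (z - 1)(1 + z + ... + z^(k-1)), and likewise in 1/z for
    negative k, expresses z^rank by indicators of bounds on the rank, which
    Dyson's recursion controls. *)
Lemma rank_tele z n (k : int) : z != 0 -> (`|k| <= n)%N ->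
  z ^ k = 1 + \sum_(r < n) ((z - 1) * z ^+ r * (r.+1%:Z <= k)%R%:R + (z^-1 - 1) * z^-1 ^+ r * (k <= - r.+1%:Z)%R%:R).
Proof.
move=> z0; case: k => a /= an; rewrite big_split /=.
  have -> : \sum_(r < n) (z - 1) * z ^+ r * (r.+1%:Z <= a%:Z)%R%:R = \sum_(r < a) (z - 1) * z ^+ r.
    by rewrite -(sum_narrow (fun r => (z - 1) * z ^+ r) an); apply: eq_bigr => r _.
  rewrite [X in _ + (_ + X)]big1 => [|r _]; last by rewrite mulr0.
  by rewrite -mulr_sumr -subrX1 addr0 addrC subrK.
have -> : \sum_(r < n) (z^-1 - 1) * z^-1 ^+ r * (Negz a <= - r.+1%:Z)%R%:R = \sum_(r < a.+1) (z^-1 - 1) * z^-1 ^+ r.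
  rewrite -(sum_narrow (fun r => (z^-1 - 1) * z^-1 ^+ r) an); apply: eq_bigr => r _; congr (_ * _%:R).
rewrite [X in _ + (X + _)]big1 => [|r _]; last by rewrite mulr0.
by rewrite -mulr_sumr -subrX1 add0r addrC subrK exprVn.
Qed.

Definition rc z n : C := \sum_(l <- parts n) z ^ rank l.

Lemma rcE z n : z != 0 -> rc z n = pc R n + \sum_(r < n) rw z r * Xc R r.+1 n.
Proof.
move=> z0; rewrite /rc.
have -> : \sum_(l <- parts n) z ^ rank l = \sum_(l <- parts n) (1 + \sum_(r < n)
  ((z - 1) * z ^+ r * (r.+1%:Z <= rank l)%R%:R + (z^-1 - 1) * z^-1 ^+ r * (rank l <= - r.+1%:Z)%R%:R)).
  apply: eq_big_seq => l; rewrite mem_parts => /rank_bound hl; apply: rank_tele => //; lia.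
rewrite big_split /= [X in X + _]big_const_seq count_predT iter_addr_0 exchange_big /=.
congr (_ + _); apply: eq_bigr => r _; rewrite big_split /= -!mulr_sumr.
rewrite /Xc /rw [RHS]mulrDl; congr (_ * _ + _ * _); first by rewrite /cge count_sum.
by rewrite cge_conj // /cle count_sum.
Qed.

Lemma rw_bound z r : nrm z = 1 -> nrm (rw z r) <= 4.
Proof.
move=> z1; apply: le_trans (nrmD _ _) _.
rewrite !nrmM !nrmX nrmV z1 invr1 expr1n !mulr1.
have := nrmB z 1; have := nrmB z^-1 1; rewrite nrmV z1 invr1 nrm1; lra.
Qed.

Lemma unit_neq0 z : nrm z = 1 -> z != 0.
Proof. by move=> z1; rewrite -nrm_gt0 z1. Qed.

Lemma gro_rc z : nrm z = 1 -> gro (rc z).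
Proof.
move=> z1; apply: gro_le_pc => n; rewrite /rc; apply: le_trans (nrm_sum _ _ _) _.
rewrite /pn -sum1_size natr_sum; apply: ler_sum => l _.
case: (rank l) => k; first by rewrite -[z ^ _]/(z ^+ k) nrmX z1 expr1n.
by rewrite -[z ^ Negz k]/((z ^+ k.+1)^-1) nrmV nrmX z1 expr1n invr1.
Qed.

Lemma gro_n (a : nat -> C) : gro a -> gro (fun n => n%:R * a n).
Proof.
move=> ga r hr; case/andP: (hr) => r0 r1.
have hr' : 0 <= r < 1 by rewrite ltW.
have [s0 s1 hs] := mid_lt hr'; set s := (1 + r) / 2 in s0 s1 hs.
have [M HM] := ga s ltac:(by rewrite s0).
have M0 : 0 <= M by apply: le_trans (HM 0%N); rewrite expr0 mulr1 nrm_ge0.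
exists ((1 - r / s)^-1 * M) => n.
have -> : nrm (n%:R * a n) * r ^+ n = (n%:R * (r / s) ^+ n) * (nrm (a n) * s ^+ n).
  rewrite nrmM nrm_nat exprMn exprVn; field; by rewrite expf_neq0 // gt_eqF.
apply: ler_pM => //; rewrite ?mulr_ge0 ?exprn_ge0 ?nrm_ge0 ?ngeo_bound //; last by rewrite ltW.
by case/andP: hs.
Qed.

Lemma sum_ord_split (F : nat -> C) m n : (m <= n)%N ->
  \sum_(r < n) F r = \sum_(r < m) F r + \sum_(r < n - m) F (m + r)%N.
Proof. by move=> mn; rewrite -(subnKC mn); move: (n - m)%N => k; rewrite addKn big_split_ord. Qed.

(** A truncation of [rcE]: for each M only finitely many of the series in [Xgf]
    enter, and the limit M -> infinity is taken last. *)
Definition rcM z M n : C := pc R n + \sum_(r < M) rw z r * Xc R r.+1 n.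

Lemma rcM_gf z M x : nrm x < 1 -> psum (rcM z M) x = Pgf x + \sum_(r < M) rw z r * Xgf r.+1 x.
Proof.
move=> x1; have g r : gro (fun n => rw z r * Xc R r.+1 n) by apply: groZ; exact: gro_Xc.
rewrite /rcM psumD ?psum_sum //; [|exact: gro_pc|exact: gro_sum].
by congr (_ + _); apply: eq_bigr => r _; rewrite psumZ //; exact: gro_Xc.
Qed.

(** The coefficients of [rcM z M] and [rc z] agree up to degree M, and they differ
    at most by 4n times the number of partitions of n. *)
Lemma rcM_lim z x : nrm z = 1 -> nrm x < 1 -> clim (fun M => psum (rcM z M) x) (psum (rc z) x).
Proof.
move=> z1 x1; have z0 := unit_neq0 z1.
pose D (n : nat) : C := 4 * (n%:R * pc R n).
have gD : gro D by apply: groZ; apply: gro_n; exact: gro_pc.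
have [B HB] := gro_mid x1 gD.
have [h0 _ ht] := mid_lt (nrm_itv x1); case/andP: (ht) => t0 t1.
have B0 : 0 <= B by apply: le_trans (HB 0%N); rewrite expr0 mulr1 nrm_ge0.
set t := nrm x / ((1 + nrm x) / 2) in ht t0 t1.
apply: (@clim_null _ _ _ (fun N => B / (1 - t) * t ^+ N)).
  by apply: nullZ (null_geo ht); rewrite divr_ge0 //; lra.
move=> M.
have gM : gro (rcM z M).
  by apply: groD; [exact: gro_pc|apply: gro_sum => r; apply: groZ; exact: gro_Xc].
have gr := gro_rc z1.
have -> : psum (rcM z M) x - psum (rc z) x = psum (fun n => rcM z M n + -1 * rc z n) x.
  by rewrite psumD ?psumZ ?mulN1r //; apply: groZ.
have ext n K : (n <= K)%N -> \sum_(r < K) rw z r * Xc R r.+1 n = \sum_(r < n) rw z r * Xc R r.+1 n.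
  move=> nK; rewrite -(subnKC nK) big_split_ord /= [X in _ + X]big1 ?addr0 // => r _.
  by rewrite /Xc cge_small ?mulr0 //; lia.
have d0 n : (n <= M)%N -> rcM z M n + -1 * rc z n = 0.
  by move=> nM; rewrite rcE // /rcM ext // mulN1r subrr.
have dle n : nrm (rcM z M n + -1 * rc z n) <= nrm (D n).
  have [nM|Mn] := leqP n M; first by rewrite d0 // nrm0.
  rewrite rcE // /rcM mulN1r opprD addrACA subrr add0r.
  rewrite (sum_ord_split (fun r => rw z r * Xc R r.+1 n) (ltnW Mn)) opprD addrA subrr add0r nrmN.
  apply: le_trans (nrm_sum _ _ _) _.
  apply: le_trans (_ : \sum_(i < n - M) 4 * (pn n)%:R <= _).
    apply: ler_sum => i _; rewrite nrmM ler_pM ?rw_bound //.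
    by rewrite /Xc nrm_nat ler_nat count_size.
  rewrite sumr_const card_ord /D /pc !nrmM !nrm_nat -[leLHS]mulr_natl [leLHS]mulrCA ler_wpM2l //.
  by rewrite ler_wpM2r // ler_nat leq_subr.
rewrite mulrAC; apply: psum_bound => // [n|n nM|].
- by apply: le_trans (HB n); rewrite ler_wpM2r ?exprn_ge0 // ltW.
- by rewrite d0 // ltnW.
- exact: gro_le gD.
Qed.

(** The value of the geometric series in [rw_sum]. *)
Definition Wy z y : C := (z - 1) * y / (1 - z * y) + (z^-1 - 1) * y / (1 - y / z).

Lemma geo_clim (y : C) : nrm y < 1 -> clim (fun n => \sum_(i < n) y ^+ i) (1 - y)^-1.
Proof.
move=> y1; have nz : 1 - y != 0 by apply: sub1_neq0 (lexx _) y1.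
have := climM (climB (clim_cst 1) (clim_geo0 y1)) (clim_cst (1 - y)^-1).
rewrite subr0 mul1r; apply: clim_ext => n; apply: (mulIf nz).
by rewrite divfK // -[1 - y]opprB mulrN mulrC -subrX1 opprB.
Qed.

Lemma rw_sum z y : nrm z = 1 -> nrm y < 1 -> clim (fun M => \sum_(r < M) rw z r * y ^+ r.+1) (Wy z y).
Proof.
move=> z1 y1.
have h1 : nrm (z * y) < 1 by rewrite nrmM z1 mul1r.
have h2 : nrm (y / z) < 1 by rewrite nrmM nrmV z1 invr1 mulr1.
apply: clim_ext (climD (climZ ((z - 1) * y) (geo_clim h1)) (climZ ((z^-1 - 1) * y) (geo_clim h2))) => M.
rewrite !mulr_sumr -big_split; apply: eq_bigr => r _ /=.
rewrite /rw exprS !exprMn; ring.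
Qed.

Definition Tk z x K : C := 1 + \sum_(k < K) (-1) ^+ k * x ^+ pe k.+1 * Wy z (x ^+ k.+1).

(** Insert [Xgf_iter] into [rcM_gf] and exchange the sums over r and k; summing
    the geometric series over r leaves a series over pentagonal numbers. *)
Lemma rank_gf_lim z x : nrm z = 1 -> nrm x < 1 -> clim (fun K => Pgf x * Tk z x K) (psum (rc z) x).
Proof.
move=> z1 x1; have [B [B0 HB]] := Xgf_bound x1.
have x0 := nrm_ge0 x; have d0 : 0 < 1 - nrm x by lra.
apply: (@clim_null _ _ _ (fun K => 4 * B / (1 - nrm x) * nrm x ^+ K)).
  by apply: nullZ (null_geo (nrm_itv x1)); rewrite divr_ge0 ?mulr_ge0 // ltW.
move=> K; rewrite nrmBC.
have cT : clim (fun M => Pgf x * (1 + \sum_(r < M) rw z r * Xpart K r.+1 x)) (Pgf x * Tk z x K).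
  apply: climZ; apply: climD; first exact: clim_cst.
  have xk k : nrm (x ^+ k.+1) < 1 by rewrite nrmX exprn_ilt1.
  have := clim_sum (index_enum 'I_K) (fun k : 'I_K => climZ ((-1) ^+ k * x ^+ pe k.+1) (rw_sum z1 (xk k))).
  apply: clim_ext => M; under eq_bigr do rewrite mulr_sumr.
  rewrite exchange_big /=; apply: eq_bigr => r _; rewrite /Xpart mulr_sumr; apply: eq_bigr => k _.
  by rewrite -[(pe k + 3 * k + 1)%N]/(pe k.+1) (exprD x (pe k.+1)) exprM; ring.
apply: (clim_nrm_le (N := 0%N) _ (climB (rcM_lim z1 x1) cT)) => M _.
rewrite rcM_gf // mulrDr mulr1 opprD addrACA subrr add0r mulr_sumr -sumrB.
apply: le_trans (nrm_sum _ _ _) _.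
apply: le_trans (_ : \sum_(r < M) 4 * B * nrm x ^+ K * nrm x ^+ r <= _); last first.
  rewrite -mulr_sumr -[leRHS]mulrA [_^-1 * _]mulrC mulrA ler_wpM2l ?geo_sum_le0 ?nrm_itv //.
  by rewrite !mulr_ge0 ?exprn_ge0.
apply: ler_sum => r _; rewrite mulrCA -mulrBr nrmM -!mulrA.
apply: ler_pM => //; first exact: rw_bound.
rewrite (Xgf_iter K x1 (ltn0Sn r)) addrAC subrr add0r !nrmM !nrmX nrmN nrm1 expr1n mul1r.
have h1 : nrm x ^+ (pe K + K * r.+1) <= 1 by rewrite exprn_ile1 // ltW.
have h2 : nrm (Xgf (r.+1 + 3 * K) x) <= B * (nrm x ^+ K * nrm x ^+ r).
  apply: le_trans (HB _ _) _; first by lia.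
  by rewrite ler_wpM2l // -exprD ler_wiXn2l ?(ltW x1) //; lia.
by rewrite -[leRHS]mul1r ler_pM ?exprn_ge0.
Qed.

End RankSum.

(** * Sums over the integers and the Appell sum *)
Section Zsum.
Variable R : realType.
Local Notation C := R[i].
Implicit Types (x z : C) (f g : int -> C).

(** The symmetric partial sums pair n with -n-1, so that the tails of the series
    met here can be bounded together. *)
Definition zpart f K : C := \sum_(k < K) (f (Posz k) + f (Negz k)).
Definition zsum f l := clim (zpart f) l.
(** Shifting or reflecting the index changes a symmetric partial sum by finitely
    many boundary terms, which this condition makes negligible. *)
Definition zdecay f := clim (fun k : nat => f (Posz k)) 0 /\ clim (fun k : nat => f (Negz k)) 0.

Lemma zsum_ext f g l : (forall n, f n = g n) -> zsum f l -> zsum g l.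
Proof. by move=> /funext ->. Qed.
Lemma zsum_uniq f l m : zsum f l -> zsum f m -> l = m.
Proof. exact: clim_uniq. Qed.
Lemma zsumD f g l m : zsum f l -> zsum g m -> zsum (fun n => f n + g n) (l + m).
Proof.
move=> hf hg; apply: clim_ext (climD hf hg) => K.
by rewrite /zpart -big_split; apply: eq_bigr => k _ /=; rewrite addrACA.
Qed.
Lemma zsumZ c f l : zsum f l -> zsum (fun n => c * f n) (c * l).
Proof.
move=> hf; apply: clim_ext (climZ c hf) => K.
by rewrite /zpart mulr_sumr; apply: eq_bigr => k _; rewrite mulrDr.
Qed.
Lemma zsum_sum (I : Type) (s : seq I) (f : I -> int -> C) (l : I -> C) :
  (forall i, zsum (f i) (l i)) -> zsum (fun n => \sum_(i <- s) f i n) (\sum_(i <- s) l i).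
Proof.
move=> hf; elim: s => [|i s IH].
  rewrite big_nil; apply: clim_ext (clim_cst 0) => K.
  by rewrite /zpart big1 // => k _; rewrite !big_nil addr0.
rewrite big_cons; apply: zsum_ext (zsumD (hf i) IH) => n; by rewrite big_cons.
Qed.

Lemma zpartS f K : zpart f K.+1 = zpart f K + (f (Posz K) + f (Negz K)).
Proof. by rewrite /zpart big_ord_recr. Qed.

Lemma zpart_shift f K : zpart (fun n => f (n + 1)) K = zpart f K + f K%:Z - f (- K%:Z).
Proof.
elim: K => [|K IH]; first by rewrite /zpart !big_ord0 oppr0; ring.
rewrite !zpartS IH.
have -> : (Posz K + 1 = Posz K.+1)%R by lia.
have -> : (Negz K + 1 = - Posz K)%R by lia.
by rewrite -[Negz K]/(- Posz K.+1)%R; ring.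
Qed.

Lemma zdecay_term f : zdecay f -> clim (fun K => f K%:Z - f (- K%:Z)) 0.
Proof.
case=> h1 h2; rewrite -[X in clim _ X](subrr 0); apply: climB => //.
by apply: (@clim_unaddn _ 1); apply: clim_ext h2 => n; rewrite addn1.
Qed.

Lemma zsum_shift1 f l : zdecay f -> zsum f l -> zsum (fun n => f (n + 1)) l.
Proof.
move=> df hf; rewrite -[l]addr0; apply: clim_ext (climD hf (zdecay_term df)) => K.
by rewrite zpart_shift addrA.
Qed.
Lemma zsum_unshift1 f l : zdecay f -> zsum (fun n => f (n + 1)) l -> zsum f l.
Proof.
move=> df hf; rewrite -[l]subr0; apply: clim_ext (climB hf (zdecay_term df)) => K.
by rewrite zpart_shift; ring.
Qed.
Lemma zdecay_shift1 f : zdecay f -> zdecay (fun n => f (n + 1)).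
Proof.
case=> h1 h2; split.
  by apply: clim_ext (clim_addn 1 h1) => n; rewrite PoszD.
apply: (@clim_unaddn _ 1); apply: clim_ext h2 => n.
by congr f; rewrite addn1; lia.
Qed.
Lemma zsum_shift f l m : zdecay f -> zsum f l -> zsum (fun n => f (n + Posz m)) l.
Proof.
move=> df hf; have [_] : zdecay (fun n => f (n + Posz m)) /\ zsum (fun n => f (n + Posz m)) l; last by [].
elim: m => [|m [IH1 IH2]].
  by have -> : (fun n : int => f (n + 0)) = f by apply/funext => n; rewrite addr0.
have -> : (fun n : int => f (n + Posz m.+1)) = (fun n => (fun k => f (k + Posz m)) (n + 1)).
  by apply/funext => n; congr f; lia.
by split; [exact: (zdecay_shift1 (f := fun k => f (k + Posz m)))|exact: (zsum_shift1 (f := fun k => f (k + Posz m)))].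
Qed.
Lemma zsum_opp f l : zdecay f -> zsum f l -> zsum (fun n => f (- n)) l.
Proof.
move=> df hf; rewrite -[l]addr0; apply: clim_ext (climD hf (zdecay_term df)) => K.
rewrite /= addrA -zpart_shift; elim: K => [|K IH]; first by rewrite /zpart !big_ord0.
rewrite !zpartS IH.
have -> : (Posz K + 1 = Posz K.+1)%R by lia.
have -> : (Negz K + 1 = - Posz K)%R by lia.
by rewrite -[Negz K]/(- Posz K.+1)%R opprK; ring.
Qed.

Lemma zdecay_geo f (M t : R) N : 0 <= M -> 0 <= t < 1 ->
  (forall k, (N <= k)%N -> nrm (f (Posz k)) <= M * t ^+ k /\ nrm (f (Negz k)) <= M * t ^+ k) -> zdecay f.
Proof.
move=> M0 ht hf; have nt := nullZ M0 (null_geo ht).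
split; move=> e e0; have [L hL] := nt _ e0; exists (maxn N L) => k; rewrite geq_max => /andP[k1 k2];
  rewrite subr0; apply: le_lt_trans (hL _ k2); by have [] := hf k k1.
Qed.

Lemma series_ev (a : nat -> C) (M t : R) N : 0 <= M -> 0 <= t < 1 ->
  (forall n, (N <= n)%N -> nrm (a n) <= M * t ^+ n) ->
  exists l, clim (fun n => \sum_(i < n) a i) l.
Proof.
move=> M0 ht ha; case/andP: (ht) => t0 t1.
have [l cl] : exists l, clim (fun n => \sum_(i < n) a (N + i)%N) l.
  apply: (geo_series (a := fun i => a (N + i)%N) (M := M * t ^+ N) ht) => n.
  by rewrite -mulrA -exprD ha // leq_addr.
exists (\sum_(i < N) a i + l); apply: (@clim_unaddn _ N).
by apply: clim_ext (climD (clim_cst _) cl) => n; rewrite addnC big_split_ord.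
Qed.

Lemma series_ev_tail (a : nat -> C) (M t : R) N l : 0 <= M -> 0 <= t < 1 ->
  (forall n, (N <= n)%N -> nrm (a n) <= M * t ^+ n) ->
  clim (fun n => \sum_(i < n) a i) l ->
  forall n, (N <= n)%N -> nrm (l - \sum_(i < n) a i) <= M * t ^+ n / (1 - t).
Proof.
move=> M0 ht ha cl n Nn; case/andP: (ht) => t0 t1.
apply: (clim_nrm_le (N := n) _ (climB cl (clim_cst _))) => k nk.
rewrite -!(big_mkord xpredT a) (big_cat_nat (leq0n n) nk) //= addrAC subrr add0r.
apply: le_trans (nrm_sum _ _ _) _.
apply: le_trans (_ : \sum_(n <= i < k) M * t ^+ i <= _).
  rewrite big_nat_cond [leRHS]big_nat_cond; apply: ler_sum => i /andP[/andP[h _] _].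
  by apply: ha; apply: leq_trans h.
by rewrite -mulr_sumr -mulrA ler_wpM2l // geo_sum_le.
Qed.

(** The generalized pentagonal number n(3n+1)/2. *)
Definition gpe (n : int) : nat := match n with Posz k => (pe k + k)%N | Negz k => pe k.+1 end.

Lemma gpe2 n : ((gpe n)%:Z * 2 = 3 * n * n + n)%R.
Proof. by case: n => k; rewrite /gpe; [have := peE k|have := peE k.+1]; nia. Qed.

Definition altsgn (n : int) : C := (-1) ^+ `|n|%N.
Lemma altsgnS (n : int) : altsgn (n + 1) = - altsgn n.
Proof.
rewrite /altsgn -signr_odd -[in RHS]signr_odd.
have -> : odd (absz (n + 1)) = ~~ odd (absz n) by lia.
by case: (odd _); rewrite ?expr0 ?expr1 ?opprK.
Qed.
Lemma altsgnN n : altsgn (- n) = altsgn n.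
Proof. by rewrite /altsgn abszN. Qed.
Lemma altsgnD n m : altsgn (n + Posz m) = (-1) ^+ m * altsgn n.
Proof.
elim: m => [|m IH]; first by rewrite addr0 mul1r.
have -> : (n + Posz m.+1 = (n + Posz m) + 1)%R by lia.
by rewrite altsgnS IH exprS mulN1r mulNr.
Qed.
Lemma nrm_altsgn n : nrm (altsgn n) = 1.
Proof. by rewrite /altsgn nrmX nrmN nrm1 expr1n. Qed.

Definition aterm z x n : C := altsgn n * x ^+ gpe n / (1 - z * x ^ n).
Definition wterm (i : nat) x n : C := altsgn n * x ^ ((gpe n)%:Z - i%:Z * n).
(** The level 3 Appell sum that generates the ranks. *)
Definition Ap z x : C := limn (fun K => (zpart (aterm z x) K : C^o)).
(** The theta constant, sum over n of (-1)^n x^(n(3n+1)/2 - i n), that measures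
    the failure of [Ap] to be quasi-periodic. *)
Definition Wv i x : C := limn (fun K => (zpart (wterm i x) K : C^o)).

Lemma aterm_neg z x k : x != 0 -> z != 0 ->
  aterm z x (Negz k) = - altsgn (Negz k) * x ^+ (gpe (Negz k) + k.+1) / z / (1 - x ^+ k.+1 / z).
Proof.
move=> x0 z0; rewrite /aterm -[x ^ Negz k]/((x ^+ k.+1)^-1).
have xk : x ^+ k.+1 != 0 by rewrite expf_neq0.
have -> : 1 - z / x ^+ k.+1 = - (z / x ^+ k.+1) * (1 - x ^+ k.+1 / z).
  by move: (x ^+ k.+1) xk => y y0; field; apply/andP.
by rewrite exprD !invfM invrN invfM invrK; ring.
Qed.

Lemma aterm_tail (r1 r2 : R) x : 0 < r1 -> x != 0 -> nrm x < 1 ->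
  exists N M, 0 <= M /\ forall z, ann r1 r2 z -> forall n, (N <= n)%N ->
   nrm (aterm z x (Posz n)) <= M * nrm x ^+ n /\ nrm (aterm z x (Negz n)) <= M * nrm x ^+ n.
Proof.
move=> r10 x0 x1; have xn0 := nrm_ge0 x; have hx := nrm_itv x1; have xle := ltW x1.
have h2 : (0 : R) < 1 / 2 by lra.
have [N1 hN1] := nullZ (normr_ge0 r2) (null_geo hx) h2.
have [N2 hN2] := nullZ (ltW (etrans (invr_gt0 _) r10)) (null_geo hx) h2.
exists (maxn N1 N2), (2 + 2 / r1); split; first by rewrite addr_ge0 // divr_ge0 // ltW.
move=> z /andP[z1 z2] n; rewrite geq_max => /andP[/hN1 n1 n2].
have z0 : z != 0 by rewrite -nrm_gt0; apply: lt_le_trans z1.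
have key (w : C) : nrm w <= 1 / 2 -> nrm (1 - w)^-1 <= 2.
  move=> hw; rewrite nrmV -[leRHS]invrK lef_pV2 ?posrE //; last first.
    by have := nrm_subl 1 w; rewrite nrm1; lra.
  by have := nrm_subl 1 w; rewrite nrm1; lra.
split.
  rewrite /aterm -[x ^ Posz n]/(x ^+ n) !nrmM nrm_altsgn mul1r nrmX /gpe.
  have k1 : nrm (1 - z * x ^+ n)^-1 <= 2.
    apply: key; rewrite nrmM nrmX; apply: le_trans (ltW n1).
    by rewrite ler_wpM2r ?exprn_ge0 // (le_trans z2) // ler_norm.
  apply: le_trans (_ : nrm x ^+ n * 2 <= _).
    by apply: ler_pM; rewrite ?exprn_ge0 // ler_wiXn2l // leq_addl.
  by rewrite mulrC ler_wpM2r ?exprn_ge0 // lerDl divr_ge0 // ltW.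
rewrite aterm_neg // !nrmM nrmN nrm_altsgn mul1r nrmX.
have n3 := hN2 n.+1 (leqW n2).
have k1 : nrm (1 - x ^+ n.+1 / z)^-1 <= 2.
  apply: key; rewrite nrmM nrmX nrmV; apply: le_trans (ltW n3).
  rewrite mulrC ler_wpM2r ?exprn_ge0 // lef_pV2 ?posrE // (lt_le_trans r10) //.
have k2 : nrm z^-1 <= r1^-1 by rewrite nrmV lef_pV2 ?posrE // (lt_le_trans r10).
have k3 : nrm x ^+ (gpe (Negz n) + n.+1) <= nrm x ^+ n by rewrite ler_wiXn2l // (leq_trans (leqnSn n) (leq_addl _ _)).
have k4 : nrm x ^+ (gpe (Negz n) + n.+1) * nrm z^-1 <= nrm x ^+ n * r1^-1.
  by apply: ler_pM; rewrite ?exprn_ge0.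
apply: le_trans (_ : nrm x ^+ n * r1^-1 * 2 <= _).
  by apply: ler_pM; rewrite ?mulr_ge0 ?exprn_ge0.
have p0 : 0 <= nrm x ^+ n by rewrite exprn_ge0.
rewrite mulrDl [leRHS]addrC -[leLHS]addr0; apply: lerD; last by rewrite mulr_ge0.
by rewrite -mulrA mulrC [2 / r1]mulrC.
Qed.

(** Uniformity in z on annuli is what the residue theorem needs.  Finitely many
    terms are left out because their poles may lie in the annulus. *)
Lemma Ap_tail (r1 r2 : R) x : 0 < r1 -> x != 0 -> nrm x < 1 ->
  exists N M, 0 <= M /\ forall z, ann r1 r2 z -> zdecay (aterm z x) /\ zsum (aterm z x) (Ap z x) /\
   forall n, (N <= n)%N -> nrm (Ap z x - zpart (aterm z x) n) <= M * nrm x ^+ n.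
Proof.
move=> r10 x0 x1; have hx := nrm_itv x1; have [N [M [M0 H]]] := aterm_tail r2 r10 x0 x1.
have M2 : 0 <= M + M by rewrite addr_ge0.
exists N, ((M + M) / (1 - nrm x)); split; first by rewrite divr_ge0 // subr_ge0 ltW.
move=> z hz; have {}H := H z hz.
have h n : (N <= n)%N -> nrm (aterm z x (Posz n) + aterm z x (Negz n)) <= (M + M) * nrm x ^+ n.
  move=> /H [h1 h2]; apply: le_trans (nrmD _ _) _; rewrite mulrDl; exact: lerD.
have [l cl] := series_ev M2 hx h.
split; first exact: zdecay_geo M0 hx H.
have e : Ap z x = l by apply: clim_lim.
rewrite e; split=> // n Nn.
have := series_ev_tail M2 hx h cl Nn; by rewrite mulrAC.
Qed.

Lemma Ap_zsum z x : z != 0 -> x != 0 -> nrm x < 1 -> zdecay (aterm z x) /\ zsum (aterm z x) (Ap z x).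
Proof.
move=> z0 x0 x1; have zp : 0 < nrm z by rewrite nrm_gt0.
have [N [M [_ H]]] := Ap_tail (nrm z) zp x0 x1.
by have [h1 [h2 _]] := H z ltac:(by rewrite /ann lexx).
Qed.

Lemma wterm_geo i x k : nrm x < 1 -> (i.+1 <= k)%N ->
  nrm (wterm i x (Posz k)) <= 1 * nrm x ^+ k /\ nrm (wterm i x (Negz k)) <= 1 * nrm x ^+ k.
Proof.
move=> x1 ik; have xle := ltW x1; split; rewrite /wterm nrmM nrm_altsgn !mul1r.
  have -> : ((gpe (Posz k))%:Z - i%:Z * Posz k = Posz (gpe (Posz k) - i * k))%R.
    by rewrite /gpe; have := peE k; nia.
  rewrite -[x ^ _]/(x ^+ _) nrmX ler_wiXn2l // /gpe; have := peE k; nia.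
have -> : ((gpe (Negz k))%:Z - i%:Z * Negz k = Posz (gpe (Negz k) + i * k.+1))%R by nia.
rewrite -[x ^ _]/(x ^+ _) nrmX ler_wiXn2l // /gpe; have := pe_ge k.+1; lia.
Qed.

Lemma wterm_decay i x : nrm x < 1 -> zdecay (wterm i x).
Proof.
move=> x1; apply: (zdecay_geo ler01 (nrm_itv x1)) => k; exact: wterm_geo.
Qed.

Lemma Wv_eq i x l : zsum (wterm i x) l -> Wv i x = l.
Proof. exact: clim_lim. Qed.

Lemma Wv0 x : nrm x < 1 -> zsum (wterm 0 x) (poch x x).
Proof.
move=> x1; have [d _] := wterm_decay 0 x1.
rewrite -[poch x x]subr0; apply: clim_ext (climB (pentagonal x1) d) => K.
have e k : wterm 0 x (Posz k) = (-1) ^+ k * x ^+ (pe k + k) by rewrite /wterm mul0r subr0.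
have e' k : wterm 0 x (Negz k) = (-1) ^+ k.+1 * x ^+ (pe k.+1) by rewrite /wterm mul0r subr0.
elim: K => [|K IH]; first by rewrite /zpart !big_ord0 e !mul1r addr0 expr0 subrr.
rewrite /zpart !big_ord_recr /= -/(zpart _ K) -IH !e e' /= mulrDr; ring.
Qed.

(** The index shift n -> n + 1 changes the exponent n(3n+1)/2 by 3n + 2. *)
Lemma Wv_step i x l : x != 0 -> nrm x < 1 -> zsum (wterm i x) l ->
  zsum (wterm (i + 3) x) (- x ^- i.+1 * l).
Proof.
move=> x0 x1 hl; apply: zsum_unshift1; first exact: wterm_decay.
apply: zsum_ext (zsumZ (- x ^- i.+1) hl) => n.
rewrite /wterm altsgnS !mulNr mulrCA; congr (- (_ * _)).
rewrite -[x ^- i.+1]/(x ^ (- Posz i.+1)%R) -expfzDr //; congr (x ^ _).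
have := gpe2 n; have := gpe2 (n + 1)%R; nia.
Qed.

Lemma Wv1 x : x != 0 -> nrm x < 1 -> zsum (wterm 1 x) (poch x x).
Proof.
move=> x0 x1; apply: zsum_ext (zsum_opp (wterm_decay 0 x1) (Wv0 x1)) => n.
rewrite /wterm altsgnN; congr (_ * x ^ _).
have := gpe2 n; have := gpe2 (- n)%R; nia.
Qed.

(** The exponent 3n(n-1)/2 is symmetric under n -> 1 - n, whereas the sign
    changes. *)
Lemma Wv2 x : x != 0 -> nrm x < 1 -> zsum (wterm 2 x) 0.
Proof.
move=> x0 x1; have d := wterm_decay 2 x1.
have [l hl] := series_ev ler01 (nrm_itv x1) (N := 3) (a := fun k => wterm 2 x (Posz k)) (fun k hk => (wterm_geo x1 hk).1).
have [l' hl'] := series_ev ler01 (nrm_itv x1) (N := 3) (a := fun k => wterm 2 x (Negz k)) (fun k hk => (wterm_geo x1 hk).2).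
have cl : zsum (wterm 2 x) (l + l').
  by apply: clim_ext (climD hl hl') => K; rewrite /zpart big_split.
have h := zsum_opp (zdecay_shift1 d) (zsum_shift1 d cl).
have e : (fun n => wterm 2 x (- n + 1)) = (fun n => -1 * wterm 2 x n).
  apply/funext => n; rewrite /wterm altsgnS altsgnN mulN1r mulNr; congr (- (_ * x ^ _)).
  have := gpe2 n; have := gpe2 (- n + 1)%R; nia.
rewrite e in h; have := zsum_uniq h (zsumZ (-1) cl) => h2.
have {}h2 : l + l' = 0.
  have h3 : (l + l') *+ 2 == 0 by rewrite mulr2n {1}h2 mulN1r addNr.
  by move: h3; rewrite mulrn_eq0 /= => /eqP.
by rewrite -h2.
Qed.

(** By [Wv_step] it suffices to treat i = 0, 1, 2; the first two are the pentagonal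
    number theorem.  The arithmetic relation between i and d is the reason for
    the residue class -s in the theorem. *)
Lemma Wv_eval i : exists (c : int) (d : nat), (c = 0 \/ (24 * d%:Z + 1 = (2 * i%:Z - 1) * (2 * i%:Z - 1))%R) /\
  forall x, x != 0 -> nrm x < 1 -> zsum (wterm i x) (c%:~R * x ^- d * poch x x).
Proof.
have [n] := ubnP i; elim: n i => // n IH i; case: i => [|[|[|i]]] hi.
- exists 1%R, 0%N; split; first by right.
  by move=> x x0 x1; rewrite expr0 invr1 !mul1r; exact: Wv0.
- exists 1%R, 0%N; split; first by right.
  by move=> x x0 x1; rewrite expr0 invr1 !mul1r; exact: Wv1.
- exists 0%R, 0%N; split; first by left.
  by move=> x x0 x1; rewrite !mul0r; exact: Wv2.
have [|c [d [h1 h2]]] := IH i; first by lia.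
exists (- c)%R, (d + i.+1)%N; split; first by case: h1 => [->|h]; [left|right]; lia.
move=> x x0 x1; have := Wv_step x0 x1 (h2 x x0 x1); rewrite addn3.
rewrite (_ : - x ^- i.+1 * _ = (- c)%:~R * x ^- (d + i.+1) * poch x x) //.
by rewrite exprD invfM mulrNz; ring.
Qed.

(** Reindexing by n -> n - m turns the summand into y^(-3m) / (1 - y) with
    y = z x^n, up to a factor (-1)^n x^(n(3n+1)/2) and one independent of n, and
    y^(-3m) / (1 - y) = 1 / (1 - y) + sum_(i < 3m) y^(-i-1). *)
Lemma Ap_shift z x m : z != 0 -> x != 0 -> nrm x < 1 -> (forall n : int, z * x ^ n != 1) ->
  Ap (z * x ^+ m) x = (-1) ^+ m * x ^+ pe m * z ^+ (3 * m) *
    (Ap z x + \sum_(i < 3 * m) z ^- i.+1 * Wv i.+1 x).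
Proof.
move=> z0 x0 x1 hz.
have hW i : zsum (wterm i x) (Wv i x).
  by have [c [d [_ h]]] := Wv_eval i; rewrite (Wv_eq (h x x0 x1)); exact: h.
have [dA hA] := Ap_zsum z0 x0 x1.
have zm0 : z * x ^+ m != 0 by rewrite mulf_neq0 // expf_neq0.
have [dB hB] := Ap_zsum zm0 x0 x1.
pose c := (-1) ^+ m * x ^+ pe m * z ^+ (3 * m).
pose f n := c * (aterm z x n + \sum_(i < 3 * m) z ^- i.+1 * wterm i.+1 x n).
have hf : zsum f (c * (Ap z x + \sum_(i < 3 * m) z ^- i.+1 * Wv i.+1 x)).
  apply: zsumZ; apply: zsumD => //; apply: zsum_sum => i; exact: zsumZ.
suff fe n : f (n + Posz m) = aterm (z * x ^+ m) x n.
  have df : zdecay f.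
    have [h1 h2] : zdecay (fun n => \sum_(i < 3 * m) z ^- i.+1 * wterm i.+1 x n).
      have w i := wterm_decay i.+1 x1.
      have s0 : \sum_(i < 3 * m) z ^- i.+1 * 0 = 0 :> C by rewrite big1 // => i _; rewrite mulr0.
      by split; rewrite -[X in clim _ X]s0; apply: clim_sum => i; apply: climZ; have [] := w i.
    have [h3 h4] := dA.
    by split; rewrite -[X in clim _ X](mulr0 c); apply: climZ; rewrite -[X in clim _ X](addr0 0); apply: climD.
  apply: zsum_uniq hB _; apply: zsum_ext (zsum_shift m df hf) => n; exact: fe.
have xm0 : x ^+ m != 0 by rewrite expf_neq0.
set n' := (n + Posz m)%R; pose X := z * x ^ n'.
have X1 : X != 1 by exact: hz.
have X0 : X != 0 by rewrite mulf_neq0 // expfz_neq0.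
have geo : forall k, X ^- k / (1 - X) = 1 / (1 - X) + \sum_(i < k) X ^- i.+1.
  have nz : 1 - X != 0 by rewrite subr_eq0 eq_sym.
  elim=> [|k IH]; first by rewrite big_ord0 addr0 expr0 invr1.
  rewrite big_ord_recr /= addrA -IH exprS; have : X ^+ k != 0 by rewrite expf_neq0.
  by move: (X ^+ k) => Y Y0; field; apply/and3P.
have e1 : (gpe n)%:Z = ((gpe n')%:Z + (pe m)%:Z - (3 * m)%:Z * n')%R.
  by have := gpe2 n; have := gpe2 n'; have := peE m; rewrite /n'; nia.
have -> : aterm (z * x ^+ m) x n = c * (altsgn n' * x ^+ gpe n' * (X ^- (3 * m) / (1 - X))).
  rewrite /aterm; have -> : z * x ^+ m * x ^ n = X.
    by rewrite /X /n' expfzDr // -[x ^ Posz m]/(x ^+ m) mulrA mulrAC.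
  have -> : altsgn n = (-1) ^+ m * altsgn n'.
    by rewrite /n' altsgnD mulrA -exprMn mulrNN mulr1 expr1n mul1r.
  have -> : x ^+ gpe n = x ^+ gpe n' * x ^+ pe m * z ^+ (3 * m) * X ^- (3 * m).
    rewrite -[x ^+ gpe n]/(x ^ (gpe n)%:Z) e1 !expfzDr //.
    rewrite /X exprMn invfM -!mulrA; congr (_ * (_ * _)).
    rewrite mulrA mulfV ?expf_neq0 // mul1r -invr_expz mulrC -exprz_exp //.
  rewrite /c; ring.
rewrite /f geo; congr (c * _); rewrite mulrDr mul1r; congr (_ + _).
rewrite mulr_sumr; apply: eq_bigr => i _; rewrite /wterm mulrCA -[RHS]mulrA; congr (_ * _).
rewrite expfzDr // -[x ^ (gpe n')%:Z]/(x ^+ gpe n') mulrCA; congr (_ * _).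
by rewrite /X exprMn invfM; congr (_ * _); rewrite -invr_expz mulrC -exprz_exp.
Qed.

(** In [rank_gf_lim] the terms for k split into the summands of the Appell sum for
    the indices k and -k; the constant parts add up to the pentagonal series. *)
Lemma rank_gf z x : nrm z = 1 -> z != 1 -> x != 0 -> nrm x < 1 ->
  psum (rc z) x * poch x x = (1 - z) * Ap z x.
Proof.
move=> z1 zn1 x0 x1; have z0 := unit_neq0 z1.
have [[_ d] hA] := Ap_zsum z0 x0 x1; have hP := Pgf_poch x1.
have cA : clim (fun K => (1 - z) * zpart (aterm z x) (K + 1)%N) ((1 - z) * Ap z x).
  by apply: climZ; exact: clim_addn.
have cT : clim (fun K => Tk z x K + (1 - z) * aterm z x (Negz K)) (psum (rc z) x * poch x x + (1 - z) * 0).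
  apply: climD; last exact: climZ.
  have := climM (rank_gf_lim z1 x1) (clim_cst (poch x x)); apply: clim_ext => K.
  by rewrite mulrAC hP mul1r.
rewrite mulr0 addr0 in cT; apply: (clim_uniq cT); apply: clim_ext cA => K.
have zz : 1 - z != 0 by rewrite subr_eq0 eq_sym.
have nz k (w : C) : nrm w = 1 -> 1 - w * x ^+ k.+1 != 0.
    move=> w1; apply: (@sub1_neq0 _ _ (nrm x ^+ k.+1)); last by rewrite exprn_ilt1 ?nrm_ge0 ?x1.
  by rewrite nrmM nrmX w1 mul1r.
rewrite addn1 /zpart big_ord_recr /= addrA mulrDr; congr (_ + _).
rewrite big_split /= addrAC -(big_ord_recr K (fun k : 'I_K.+1 => aterm z x k)) /=.
elim: K => [|K IH].
  have e0 : aterm z x (Posz 0) = 1 / (1 - z).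
    by rewrite /aterm (_ : altsgn 0 = 1) // (_ : x ^+ gpe 0 = 1) // expr0z !mulr1.
  by rewrite /Tk big_ord1 !big_ord0 !addr0 e0 div1r mulfV.
have eP : \sum_(i < K.+2) aterm z x (Posz i) = \sum_(i < K.+1) aterm z x (Posz i) + aterm z x (Posz K.+1).
  by rewrite big_ord_recr.
have eN : \sum_(i < K.+1) aterm z x (Negz i) = \sum_(i < K) aterm z x (Negz i) + aterm z x (Negz K).
  by rewrite big_ord_recr.
have eT : Tk z x K.+1 = Tk z x K + (-1) ^+ K * x ^+ pe K.+1 * Wy z (x ^+ K.+1).
  by rewrite /Tk big_ord_recr addrA.
rewrite eP eN eT addrACA mulrDr IH; congr (_ + _).
have n1 := nz K z z1; have n2 : 1 - x ^+ K.+1 / z != 0.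
  by rewrite mulrC; apply: nz; rewrite nrmV z1 invr1.
rewrite aterm_neg // /aterm /Wy /altsgn -[x ^ Posz K.+1]/(x ^+ K.+1) /gpe /absz -/(pe K.+1).
rewrite (exprD x (pe K.+1) K.+1) (exprS (-1) K).
move: (x ^+ K.+1) (x ^+ pe K.+1) ((-1) ^+ K) n1 n2 => y w s n1 n2.
have n3 : z - y != 0 by rewrite (_ : z - y = z * (1 - y / z)) ?mulf_neq0 //; field.
field; repeat (apply/andP; split => //).
Qed.

End Zsum.

(** * Residue theorem on an annulus for series of simple fractions *)
Section Residues.
Variable R : realType.
Local Notation C := R[i].
Implicit Types (x b : C) (f g : C -> C).

Lemma ring_sub1 x (r : R) : nrm x = r -> `|1 - r| <= nrm (1 - x).
Proof.
move=> <-; have h1 := nrm_subl 1 x; have h2 := nrm_subl x 1.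
rewrite nrm1 in h1 h2; rewrite nrmBC in h2; rewrite ler_norml; lra.
Qed.

(** Partial fractions reduce the two simple poles 1 and b to [jump]. *)
Lemma jump2 (r1 r2 : R) f (xi xo : C) b : 0 < r1 -> r1 < 1 -> 1 < r2 -> unif (ann r1 r2) (@glaur R) f ->
  nrm xi = r1 -> nrm xo = r2 -> b != 0 -> b != 1 -> nrm b != r1 -> nrm b != r2 ->
  clim (fun N => mean N (fun x => f x / (1 - x) / (1 - x / b)) xo - mean N (fun x => f x / (1 - x) / (1 - x / b)) xi)
    (- (f 1 / (1 - b^-1) + (if r1 < nrm b < r2 then f b / (1 - b) else 0))).
Proof.
move=> r10 r11 r21 uf hi ho b0 b1 bi bo; have r12 : r1 <= r2 by lra.
have b1' : 1 - b != 0 by rewrite subr_eq0 eq_sym.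
have j1 := jump r10 r12 uf hi ho (oner_neq0 C).
rewrite nrm1 r11 r21 in j1.
have {}j1 := j1 (negbT (gt_eqF r11)). 
have {}j1 := j1 (negbT (lt_eqF r21)).
have j2 := jump r10 r12 uf hi ho b0 bi bo.
set L := - _; have -> : L = (1 - b^-1)^-1 * - f 1 + (1 - b)^-1 * - (if r1 < nrm b < r2 then f b else 0).
  by rewrite /L; case: ifP => _; ring.
apply: clim_ext (climD (climZ (1 - b^-1)^-1 j1) (climZ (1 - b)^-1 j2)) => N.
have key x (r : R) : nrm x = r -> r != 1 -> nrm b != r ->
  mean N (fun x => f x / (1 - x) / (1 - x / b)) x = (1 - b^-1)^-1 * mean N (fun x => f x / (1 - x / 1)) x +
   (1 - b)^-1 * mean N (fun x => f x / (1 - x / b)) x.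
  move=> xr rn1 rb; rewrite -!meanZ -meanD; apply: mean_ext => y yx.
  have n1 : 1 - y != 0 by rewrite subr_eq0; apply: contra rn1 => /eqP e; rewrite -xr -yx -e nrm1.
  have n2 : b - y != 0 by rewrite subr_eq0; apply: contra rb => /eqP ->; rewrite yx xr.
  have b1'' : b - 1 != 0 by rewrite subr_eq0.
  by rewrite divr1; field; repeat (apply/andP; split => //).
rewrite (key _ _ hi) ?(key _ _ ho) //; [ring| |]; lra.
Qed.

(** Here [f x / (1 - x)] has a simple pole at 1, and [Phi] is a series of simple
    fractions with poles [bb t n], finitely many of them between the two
    circles.  If the means over both circles agree, the residues add up to 0:
    the finite partial sums obey [jump2], and the error tends to 0 because the
    series converges uniformly on the circles. *)
Lemma residue_sum (T : finType) (cc bb : T -> int -> C) (Phi : C -> C) f (xi xo : C) (r1 r2 : R) (eps : nat -> R) N0 (S : C) :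
  0 < r1 -> r1 < 1 -> 1 < r2 -> unif (ann r1 r2) (@glaur R) f -> nrm xi = r1 -> nrm xo = r2 ->
  (forall t n, [/\ bb t n != 0, bb t n != 1, nrm (bb t n) != r1 & nrm (bb t n) != r2]) ->
  null eps -> (forall x K, ann r1 r2 x -> (N0 <= K)%N ->
    nrm (Phi x - \sum_t zpart (fun n => cc t n / (1 - x / bb t n)) K) <= eps K) ->
  (forall N, mean N (fun x => f x / (1 - x) * Phi x) xo = mean N (fun x => f x / (1 - x) * Phi x) xi) ->
  (forall K, (N0 <= K)%N -> 
    \sum_t zpart (fun n => cc t n * (if r1 < nrm (bb t n) < r2 then f (bb t n) / (1 - bb t n) else 0)) K = S) ->
  f 1 * Phi 1 + S = 0.
Proof.
move=> r10 r11 r21 uf hi ho hb neps tail inv hS.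
have [M0 HM0] := unif_bdd (glaur_bdd r2 r10) uf; pose M := `|M0|.
have HM x : ann r1 r2 x -> nrm (f x) <= M by move=> /HM0 h; apply: le_trans h _; exact: ler_norm.
have M0' : 0 <= M by exact: normr_ge0.
pose Psi K x := \sum_t zpart (fun n => cc t n / (1 - x / bb t n)) K.
have eps0 K : (N0 <= K)%N -> 0 <= eps K.
  by move=> hK; apply: le_trans (tail 1 K _ hK); rewrite ?nrm_ge0 // /ann nrm1 !ltW.
have jmp K : (N0 <= K)%N -> clim (fun N => mean N (fun x => f x / (1 - x) * Psi K x) xo -
    mean N (fun x => f x / (1 - x) * Psi K x) xi) (- (f 1 * Psi K 1 + S)).
  move=> hK; rewrite -(hS K hK) /Psi.
  set L := - _.
  have -> : L = \sum_t \sum_(k < K) (cc t (Posz k) * - (f 1 / (1 - (bb t (Posz k))^-1) +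
     (if r1 < nrm (bb t (Posz k)) < r2 then f (bb t (Posz k)) / (1 - bb t (Posz k)) else 0)) +
     cc t (Negz k) * - (f 1 / (1 - (bb t (Negz k))^-1) +
     (if r1 < nrm (bb t (Negz k)) < r2 then f (bb t (Negz k)) / (1 - bb t (Negz k)) else 0))).
    rewrite /L mulr_sumr -big_split -sumrN; apply: eq_bigr => t _.
    rewrite /zpart mulr_sumr -big_split -sumrN; apply: eq_bigr => k _ /=.
    by rewrite !div1r; ring.
  have jb t n := let: And4 h1 h2 h3 h4 := hb t n in jump2 r10 r11 r21 uf hi ho h1 h2 h3 h4.
  apply: clim_ext (clim_sum _ (fun t => clim_sum _ (fun k : 'I_K => climD
    (climZ (cc t (Posz k)) (jb t (Posz k))) (climZ (cc t (Negz k)) (jb t (Negz k)))))) => N.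
  have key x : mean N (fun x => f x / (1 - x) * (\sum_t zpart (fun n => cc t n / (1 - x / bb t n)) K)) x =
    \sum_t \sum_(k < K) (cc t (Posz k) * mean N (fun x => f x / (1 - x) / (1 - x / bb t (Posz k))) x +
      cc t (Negz k) * mean N (fun x => f x / (1 - x) / (1 - x / bb t (Negz k))) x).
    under [RHS]eq_bigr => t _ do (under eq_bigr => k _ do rewrite -!meanZ -meanD; rewrite -mean_sum).
    rewrite -mean_sum; apply: mean_ext => y _; rewrite mulr_sumr; apply: eq_bigr => t _.
    by rewrite /zpart mulr_sumr; apply: eq_bigr => k _; ring.
  rewrite !key -sumrB; apply: eq_bigr => t _; rewrite -sumrB; apply: eq_bigr => k _; ring.
(* On the two circles |1 - x| is at least r2 - 1 and 1 - r1, respectively. *)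
pose D := M / (r2 - 1) + M / (1 - r1).
have D0 : 0 <= D by rewrite addr_ge0 // divr_ge0 // subr_ge0 ltW.
have bnd K : (N0 <= K)%N -> nrm (f 1 * Psi K 1 + S) <= D * eps K.
  move=> hK; rewrite -nrmN; apply: (clim_nrm_le (N := 0) _ (jmp K hK)) => N _.
  have key x (r : R) : nrm x = r -> ann r1 r2 x -> r != 1 ->
     nrm (mean N (fun x => f x / (1 - x) * Phi x) x - mean N (fun x => f x / (1 - x) * Psi K x) x) <= M / `|1 - r| * eps K.
    move=> xr ax rn1; rewrite -mulN1r -meanZ -meanD.
    have rp : 0 < `|1 - r| by rewrite normr_gt0 subr_eq0 eq_sym.
    apply: mean_bound => [y yx|]; last by rewrite mulr_ge0 ?divr_ge0 ?eps0 // ltW.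
    have -> : f y / (1 - y) * Phi y + -1 * (f y / (1 - y) * Psi K y) = f y / (1 - y) * (Phi y - Psi K y) by ring.
    have ay : ann r1 r2 y by rewrite /ann yx.
    have hy := ring_sub1 (etrans yx xr).
    rewrite !nrmM nrmV; apply: ler_pM; rewrite ?mulr_ge0 ?invr_ge0 ?nrm_ge0 //; last exact: tail.
    apply: ler_pM; rewrite ?invr_ge0 ?nrm_ge0 //; first exact: HM.
    by rewrite lef_pV2 ?posrE // (lt_le_trans rp).
  have ko := key _ _ ho _ _; have ki := key _ _ hi _ _.
  have {}ko : nrm (mean N (fun x => f x / (1 - x) * Phi x) xo - mean N (fun x => f x / (1 - x) * Psi K x) xo) <= M / (r2 - 1) * eps K.
    have -> : r2 - 1 = `|1 - r2| by rewrite ler0_norm; lra.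
    by apply: ko; rewrite /ann ?ho; lra.
  have {}ki : nrm (mean N (fun x => f x / (1 - x) * Phi x) xi - mean N (fun x => f x / (1 - x) * Psi K x) xi) <= M / (1 - r1) * eps K.
    have -> : 1 - r1 = `|1 - r1| by rewrite ger0_norm; lra.
    by apply: ki; rewrite /ann ?hi; lra.
  rewrite inv in ko; rewrite /D mulrDl [leRHS]addrC; apply: le_trans (lerD ki ko).
  rewrite -[nrm (_ - mean N _ xo)]nrmN; apply: le_trans _ (nrmD _ _); rewrite le_eqVlt; apply/orP; left; apply/eqP.
  by congr nrm; ring.
have c1 : clim (fun K => f 1 * Psi K 1 + S) (f 1 * Phi 1 + S).
  apply: climD (clim_cst S); apply: climZ.
  apply: (@clim_unaddn _ N0); apply: (clim_null (v := fun K => eps (K + N0)%N)).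
    by move=> e e0; have [N hN] := neps e e0; exists N => n hn; apply: hN; apply: leq_trans hn (leq_addr _ _).
  by move=> n; rewrite nrmBC; apply: tail; rewrite ?leq_addl // /ann nrm1 !ltW.
have c2 : clim (fun K => f 1 * Psi K 1 + S) 0.
  apply: (@clim_unaddn _ N0); apply: (clim_null (v := fun K => D * eps (K + N0)%N)).
    by apply: nullZ => // e e0; have [N hN] := neps e e0; exists N => n hn; apply: hN; apply: leq_trans hn (leq_addr _ _).
  by move=> n; rewrite subr0; apply: bnd; rewrite leq_addl.
exact: clim_uniq c1 c2.
Qed.

End Residues.

(** * The dissection formula *)
Lemma sp24 p : prime p -> (3 < p)%N -> (24 * sp p + 1 = p ^ 2)%N.
Proof.
move=> pp p3; have h2 : ~~ (2 %| p)%N by rewrite dvdn_prime2 //; apply/eqP; lia.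
have h3 : ~~ (3 %| p)%N by rewrite dvdn_prime2 //; apply/eqP; lia.
rewrite /sp; have : (24 %| p ^ 2 - 1)%N; last by move/divnK => e; lia.
have [k [l hk]] : exists k l : nat, (p = 12 * k + l /\ (l = 1 \/ l = 5 \/ l = 7 \/ l = 11))%N.
  by exists (p %/ 12)%N, (p %% 12)%N; lia.
case: hk => e hl; apply/dvdnP.
case: hl => [hl|[hl|[hl|hl]]]; rewrite {}hl in e; rewrite {}e.
- by exists (6 * k ^ 2 + k)%N; nia.
- by exists (6 * k ^ 2 + 5 * k + 1)%N; nia.
- by exists (6 * k ^ 2 + 7 * k + 2)%N; nia.
- by exists (6 * k ^ 2 + 11 * k + 5)%N; nia.
Qed.

Section Jt.
Variable R : realType.
Local Notation C := R[i].
Implicit Types (x z q u : C) (s : R).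

Lemma nrmXz x (n : int) : nrm (x ^ n) = nrm x ^ n.
Proof. by case: n => n; [exact: nrmX | rewrite /exprz nrmV nrmX]. Qed.

(** Radii are measured as integral powers of one number s, so that comparing them
    is linear arithmetic on exponents. *)
Lemma expz_lt s (a b : int) : 0 < s < 1 -> (s ^ a < s ^ b) = (b < a).
Proof.
case/andP=> s0 s1; have hlt (c d : int) : d < c -> s ^ c < s ^ d.
  move=> dc; have [n ->] : exists n, c = d + Posz n.+1 by exists (absz (c - d)).-1; lia.
  rewrite expfzDr ?gt_eqF // -[ltRHS]mulr1 ltr_pM2l ?exprz_gt0 // -[s ^ _]/(s ^+ n.+1).
  by rewrite exprn_ilt1 // ltW.
have [h|h|->] := ltgtP b a; first exact: hlt.
  by apply/negbTE; rewrite -leNgt ltW // hlt.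
by rewrite ltxx.
Qed.

Lemma expz_eq s (a b : int) : 0 < s < 1 -> (s ^ a == s ^ b) = (a == b).
Proof. by move=> hs; rewrite !eq_le !leNgt !expz_lt // andbC. Qed.

(** Jacobi's theta product without its factor (q;q). *)
Definition jt z q := poch z q * poch (q / z) q.

Lemma jt_rec z q : nrm q < 1 -> jt z q = (1 - z) * (poch (z * q) q * poch (q / z) q).
Proof. by move=> q1; rewrite /jt poch_rec // mulrA. Qed.

Lemma jt_shift z q : z != 0 -> q != 0 -> nrm q < 1 -> jt (q * z) q = - z^-1 * jt z q.
Proof.
move=> z0 q0 q1; rewrite /jt (_ : q / (q * z) = z^-1); last by field; apply/andP.
rewrite (poch_rec z^-1) // (poch_rec z) // (mulrC q z) (mulrC z^-1 q); field; exact: z0.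
Qed.

Lemma jt1 q : nrm q < 1 -> jt 1 q = 0.
Proof. by move=> q1; rewrite jt_rec // subrr mul0r. Qed.

(** The substitution n -> -n. *)
Lemma Ap_inv z x : z != 0 -> x != 0 -> nrm x < 1 -> Ap z^-1 x = - z * Ap z x.
Proof.
move=> z0 x0 x1; have [d h] := Ap_zsum (z := z^-1) (invr_neq0 z0) x0 x1.
have [_ h'] := Ap_zsum z0 x0 x1.
apply: (zsum_uniq (zsum_opp d h)); apply: zsum_ext (zsumZ (- z) h') => n.
rewrite /aterm altsgnN; have e : x ^+ gpe n = x ^+ gpe (- n) * x ^ n.
  rewrite -![x ^+ _]/(x ^ (Posz _)) -expfzDr //; congr (_ ^ _).
  by have := gpe2 n; have := gpe2 (- n); nia.
have xn0 : x ^ n != 0 by rewrite expfz_eq0 (negbTE x0) andbF.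
have -> : 1 - z^-1 * x ^ (- n) = - ((1 - z * x ^ n) / (z * x ^ n)).
  by rewrite -invr_expz; field; apply/andP.
by rewrite e invrN invf_div; ring.
Qed.

Section Dissection.
Variables (p : nat) (x0 w : C).
Hypotheses (pp : prime p) (p3 : (3 < p)%N) (x00 : x0 != 0) (x01 : nrm x0 < 1).
Hypothesis pw : p.-primitive_root w.
Let q := x0 ^+ p.
Let m1 := (3 * p).-1./2.
Let m := m1.+1.
Let qj (j : nat) := x0 * w ^+ j.
Definition dcoef j : C := (qj j) ^+ sp p / poch (qj j) (qj j).
(** The exponent of the numerator and the power of z are chosen so that the
    multiplier of [Hf] under z -> q z is inverse to that of [Phif]; the zeros at
    w and 1/w cancel the poles of [Phif] there, and the denominator supplies the
    pole at 1. *)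
Definition Hf z := z ^- m1 * (jt (z / w) q * jt (z * w) q) ^+ m / jt z q.

Let podd : odd p. Proof. by have := even_prime pp; case=> // e; move: p3; rewrite e. Qed.
Let m1E : (2 * m1 + 1 = 3 * p)%N. Proof. rewrite /m1; have := podd; lia. Qed.
Let p0 : (0 < p)%N. Proof. lia. Qed.
Let nw : nrm w = 1. Proof. exact: prim_nrm pw. Qed.
Let w0 : w != 0. Proof. exact: unit_neq0. Qed.
Let wp : w ^+ p = 1. Proof. exact: prim_expr_order. Qed.
Let q0 : q != 0. Proof. by rewrite expf_neq0. Qed.
Let q1 : nrm q < 1. Proof. by rewrite nrmX exprn_ilt1 ?nrm_ge0 -?lt0n // ltW. Qed.
Let qj0 j : qj j != 0. Proof. by rewrite mulf_neq0 ?expf_neq0. Qed.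
Let nqj j : nrm (qj j) = nrm x0. Proof. by rewrite nrmM nrmX nw expr1n mulr1. Qed.
Let qj1 j : nrm (qj j) < 1. Proof. by rewrite nqj. Qed.
Let qjp j : qj j ^+ p = q. Proof. by rewrite exprMn -exprM mulnC exprM wp expr1n mulr1. Qed.
Let poch_qj j : poch (qj j) (qj j) != 0.
Proof.
apply: poch_neq0 => // n; rewrite -exprS; apply/eqP => /(congr1 (fun x => nrm x)).
by rewrite nrmX nqj nrm1 => /eqP; rewrite pexpr_eq1 ?nrm_ge0 // lt_eqF.
Qed.

(** By [Wv_eval] the sum over j is a multiple of the sum of (x0 w^j)^(s - d) with
    24 (s - d) = p^2 - (2i+1)^2.  It vanishes unless p divides 2i + 1, and then
    w^(-i) = w^(i+1). *)
Lemma W_vanish i : (\sum_(j < p) dcoef j * Wv i.+1 (qj j)) * (w ^- i - w ^+ i.+1) = 0.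
Proof.
have [c [d [hd H]]] := Wv_eval R i.+1.
have -> : \sum_(j < p) dcoef j * Wv i.+1 (qj j) = c%:~R * (x0 ^+ sp p / x0 ^+ d) * \sum_(j < p) (w ^+ sp p / w ^+ d) ^+ j.
  rewrite mulr_sumr; apply: eq_bigr => j _; rewrite (Wv_eq (H _ (qj0 j) (qj1 j))) /dcoef.
  have -> : qj j ^+ sp p / poch (qj j) (qj j) * (c%:~R / qj j ^+ d * poch (qj j) (qj j)) = c%:~R * (qj j ^+ sp p / qj j ^+ d).
    by field; rewrite poch_qj expf_neq0.
  rewrite /qj !exprMn exprVn -!exprM [(j * sp p)%N]mulnC [(j * d)%N]mulnC.
  by field; rewrite !expf_neq0.
case: hd => [->|hd]; first by rewrite !mul0r.
have [hp|hp] := boolP (p %| 2 * i + 1)%N.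
  have e : w ^+ i.+1 = w ^- i.
    apply: (mulIf (expf_neq0 i w0)); rewrite mulVf ?expf_neq0 // -exprD.
    have /dvdnP [k ek] := hp; have -> : (i.+1 + i)%N = (p * k)%N by lia.
    by rewrite exprM wp expr1n.
  by rewrite e subrr mulr0.
rewrite geo_root ?mulr0 ?mul0r //.
  by rewrite exprMn exprVn -!exprM ![(_ * p)%N]mulnC !exprM wp !expr1n invr1 mulr1.
apply/eqP => /(congr1 (fun y => y * w ^+ d)); rewrite mulfVK ?expf_neq0 // mul1r => /eqP.
rewrite (eq_prim_root_expr pw) => /eqP hsd; move/negP: hp; apply.
have hs := sp24 pp p3.
have h1 : (24 * sp p + 1 = 24 * d + 1 %[mod p])%N by rewrite -modnDml -modnMmr hsd modnMmr modnDml.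
rewrite hs in h1.
have hd' : (24 * d + 1 = (2 * i + 1) ^ 2)%N.
  have e : (2 * (i.+1)%:Z - 1 = (2 * i + 1)%N%:Z)%R by clear; lia.
  by move: hd; rewrite e -mulnn; move: (2 * i + 1)%N => n; clear; lia.
rewrite hd' in h1; have : (p %| (2 * i + 1) ^ 2)%N by rewrite /dvdn -h1 -[X in (X == _)]/(p ^ 2 %% p)%N expnS modnMr.
by rewrite Euclid_dvdX // => /andP[].
Qed.

Lemma Hf_shift z : z != 0 -> Hf (q * z) = - (q ^- m1 * z ^- (3 * p)) * Hf z.
Proof.
move=> z0; rewrite /Hf -[q * z / w]mulrA -[q * z * w]mulrA !jt_shift ?mulf_neq0 ?invr_neq0 //.
have -> : - (z / w)^-1 * jt (z / w) q * (- (z * w)^-1 * jt (z * w) q) = (z ^+ 2)^-1 * (jt (z / w) q * jt (z * w) q).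
  by field; apply/andP.
rewrite (exprMn m (z ^- 2)) (exprMn m1 q) invfM -m1E exprD (exprM z 2 m1) expr1 exprVn (exprS (z ^+ 2) m1).
move: (jt (z / w) q * _) (jt z q) => A J.
have : z ^+ m1 != 0 by rewrite expf_neq0. 
have : (z ^+ 2) ^+ m1 != 0 by rewrite !expf_neq0. 
move: (z ^+ m1) ((z ^+ 2) ^+ m1) (A ^+ m) (q ^- m1) => a b c d b0 a0.
by rewrite mulNr invrN (invfM z^-1 J) invrK; move: (J^-1) => J'; field; repeat (apply/andP; split => //).
Qed.

Let T := ('I_p * bool)%type.
Let ut (t : T) := if t.2 then w else w^-1.
Let acoef (t : T) := dcoef t.1 * (if t.2 then w else -1).
Definition Phif z := \sum_(t : T) acoef t * Ap (z * ut t) (qj t.1).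

Let sumT (F : T -> C) : \sum_t F t = \sum_(j < p) (F (j, true) + F (j, false)).
Proof.
transitivity (\sum_(t : T) F (t.1, t.2)); first by apply: eq_bigr => -[].
rewrite -(pair_bigA _ (fun j b => F (j, b))) /=; apply: eq_bigr => j _.
by rewrite big_bool.
Qed.

Let nut t : nrm (ut t) = 1.
Proof. by rewrite /ut; case: ifP => _; rewrite ?nrmV nw ?invr1. Qed.
Let ut0 t : ut t != 0. Proof. by rewrite unit_neq0 ?nut. Qed.
Let utp t : ut t ^+ p = 1.
Proof. by rewrite /ut; case: ifP => _; rewrite ?exprVn wp ?invr1. Qed.

(** The shift by q is the p-th power of the shift by each x0 w^j, so [Ap_shift]
    applies with m = p; the correction terms are those of [W_vanish]. *)
Lemma Phif_shift z : z != 0 -> (forall t (n : int), z * ut t * qj t.1 ^ n != 1) ->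
  Phif (q * z) = - (q ^+ m1 * z ^+ (3 * p)) * Phif z.
Proof.
move=> z0 hz; have hpe : (pe p = p * m1)%N.
  by have := peE p; rewrite -muln2; have := m1E; nia.
rewrite /Phif mulr_sumr.
transitivity (\sum_t (- (q ^+ m1 * z ^+ (3 * p)) * (acoef t * Ap (z * ut t) (qj t.1)) +
   \sum_(i < 3 * p) (- (q ^+ m1 * z ^+ (3 * p)) * z ^- i.+1) * (acoef t * ut t ^- i.+1 * Wv i.+1 (qj t.1)))).
  apply: eq_bigr => t _; rewrite -{1}(qjp t.1) -mulrA [qj _ ^+ p * _]mulrC.
  rewrite (Ap_shift p (mulf_neq0 z0 (ut0 t)) (qj0 _) (qj1 _) (hz t)) hpe exprM qjp exprMn [ut t ^+ _]exprM [ut t ^+ 3]exprS.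
  have -> : (ut t * ut t ^+ 2) ^+ p = 1 by rewrite exprMn -exprM mulnC exprM utp expr1n mulr1.
  rewrite -signr_odd podd expr1 mulr1 mulrDr mulrDr; congr (_ + _); first by ring.
  rewrite !mulr_sumr; apply: eq_bigr => i _; rewrite exprMn invfM; ring.
rewrite big_split /= -[RHS]addr0; congr (_ + _); rewrite exchange_big /= big1 // => i _.
rewrite -mulr_sumr sumT /= (_ : \sum_(j < p) _ = 0) ?mulr0 //.
rewrite -[RHS](W_vanish i) mulr_suml; apply: eq_bigr => j _.
rewrite /acoef /ut /= exprVn invrK exprS; field; by rewrite w0 expf_neq0.
Qed.

(** By [Ap_inv] the two halves of [Phif] contribute equally at 1. *)
Lemma Phif1 : Phif 1 = 2 * w * \sum_(j < p) dcoef j * Ap w (qj j).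
Proof.
rewrite /Phif sumT mulr_sumr; apply: eq_bigr => j _.
by rewrite /acoef /ut /= !mul1r Ap_inv //; ring.
Qed.

(** The residues at the poles of [Phif] inside the fundamental annulus. *)
Definition dsum := \sum_(j < p) dcoef j * \sum_(k < p.-1) (-1) ^+ k.+1 * qj j ^+ pe k.+1 *
  (w * Hf (qj j ^+ k.+1 / w) - Hf (w * qj j ^+ k.+1)).

Let sg := Num.sqrt (nrm x0).
Let sg01 : 0 < sg < 1.
Proof.
rewrite sqrtr_gt0 nrm_gt0 x00 /=; have /sqrt_unit /andP[] // : 0 <= nrm x0 < 1.
by rewrite nrm_ge0.
Qed.
Let sg2 : nrm x0 = sg ^ (2 : int).
Proof. by rewrite -[RHS]/(sg ^+ 2) sqr_sqrtr ?nrm_ge0. Qed.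
(* The poles have absolute value |x0|^(-n).  The annulus from |x0|^(p - 1/2) to
   |x0|^(-1/2) has none of them on its boundary, contains those with
   -p < n <= 0, and its outer circle is carried to the inner one by
   multiplication with q. *)
Let r1 := sg ^ (2 * p%:Z - 1).
Let r2 := sg ^ (-1 : int).
Let bt (t : T) (n : int) : C := (ut t * qj t.1 ^ n)^-1.
Let ct (t : T) (n : int) : C := acoef t * (altsgn R n * qj t.1 ^+ gpe n).

Let nbt t n : nrm (bt t n) = sg ^ (- 2 * n).
Proof. by rewrite nrmV nrmM nrmXz nut mul1r nqj sg2 exprz_exp invr_expz mulNr. Qed.

Let bt_cond t n : [/\ bt t n != 0, bt t n != 1, nrm (bt t n) != r1 & nrm (bt t n) != r2].
Proof.
rewrite nbt /r1 /r2 !expz_eq //; split; [| |by apply/eqP; clear; lia|by apply/eqP; clear; lia].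
  by rewrite invr_neq0 // mulf_neq0 // expfz_eq0 negb_and qj0 orbT.
have [->|n0] := eqVneq n 0.
  rewrite /bt expr0z mulr1 invr_eq1 /ut; have w1 : w != 1.
    by rewrite -[w]expr1 -(expr0 w) (eq_prim_root_expr pw) !modn_small //; move: p3; clear; lia.
  by case: ifP => _ //; rewrite invr_eq1.
apply/eqP => /(congr1 (fun x => nrm x)); rewrite nbt nrm1 => /eqP.
rewrite -(expr0z sg) expz_eq // => /eqP; move/eqP: n0; clear; lia.
Qed.

Let r1_lt : r1 < 1. Proof. rewrite -(expr0z sg) expz_lt //; move: p3; clear; lia. Qed.
Let r2_gt : 1 < r2. Proof. by rewrite -(expr0z sg) expz_lt. Qed.
Let r1_gt : 0 < r1. Proof. by rewrite exprz_gt0 //; case/andP: sg01. Qed.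

(** The function [Hf] without its pole at 1, approximable on the whole annulus. *)
Definition Cf z := z ^- m1 * (jt (z / w) q * jt (z * w) q) ^+ m / (poch (z * q) q * poch (q / z) q).

Let nq : nrm q = sg ^ (2 * p%:Z).
Proof. by rewrite nrmX sg2 -[_ ^+ p]/(_ ^ p%:Z) exprz_exp. Qed.

Let unif_Cf : unif (ann r1 r2) (@glaur R) Cf.
Proof.
have gb := glaur_bdd r2 r1_gt.
have uid : unif (ann r1 r2) (@glaur R) id by apply: unif_gen; left.
have uinv : unif (ann r1 r2) (@glaur R) (fun x => x^-1) by apply: unif_gen; right.
have cst c : unif (ann r1 r2) (@glaur R) (fun _ => c) by exact: unif_cst.
have hq : forall x, ann r1 r2 x -> nrm q <= nrm q by [].
have hq01 := nrm_itv q1.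
have ujt c : unif (ann r1 r2) (@glaur R) (fun z => jt (z * c) q).
  apply: (unifM gb); apply: (unif_poch gb hq01) => //; first exact: unifM gb _ _ uid (cst c).
  by apply: unif_ext (unifM gb uinv (cst (q / c))) => x _; rewrite invfM; ring.
have sg1 : sg < 1 by case/andP: sg01.
have bnd1 x : ann r1 r2 x -> nrm (x * q) <= sg.
  case/andP => _ h; rewrite nrmM nq; apply: le_trans (ler_wpM2r _ h) _; first by rewrite exprz_ge0 // sqrtr_ge0.
  rewrite /r2 -expfzDr; last by case/andP: sg01 => /gt_eqF ->.
  by rewrite -[leRHS]expr1z leNgt expz_lt //; move: p3; clear; lia.
have bnd2 x : ann r1 r2 x -> nrm (q / x) <= sg.
  case/andP => h _; rewrite nrmM nrmV nq ler_pdivrMr; last exact: lt_le_trans h.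
  apply: le_trans (ler_wpM2l _ h); last by rewrite sqrtr_ge0.
  rewrite /r1 -{2}[sg]expr1z -expfzDr; last by case/andP: sg01 => /gt_eqF ->.
  by rewrite leNgt expz_lt //; move: p3; clear; lia.
apply: (unifM gb); first apply: (unifM gb).
- by apply: unif_ext (unifX gb m1 uinv) => x _; rewrite exprVn.
- by apply: unifX => //; apply: unifM.
apply: (unif_ext (f := fun z => (poch (z * q) q)^-1 * (poch (q / z) q)^-1)) => [x _|].
  by rewrite invfM.
apply: (unifM gb); apply: (unif_pochV gb hq01 hq sg1) => //; exact: unifM.
Qed.

Let Cf_Hf z : z != 1 -> Cf z / (1 - z) = Hf z.
Proof. by move=> z1; rewrite /Cf /Hf (jt_rec z) // -[LHS]mulrA -invfM [_ * (1 - z)]mulrC. Qed.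

Let inv_pt z : nrm z = r2 -> Hf (q * z) * Phif (q * z) = Hf z * Phif z.
Proof.
move=> zr; have z0 : z != 0 by rewrite -nrm_gt0 zr (lt_trans ltr01).
rewrite Hf_shift // Phif_shift // => [|t n].
  have a0 : z ^+ (3 * p) != 0 by rewrite expf_neq0.
  have b0 : q ^+ m1 != 0 by rewrite expf_neq0.
  by field; apply/andP.
apply/eqP => /(congr1 (fun x => nrm x)); rewrite !nrmM nrmXz nut zr nqj sg2 mulr1 nrm1 exprz_exp /r2.
rewrite -expfzDr; last by case/andP: sg01 => /gt_eqF ->.
by move/eqP; rewrite -(expr0z sg) expz_eq //; clear; lia.
Qed.

(** The residue theorem for [Hf] times [Phif]: the left side comes from the pole
    at 1, and the residues for n = 0 vanish with [Cf]. *)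
Lemma dissection : (jt w^-1 q * jt w q) ^+ m / poch q q ^+ 2 *
   (2 * w * \sum_(j < p) dcoef j * Ap w (qj j)) = - dsum.
Proof.
have tails t : exists NM : nat * R, 0 <= NM.2 /\ forall x K, ann r1 r2 x -> (NM.1 <= K)%N ->
   nrm (acoef t * Ap (x * ut t) (qj t.1) - zpart (fun n => ct t n / (1 - x / bt t n)) K) <= NM.2 * nrm x0 ^+ K.
  have [N [M [M0 H]]] := Ap_tail r2 r1_gt (qj0 t.1) (qj1 t.1).
  exists (N, nrm (acoef t) * M); split; first by rewrite mulr_ge0 ?nrm_ge0.
  move=> x K hx hK; have {}hx : ann r1 r2 (x * ut t) by rewrite /ann nrmM nut mulr1.
  have [_ [_ h]] := H _ hx; rewrite /= -(mulrA (nrm (acoef t))) -(nqj t.1).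
  have e n : ct t n / (1 - x / bt t n) = acoef t * aterm (x * ut t) (qj t.1) n.
    by rewrite /ct /bt /aterm invrK (mulrA x); move: (acoef t) => a; rewrite !mulrA.
  have -> : zpart (fun n => ct t n / (1 - x / bt t n)) K = acoef t * zpart (aterm (x * ut t) (qj t.1)) K.
    by rewrite /zpart mulr_sumr; apply: eq_bigr => k _; rewrite !e -mulrDr.
  by rewrite -mulrBr nrmM ler_wpM2l ?nrm_ge0 // h.
have [NM hNM] := choice tails.
pose N0 := (p + \sum_t (NM t).1)%N.
pose eps K := (\sum_t (NM t).2) * nrm x0 ^+ K.
have neps : null eps.
  by apply: nullZ; [apply: sumr_ge0 => t _; case: (hNM t) | apply/null_geo/nrm_itv].
have r2n : nrm (r2%:C : C) = r2 by rewrite nrm_real ger0_norm // ltW // (lt_trans ltr01).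
have r1n : nrm (q * r2%:C : C) = r1.
  rewrite nrmM r2n nq -expfzDr //; by case/andP: sg01 => /gt_eqF ->.
have tl x K : ann r1 r2 x -> (N0 <= K)%N ->
    nrm (Phif x - \sum_t zpart (fun n => ct t n / (1 - x / bt t n)) K) <= eps K.
  move=> hx hK; rewrite -sumrB /eps mulr_suml; apply: le_trans (nrm_sum _ _ _) _.
  apply: ler_sum => t _; apply: (hNM t).2 => //; apply: leq_trans hK.
  by rewrite /N0 (bigD1 t) //= addnCA leq_addr.
have inv N : mean N (fun x => Cf x / (1 - x) * Phif x) r2%:C = mean N (fun x => Cf x / (1 - x) * Phif x) (q * r2%:C).
  congr (_ * _); apply: eq_bigr => k _; set y := r2%:C * _ ^+ k.
  have ny : nrm y = r2 by rewrite nrmM root_nrm r2n mulr1.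
  rewrite -[q * _ * _]mulrA -/y !Cf_Hf ?inv_pt //.
    apply/eqP => /(congr1 (fun x => nrm x)); rewrite /y mulrA nrmM r1n root_nrm mulr1 nrm1 => e'.
    by move: r1_lt; rewrite e' ltxx.
  by apply/eqP => e; move: ny; rewrite e nrm1 => e'; move: r2_gt; rewrite -e' ltxx.
have hS K : (N0 <= K)%N -> \sum_t zpart (fun n => ct t n * (if r1 < nrm (bt t n) < r2
      then Cf (bt t n) / (1 - bt t n) else 0)) K = dsum.
  move=> hK; have pK : (p <= K)%N by apply: leq_trans hK; exact: leq_addr.
  have hz t : zpart (fun n => ct t n * (if r1 < nrm (bt t n) < r2
      then Cf (bt t n) / (1 - bt t n) else 0)) K = \sum_(k < p.-1) ct t (Negz k) * Hf (bt t (Negz k)).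
    rewrite /zpart big_split /= big1 ?add0r => [|k _].
      pose F k := ct t (Negz k) * (if r1 < nrm (bt t (Negz k)) < r2 then Cf (bt t (Negz k)) / (1 - bt t (Negz k)) else 0).
      rewrite -/(\sum_(k < K) F k) (sum_ord_split (m := p.-1) F); last by move: pK; clear; lia.
      rewrite [X in _ + X]big1 ?addr0 => [|k _].
        apply: eq_bigr => k _; rewrite /F; case: (bt_cond t (Negz k)) => _ h1 _ _; rewrite Cf_Hf //.
        rewrite nbt /r1 /r2 !expz_lt //; case: ifP => // /negbT.
        by have := ltn_ord k; clear; lia.
      rewrite /F nbt /r1 /r2 !expz_lt //; case: ifP; last by rewrite mulr0.
      by have := ltn_ord k; clear; lia.
    case: (nat_of_ord k) => [|k']; last first.
      by rewrite nbt /r1 /r2 !expz_lt //; case: ifP; rewrite ?mulr0 //; clear; lia.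
    case: ifP => _; rewrite ?mulr0 // /Cf /bt expr0z mulr1.
    rewrite (_ : jt _ q * jt _ q = 0) ?expr0n /= ?mulr0 ?mul0r ?mulr0 //.
    rewrite /ut; case: ifP => _; first by rewrite mulVf // jt1 // mulr0.
    by rewrite invrK divff // jt1 // mul0r.
  under eq_bigr => t _ do rewrite hz.
  rewrite sumT; apply: eq_bigr => j _; rewrite -big_split mulr_sumr; apply: eq_bigr => k _ /=.
  have qk0 : qj j ^+ k.+1 != 0 by rewrite expf_neq0.
  rewrite /ct /bt /ut /acoef /= -[qj j ^ Negz k]/((qj j ^+ k.+1)^-1) !invfM !invrK.
  rewrite -[altsgn R (Negz k)]/((-1) ^+ k.+1).
  by rewrite [w^-1 * _]mulrC; move: (Hf _) (Hf _) (qj j ^+ (_ + _)) => h1 h2 h3; ring.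
have := residue_sum r1_gt r1_lt r2_gt unif_Cf r1n r2n bt_cond neps tl inv hS.
move/eqP; rewrite addr_eq0 Phif1 => /eqP <-; congr (_ * _).
by rewrite /Cf expr1n invr1 div1r !mul1r mulr1 expr2.
Qed.

End Dissection.
End Jt.

(** * Local holomorphy, the maximum principle and elliptic functions *)
Section LocalSeries.
Variable R : realType.
Local Notation C := R[i].
Implicit Types (x z w u h : C) (f g : C -> C).

Lemma unif_sub (T : Type) (S S' : T -> Prop) gen (f : T -> C) : (forall t, S' t -> S t) -> unif S gen f -> unif S' gen f.
Proof. by move=> h uf e /uf [g [ag hg]]; exists g; split=> // x /h; exact: hg. Qed.

(** Continuity at the centre is inherited from an approximating polynomial. *)
Lemma disc_cont r f : 0 < r -> unif (disc r) (@gid R) f ->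
  forall e : R, 0 < e -> exists d : R, [/\ 0 < d, d <= r & forall h, nrm h <= d -> nrm (f h - f 0) <= e].
Proof.
move=> r0 uf e e0; have e3 : 0 < e / 3 by lra.
have [g [ag hg]] := uf _ e3; have [p hp] := alg_poly ag.
have [|q hq] := factor_theorem (p - (p.[0])%:P) 0 _; first by rewrite rootE !hornerE subrr.
have {}hq x : p.[x] = p.[0] + x * q.[x].
  have := congr1 (horner^~ x) hq; rewrite !hornerE => /eqP; rewrite subr_eq => /eqP ->.
  by rewrite subr0 addrC mulrC.
have [M [M0 HM]] : exists M : R, 0 < M /\ forall x, disc r x -> nrm q.[x] <= M.
  apply: bdd_gt0; apply: (alg_bdd (gen := @gid R)); first exact: gid_bdd.
  elim/poly_ind: q {hq} => [|q c IH]; first by rewrite (_ : horner 0 = fun=> 0); [exact: alg_cst|apply/funext => x; rewrite horner0].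
  rewrite (_ : horner _ = fun x => q.[x] * x + c); last by apply/funext => x; rewrite !hornerE.
  by apply: alg_add; [apply: alg_mul => //; exact: alg_gen | exact: alg_cst].
exists (Num.min r (e / 3 / M)); split; first by rewrite lt_min r0 divr_gt0.
  by rewrite ge_min lexx.
move=> h; rewrite le_min => /andP[hr hd].
have -> : f h - f 0 = (f h - g h) - (f 0 - g 0) + h * q.[h] by rewrite !hp (hq h); ring.
apply: le_trans (nrmD _ _) _; have k1 := hg h hr; have k2 := hg 0 _.
have {}k2 : nrm (f 0 - g 0) <= e / 3 by apply: k2; rewrite /disc nrm0 ltW.
have k3 := nrmB (f h - g h) (f 0 - g 0).
have k4 : nrm (h * q.[h]) <= e / 3.
  rewrite nrmM; apply: le_trans (ler_pM (nrm_ge0 _) (nrm_ge0 _) hd (HM _ hr)) _.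
  by rewrite divfK // gt_eqF.
lra.
Qed.

(** Holomorphy near u. *)
Definition locU f u := exists r : R, 0 < r /\ unif (disc r) (@gid R) (fun h => f (u + h)).

Lemma locU_cont f u : locU f u -> forall e : R, 0 < e ->
  exists d : R, 0 < d /\ forall h, nrm h <= d -> nrm (f (u + h) - f u) <= e.
Proof.
case=> r [r0 uf] e e0; have [d [d0 _ hd]] := disc_cont r0 uf e0.
by exists d; split=> // h /hd; rewrite addr0.
Qed.

Lemma locU_M f g u : locU f u -> locU g u -> locU (fun x => f x * g x) u.
Proof.
case=> r [r0 uf] [s [s0 ug]]; exists (Num.min r s); split; first by rewrite lt_min r0.
apply: unifM; first exact: gid_bdd.
  by apply: unif_sub uf => x; rewrite /disc le_min => /andP[].
by apply: unif_sub ug => x; rewrite /disc le_min => /andP[].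
Qed.

(** Near u, 1/f is 1/f(u) times a geometric series in 1 - f/f(u). *)
Lemma locU_inv f u : f u != 0 -> locU f u -> locU (fun x => (f x)^-1) u.
Proof.
move=> fu [r [r0 uf]]; have c0 : 0 < nrm (f u) / 2 by rewrite divr_gt0 ?nrm_gt0.
have [d [d0 dr hd]] := disc_cont r0 uf c0; rewrite addr0 in hd.
exists d; split=> //; have ud : unif (disc d) (@gid R) (fun h => f (u + h)).
  by apply: unif_sub uf => x /le_trans; apply.
have gb := @gid_bdd R d.
apply: (unif_ext (f := fun h => (f u)^-1 * (1 - (1 - f (u + h) / f u))^-1)) => [h hh|].
  have e : 1 - (1 - f (u + h) / f u) = f (u + h) / f u by ring.
  by rewrite e invf_div mulKf.
apply: (unifM gb); first exact: unif_cst.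
apply: (unif_inv1 gb (th := 1 / 2)); first by lra.
  move=> h hh; have -> : 1 - f (u + h) / f u = - (f (u + h) - f u) / f u by field.
  rewrite mulNr nrmN nrmM nrmV ler_pdivrMr ?nrm_gt0 //; apply: le_trans (hd h hh) _; lra.
apply: (unifB gb); first exact: unif_cst.
by apply: (unifM gb) => //; exact: unif_cst.
Qed.

Lemma nrm_sub1_sq w : nrm (w - 1) ^+ 2 = nrm w ^+ 2 + 1 - 2 * complex.Re w.
Proof.
case: w => a b; rewrite /= !sqr_sqrtr ?addr_ge0 ?sqr_ge0 //; ring.
Qed.

Lemma Re_sum (I : Type) (s : seq I) (F : I -> C) :
  complex.Re (\sum_(i <- s) F i) = \sum_(i <- s) complex.Re (F i).
Proof. by elim/big_rec2: _ => // i x y _ <-; case: (F i) y => a b [c d]. Qed.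

(** Normalize g(0) = 1.  The mean of |g - 1|^2 over a circle is the mean of
    |g|^2 + 1 - 2 Re g, hence at most 2 - 2 Re g(0) = 0.  So all coefficients of
    g - 1 vanish.  The proof runs this argument for approximating polynomials,
    with errors, and therefore obtains an arbitrarily small bound. *)
Lemma max_disc r g : 0 < r -> unif (disc r) (@gid R) g ->
  (forall x, disc r x -> nrm (g x) <= nrm (g 0)) -> forall x, nrm x <= r / 2 -> g x = g 0.
Proof.
move=> r0 ug gmax x xr; have r2 : r / 2 <= r by lra.
have [g00|gn0] := eqVneq (g 0) 0.
  apply/eqP; rewrite g00 -nrm_eq0 eq_le nrm_ge0 andbT -(nrm0 R) -g00.
  by apply: gmax; exact: le_trans xr r2.
pose f y := g y / g 0.
suff H : f x = 1 by rewrite -[LHS](divfK gn0) -/(f x) H mul1r.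
have uf : unif (disc r) (@gid R) f.
  by apply: unifM => //; [exact: gid_bdd | exact: unif_cst].
have f0 : f 0 = 1 by rewrite /f divff.
have fmax y : disc r y -> nrm (f y) <= 1.
  by move=> /gmax h; rewrite /f nrmM nrmV ler_pdivrMr ?nrm_gt0 // mul1r.
suff small : forall d : R, 0 < d < 1 -> nrm (f x - 1) <= 3 * d.
  apply/eqP; rewrite -subr_eq0 -nrm_eq0 eq_le nrm_ge0 andbT leNgt; apply/negP => h.
  pose d := Num.min (nrm (f x - 1) / 4) (1 / 2).
  have hd : 0 < d < 1 by rewrite /d lt_min gt_min; apply/andP; split; [apply/andP; split; lra | apply/orP; right; lra].
  have := small d hd; have : d <= nrm (f x - 1) / 4 by rewrite /d ge_min lexx.
  lra.
(* An error e in f costs at most (1 + e)^2 + 1 - 2 (1 - e) <= 5 e in the mean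
   square, which is therefore at most d^2. *)
move=> d /andP[d0 d1]; pose e := d ^+ 2 / 5.
have e0 : 0 < e by rewrite divr_gt0 // exprn_gt0.
have ed : e <= d by rewrite /e; nra.
have [g' [ag hg]] := uf _ e0; have [p hp] := alg_poly ag.
have {}hg y : disc r y -> nrm (f y - p.[y]) <= e by rewrite -hp; exact: hg.
have d0r : disc r 0 by rewrite /disc nrm0 ltW.
have p0 : nrm (p.[0] - 1) <= e by rewrite nrmBC -f0 hg.
have coef n : nrm ((p - 1%:P)`_n) * r ^+ n <= d.
  pose N := (size p + n.+1)%N; have N0 : (0 < N)%N by rewrite /N addnS.
  have pw := ee_prim R N0; set w := ee _ in pw.
  have nN : (n < N)%N by rewrite /N addnS ltnS leq_addl.
  have sN : (size (p - 1%:P)%R <= N)%N.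
    apply: leq_trans (size_polyD _ _) _; rewrite size_polyN geq_max leq_addr.
    exact: leq_trans (size_polyC_leq1 _) N0.
  have Np : 0 < N%:R :> R by rewrite ltr0n.
  have yr k : nrm (r%:C * w ^+ k) = r by rewrite nrmM nrmX (prim_nrm pw) expr1n mulr1 nrm_real gtr0_norm.
  have sq : \sum_(k < N) nrm (p.[r%:C * w ^+ k] - 1) ^+ 2 <= N%:R * d ^+ 2.
    have m0 : \sum_(k < N) p.[r%:C * w ^+ k] = N%:R * p.[0].
      rewrite horner_coef0 -[p`_0]mulr1 -(expr0 r%:C) -(coef_mean r%:C pw (leq_addr _ _) N0).
      by apply: eq_bigr => k _; rewrite muln0 expr0 divr1.
    have hre : \sum_(k < N) complex.Re p.[r%:C * w ^+ k] = N%:R * complex.Re p.[0].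
      rewrite -Re_sum m0 (rt_natE R); case: (p.[0]) => a b /=; ring.
    apply: le_trans (_ : \sum_(k < N) ((1 + e) ^+ 2 + 1 - 2 * complex.Re p.[r%:C * w ^+ k]) <= _).
      apply: ler_sum => k _; rewrite nrm_sub1_sq lerD2r lerD2r lerXn2r ?nnegrE ?nrm_ge0 //; first by lra.
      have h1 := fmax (r%:C * w ^+ k); have h2 := hg (r%:C * w ^+ k).
      rewrite /disc yr lexx in h1 h2; have := nrm_subl p.[r%:C * w ^+ k] (f (r%:C * w ^+ k)).
      have := h1 isT; have := h2 isT; rewrite nrmBC; lra.
    rewrite sumrB -mulr_sumr hre sumr_const card_ord -mulr_natl.
    have h3 : 1 - e <= complex.Re p.[0].
      have := Re_le_nrm (p.[0] - 1); case: (p.[0]) p0 => a b h4 /= h5.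
      have := le_trans h5 h4; rewrite ler_norml => /andP[]; lra.
    have h4 : d ^+ 2 = 5 * e by rewrite /e; field.
    rewrite h4; rewrite -subr_ge0 (_ : _ - _ = N%:R * (5 * e - ((1 + e) ^+ 2 + 1 - 2 * complex.Re p.[0]))); last by ring.
    apply: mulr_ge0; first exact: ltW.
    have : e <= 1 by lra.
    nra.
  have : nrm (N%:R * ((p - 1%:P)`_n * r%:C ^+ n)) <= N%:R * d.
    rewrite -(coef_mean r%:C pw sN nN); apply: le_trans (nrm_sum _ _ _) _.
    apply: le_trans (_ : \sum_(k < N) ((d + d^-1 * nrm (p.[r%:C * w ^+ k] - 1) ^+ 2) / 2) <= _).
      apply: ler_sum => k _; rewrite nrmM nrmV nrmX (prim_nrm pw) expr1n invr1 mulr1 hornerD hornerN hornerC.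
      move: (nrm _) => v; have : 0 <= d^-1 * (v - d) ^+ 2 by rewrite mulr_ge0 ?invr_ge0 ?sqr_ge0 // ltW.
      have -> : d^-1 * (v - d) ^+ 2 = 2 * ((d + d^-1 * v ^+ 2) / 2 - v) by field; rewrite gt_eqF.
      by rewrite pmulr_rge0 // subr_ge0.
    rewrite -mulr_suml big_split /= -mulr_sumr sumr_const card_ord -[d *+ N]mulr_natl.
    have : d^-1 * \sum_(k < N) nrm (p.[r%:C * w ^+ k] - 1) ^+ 2 <= d^-1 * (N%:R * d ^+ 2).
      by rewrite ler_wpM2l // invr_ge0 ltW.
    have -> : d^-1 * (N%:R * d ^+ 2) = N%:R * d by field; rewrite gt_eqF.
    lra.
  by rewrite nrmM nrm_nat ler_pM2l // nrmM nrmX nrm_real gtr0_norm.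
have xp : nrm (p.[x] - 1) <= 2 * d.
  have -> : p.[x] - 1 = (p - 1%:P).[x] by rewrite !hornerE.
  rewrite horner_coef; apply: le_trans (nrm_sum _ _ _) _.
  apply: le_trans (_ : \sum_(i < size (p - 1%:P)%R) d * (1 / 2) ^+ i <= _).
    apply: ler_sum => i _; rewrite nrmM nrmX.
    apply: le_trans (ler_wpM2l (nrm_ge0 _) (_ : nrm x ^+ i <= (r * (1 / 2)) ^+ i)) _.
      by rewrite lerXn2r ?nnegrE ?nrm_ge0 //; lra.
    by rewrite exprMn mulrA ler_wpM2r ?exprn_ge0 //; lra.
  rewrite -mulr_sumr mulrC ler_pM2r //.
  apply: le_trans (geo_sum_le0 _ _) _; first by apply/andP; split; lra.
  by rewrite (_ : 1 - 1 / 2 = 2^-1) ?invrK //; field.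
have h1 : nrm (f x - p.[x]) <= e by apply: hg; exact: le_trans xr r2.
have := nrmD (f x - p.[x]) (p.[x] - 1); rewrite addrA subrK; lra.
Qed.

Lemma locU_max f u : locU f u -> (forall v, nrm (f v) <= nrm (f u)) ->
  exists d : R, 0 < d /\ forall h, nrm h <= d -> f (u + h) = f u.
Proof.
case=> r [r0 uf] fm; exists (r / 2); split; first by lra.
move=> h hr; rewrite (max_disc r0 uf _ hr) ?addr0 // => x _; exact: fm.
Qed.

Lemma open_set1 (A : set R) : (forall t, A t -> exists e : R, 0 < e /\ forall s, `|s - t| <= e -> A s) -> open A.
Proof.
move=> hA; rewrite openE => t /hA [e [e0 he]]; apply/nbhs_ballP; exists e => //=.
by move=> s; rewrite /ball /= distrC => /ltW; exact: he.
Qed.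

(** On the line through u and v, the set where f takes the value f(u) is closed by
    continuity and open by [locU_max]. *)
Lemma locU_const f u : (forall v, locU f v) -> (forall v, nrm (f v) <= nrm (f u)) -> forall v, f v = f u.
Proof.
move=> lf fm v; pose A := [set t : R | f (u + t%:C * (v - u)) = f u].
have nd (t s : R) : u + s%:C * (v - u) = u + t%:C * (v - u) + (s - t)%:C * (v - u).
  by rewrite rmorphB /=; ring.
have small (d : R) : 0 < d -> exists e : R, 0 < e /\ forall s t : R, `|s - t| <= e -> nrm ((s - t)%:C * (v - u)) <= d.
  move=> d0; have n0 := nrm_ge0 (v - u); have n1 : 0 < nrm (v - u) + 1 by lra.
  exists (d / (nrm (v - u) + 1)); split; first by rewrite divr_gt0.
  move=> s t hst; rewrite nrmM nrm_real; apply: le_trans (ler_wpM2r n0 hst) _.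
  by rewrite mulrAC ler_pdivrMr // ler_wpM2l //; lra.
have opA : open A.
  apply: open_set1 => t At; rewrite /A /= in At.
  have [|d [d0 hd]] := locU_max (lf (u + t%:C * (v - u))); first by move=> x; rewrite At.
  have [e [e0 he]] := small d d0; exists e; split=> // s hs.
  by rewrite /A /= (nd t) hd // he.
have clA : closed A.
  rewrite -[A]setCK closedC; apply: open_set1 => t At.
  have h0 : 0 < nrm (f (u + t%:C * (v - u)) - f u) / 2.
    by rewrite divr_gt0 // nrm_gt0 subr_eq0; apply/eqP.
  have [d [d0 hd]] := locU_cont (lf (u + t%:C * (v - u))) h0.
  have [e [e0 he]] := small d d0; exists e; split=> // s hs As; rewrite /A /= (nd t) in As.
  have := hd _ (he _ _ hs); rewrite As nrmBC; lra.
have : A = setT.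
  have /connected_intervalP ci : is_interval (@setT R) by move=> x y _ _ z _.
  apply: ci; first by exists 0; rewrite /A /= (_ : 0%:C = 0) // mul0r addr0.
    by exists A => //; rewrite setTI.
  by exists A => //; rewrite setTI.
move=> /(congr1 (fun B => B 1)); rewrite /A /= => e1.
have : f (u + 1%:C * (v - u)) = f u by rewrite e1.
by rewrite (_ : 1%:C = 1) // mul1r addrC subrK.
Qed.

Lemma periodic_int f z (m n : int) u : (forall v, f (v + 1) = f v) -> (forall v, f (v + z) = f v) ->
  f (u + m%:~R + n%:~R * z) = f u.
Proof.
move=> p1 pz; have per w (k : int) v : (forall v, f (v + w) = f v) -> f (v + k%:~R * w) = f v.
  move=> pw; have pn j x : f (x + j%:R * w) = f x.
    elim: j => [|j IH]; first by rewrite mul0r addr0.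
    by rewrite -natr1 mulrDl mul1r addrA pw; exact: IH.
  case: k => k; first exact: pn.
  by rewrite -(pn k.+1 (v + _)); congr f; rewrite NegzE mulrNz; ring.
by rewrite per // -[m%:~R]mulr1 per.
Qed.

(** Liouville's theorem for elliptic functions: |f| attains its maximum on the
    compact period parallelogram, hence in the plane. *)
Lemma doubly_periodic_const f z : 0 < complex.Im z -> (forall v, locU f v) ->
  (forall v, f (v + 1) = f v) -> (forall v, f (v + z) = f v) -> forall u v, f u = f v.
Proof.
move=> z0 lf p1 pz.
(* Floors of the coordinates with respect to 1 and z move u into the
   parallelogram. *)
have red u : exists (x y : R) (m n : int), [/\ 0 <= x <= 1, 0 <= y <= 1 & u = y%:C + x%:C * z + m%:~R + n%:~R * z].
  case: u => a b; case: z z0 pz => c d /= d0 _.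
  pose n := Num.floor (b / d); pose x := b / d - n%:~R; pose y' := a - x * c - n%:~R * c; pose m := Num.floor y'.
  exists x, (y' - m%:~R), m, n; split.
  - by have /andP[h1 h2] := floor_itv (b / d); rewrite /x -/n in h1 h2 *; rewrite intrD in h2; apply/andP; split; lra.
  - by have /andP[h1 h2] := floor_itv y'; rewrite -/m in h1 h2 *; rewrite intrD in h2; apply/andP; split; lra.
  have ic (k : int) : k%:~R = (k%:~R : R)%:C :> C by rewrite rmorph_int.
  rewrite !ic.
  by rewrite /real_complex_def; apply/eqP; rewrite eq_complex /=; apply/andP; split; apply/eqP; rewrite /y' /x; field; rewrite gt_eqF.
pose F (xy : R * R) : R := nrm (f (xy.2%:C + xy.1%:C * z)).
have cF : continuous F.
  move=> [x y]; apply/cvgrPdist_le => e e0.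
  have [d [d0 hd]] := locU_cont (lf (y%:C + x%:C * z)) e0.
  have n1 : 0 < nrm z + 1 by rewrite ltr_wpDl ?nrm_ge0.
  have d2 : 0 < d / 2 by lra.
  have d3 : 0 < d / 2 / (nrm z + 1) by rewrite divr_gt0.
  exists (ball x (d / 2 / (nrm z + 1)), ball y (d / 2)).
    by split; apply/nbhs_ballP; [exists (d / 2 / (nrm z + 1)) | exists (d / 2)].
  move=> [x' y'] [/= hx hy]; rewrite /ball /= distrC in hx; rewrite /ball /= distrC in hy.
  have := hd ((y' - y)%:C + (x' - x)%:C * z) _.
  rewrite /F /= (_ : y%:C + x%:C * z + ((y' - y)%:C + (x' - x)%:C * z) = y'%:C + x'%:C * z); last by rewrite !rmorphB /=; ring.
  move=> H; apply: le_trans (H _).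
    rewrite ler_norml; have := nrm_subl (f (y'%:C + x'%:C * z)) (f (y%:C + x%:C * z)).
    have := nrm_subl (f (y%:C + x%:C * z)) (f (y'%:C + x'%:C * z)); rewrite [nrm (_ - f (y'%:C + _))]nrmBC; lra.
  apply: le_trans (nrmD _ _) _; rewrite nrmM !nrm_real.
  have : `|x' - x| * nrm z <= d / 2.
    apply: le_trans (ler_wpM2r (nrm_ge0 _) (ltW hx)) _.
    by rewrite mulrAC ler_pdivrMr // ler_wpM2l ?(ltW d2) //; lra.
  lra.
have cpt : compact (`[0, 1]%classic `*` `[0, 1]%classic : set (R * R)).
  by apply: compact_setX; exact: segment_compact.
have [] := compact_EVT_max _ cpt (continuous_subspaceT cF).
  by exists (0, 0); split => /=; rewrite in_itv /= lexx ler01.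
move=> [x0 y0] _ hmax; pose u0 := y0%:C + x0%:C * z.
have fm v : nrm (f v) <= nrm (f u0).
  have [x [y [m [n [hx hy ->]]]]] := red v; rewrite periodic_int //.
  by apply: (hmax (x, y)); rewrite inE; split; rewrite /= in_itv /=.
by move=> u v; rewrite (locU_const lf fm u) (locU_const lf fm v).
Qed.

End LocalSeries.

(** * The exponential and its difference quotient as uniform limits *)
Section UnifExp.
Variables (R : realType) (T : Type).
Local Notation C := R[i].
Variables (S : T -> Prop) (gen : (T -> C) -> Prop).
Hypothesis gen_bdd : forall f, gen f -> bddS S f.
Local Notation U := (unif S gen).

Lemma pow_diff (a b : C) (K : R) n : 1 <= K -> nrm a <= K -> nrm b <= K ->
  nrm (a ^+ n - b ^+ n) <= n%:R * nrm (a - b) * K ^+ n.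
Proof.
move=> K1 aK bK; elim: n => [|n IH]; first by rewrite !expr0 subrr nrm0 !mul0r.
have -> : a ^+ n.+1 - b ^+ n.+1 = a * (a ^+ n - b ^+ n) + (a - b) * b ^+ n by rewrite !exprS; ring.
apply: le_trans (nrmD _ _) _; rewrite !nrmM nrmX.
have k0 : 0 <= K by lra.
have h1 : nrm a * nrm (a ^+ n - b ^+ n) <= K * (n%:R * nrm (a - b) * K ^+ n).
  by apply: ler_pM; rewrite ?nrm_ge0.
have h2 : nrm (a - b) * nrm b ^+ n <= nrm (a - b) * K ^+ n.+1.
  rewrite ler_wpM2l ?nrm_ge0 //; apply: le_trans (_ : K ^+ n <= _); first by rewrite lerXn2r ?nnegrE ?nrm_ge0.
  by rewrite exprS ler_peMl ?exprn_ge0.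
apply: le_trans (lerD h1 h2) _; rewrite le_eqVlt; apply/orP; left; apply/eqP.
by rewrite exprS -natr1; ring.
Qed.

(** The functions (1 + 2 pi i g / n)^n approximate e(g) uniformly, because g is
    bounded. *)
Lemma unif_ee g : U g -> U (fun x => ee (g x)).
Proof.
move=> ug; have [M [M0 HM]] := bdd_gt0 (unif_bdd gen_bdd ug).
pose c : C := 2 * (pi : R)%:C * 'i%C.
pose L := nrm c * M + 1.
have c0 := nrm_ge0 c.
have L1 : 1 <= L by rewrite /L lerDr mulr_ge0 // ltW.
apply: unif_lim => e e0.
pose K := 8 * L ^+ 2 * expR L / e.
have K0 : 0 <= K by rewrite divr_ge0 ?mulr_ge0 ?exprn_ge0 ?expR_ge0 //; lra.
pose n := (Num.bound K + Num.bound (2 * L)).+1.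
have n0 : 0 < n%:R :> R by rewrite ltr0n.
have nz : n%:R != 0 :> C by rewrite pnatr_eq0.
have bnd (y : R) (m k : nat) : 0 <= y -> (Num.bound y <= k)%N -> y <= k%:R.
  move=> y0 h; apply: le_trans (_ : (Num.bound y)%:R <= _); last by rewrite ler_nat.
  by apply: le_trans (ler_norm y) (ltW (archi_boundP (normr_ge0 y))) || (apply/ltW/archi_boundP).
have nK : K <= n%:R by apply: bnd => //; rewrite /n; apply: leqW; exact: leq_addr.
have nL : 2 * L <= n%:R by apply: bnd => //; [lra | rewrite /n; apply: leqW; exact: leq_addl].
exists (fun x => (1 + c * g x / n%:R) ^+ n); split.
  apply: unifX => //; apply: unifD => //; first exact: unif_cst.
  by apply: unifM => //; [apply: unifM => //; exact: unif_cst | exact: unif_cst].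
move=> x Sx; have hg := HM x Sx; pose w := c * g x / n%:R.
have hw : nrm w <= L / n%:R.
  rewrite /w nrmM nrmV nrm_nat ler_wpM2r ?invr_ge0 ?(ltW n0) // nrmM.
  have := ler_wpM2l c0 hg; rewrite /L; lra.
have hw2 : nrm w <= 1 / 2.
  by apply: le_trans hw _; rewrite ler_pdivrMr //; lra.
have -> : ee (g x) = cexp w ^+ n.
  have -> : cexp w = ee (g x / n%:R) by rewrite /ee /w mulrA.
  by rewrite eeX mulrC divfK.
have Ln0 : 0 <= L / n%:R by rewrite divr_ge0 ?(ltW n0) //; lra.
have a1 : nrm (cexp w) <= expR (L / n%:R).
  by rewrite nrm_cexp ler_expR; apply: le_trans (ler_norm _) _; apply: le_trans (Re_le_nrm w) hw.
have a2 : nrm (1 + w) <= expR (L / n%:R).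
  apply: le_trans (nrmD _ _) _; rewrite nrm1; apply: le_trans (expR_ge1Dx _); lra.
have a3 : 1 <= expR (L / n%:R) by have := expR_ge1Dx (L / n%:R); lra.
apply: le_trans (pow_diff n a3 a1 a2) _.
have -> : expR (L / n%:R) ^+ n = expR L.
  by rewrite -expRM_natl; congr expR; rewrite mulrC divfK // gt_eqF.
have h1 : nrm (cexp w - (1 + w)) <= 8 * (L / n%:R) ^+ 2.
  rewrite opprD addrA; apply: le_trans (cexp_sub1 hw2) _.
  by rewrite ler_wpM2l // lerXn2r ?nnegrE ?nrm_ge0.
apply: le_trans (_ : n%:R * (8 * (L / n%:R) ^+ 2) * expR L <= _).
  by rewrite ler_wpM2r ?expR_ge0 // ler_wpM2l // ltW.
have -> : n%:R * (8 * (L / n%:R) ^+ 2) * expR L = 8 * L ^+ 2 * expR L / n%:R by field; rewrite gt_eqF.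
by rewrite ler_pdivrMr // [e * _]mulrC -ler_pdivrMr.
Qed.

(** The entire function (e(u) - 1) / u. *)
Definition Vf (u : C) : C := if u == 0 then 2 * (pi : R)%:C * 'i%C else (ee u - 1) / u.

Lemma Vf_half u : Vf u = (1 + ee (u / 2)) / 2 * Vf (u / 2).
Proof.
rewrite /Vf mulf_eq0 invr_eq0 pnatr_eq0 orbF; have [->|u0] := eqVneq u 0; last first.
  have -> : ee u = ee (u / 2) * ee (u / 2) by rewrite -eeD; congr ee; field.
  by field; rewrite u0.
by rewrite mul0r ee0; field.
Qed.

Lemma Vf_iter K u : Vf u = (\prod_(k < K) ((1 + ee (u / 2 ^+ k.+1)) / 2)) * Vf (u / 2 ^+ K).
Proof.
elim: K => [|K IH]; first by rewrite big_ord0 mul1r divr1.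
have e : u / 2 ^+ K.+1 = u / 2 ^+ K / 2 by rewrite exprSr invfM mulrA.
by rewrite big_ord_recr /= e -mulrA IH (Vf_half (u / 2 ^+ K)).
Qed.

Lemma nrm_ee_le (u : C) : nrm (ee u) <= expR (2 * pi * nrm u).
Proof.
rewrite nrm_ee ler_expR; have := Im_le_nrm u; have p0 : 0 < 2 * (pi : R) by rewrite mulr_gt0 // pi_gt0.
rewrite ler_norml => /andP[h _]; rewrite -mulrN ler_pM2l //; lra.
Qed.

Lemma Vf_near0 u : 2 * pi * nrm u <= 1 / 2 -> nrm (Vf u - 2 * (pi : R)%:C * 'i%C) <= 8 * (2 * pi) ^+ 2 * nrm u.
Proof.
have p0 : 0 < 2 * (pi : R) by rewrite mulr_gt0 // pi_gt0.
have nc : nrm (2 * (pi : R)%:C * 'i%C) = 2 * pi.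
  rewrite !nrmM nrm_nat nrm_real gtr0_norm ?pi_gt0 //.
  by rewrite (_ : nrm 'i%C = 1) ?mulr1 // /= expr0n /= add0r expr1n sqrtr1.
move=> hu; rewrite /Vf; case: eqVneq => [->|u0]; first by rewrite subrr nrm0 mulr0.
have -> : (ee u - 1) / u - 2 * (pi : R)%:C * 'i%C = (ee u - 1 - 2 * (pi : R)%:C * 'i%C * u) / u by field.
rewrite nrmM nrmV ler_pdivrMr ?nrm_gt0 //.
have := @cexp_sub1 _ (2 * (pi : R)%:C * 'i%C * u); rewrite (nrmM _ u) nc => /(_ hu).
by rewrite exprMn mulrA -[8 * _ * nrm u * _]mulrA -expr2 !mulrA.
Qed.

(** Iterating e(u) - 1 = (e(u/2) + 1)(e(u/2) - 1) writes [Vf u] as a finite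
    product of exponentials times [Vf] near 0, which is close to 2 pi i. *)
Lemma unif_Vf g : U g -> U (fun x => Vf (g x)).
Proof.
move=> ug; have [M [M0 HM]] := bdd_gt0 (unif_bdd gen_bdd ug).
have p0 : 0 < 2 * (pi : R) by rewrite mulr_gt0 // pi_gt0.
apply: unif_lim => e e0.
pose B := expR (2 * pi * M); pose D := 8 * (2 * pi) ^+ 2 * M * B.
have hh : 0 <= (1 / 2 : R) < 1 by apply/andP; split; lra.
have D0 : 0 <= D by rewrite !mulr_ge0 ?exprn_ge0 ?expR_ge0 ?pi_ge0 //; lra.
have [K1 HK1] := nullZ D0 (null_geo hh) e0.
have pM : 0 <= 2 * pi * M by rewrite mulr_ge0 ?pi_ge0 //; lra.
have h12 : 0 < (1 / 2 : R) by lra.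
have hp k : 0 <= (1 / 2) ^+ k :> R by rewrite exprn_ge0 // ltW.
have [K2 HK2] := nullZ pM (null_geo hh) h12.
pose K := (K1 + K2)%N.
have {}HK1 := HK1 K (leq_addr _ _); have {}HK2 : 2 * pi * M * (1 / 2) ^+ K < 1 / 2 by apply: HK2; rewrite leq_addl.
exists (fun x => (\prod_(k < K) ((1 + ee (g x / 2 ^+ k.+1)) / 2)) * (2 * (pi : R)%:C * 'i%C)); split.
  apply: unifM => //; last exact: unif_cst.
  apply: unif_prod => // k; apply: unifM => //; last exact: unif_cst.
  apply: unifD => //; first exact: unif_cst.
  by apply: unif_ee; apply: unifM => //; exact: unif_cst.
move=> x Sx; have hg := HM x Sx; rewrite (Vf_iter K) -mulrBr nrmM.
have n2 k : nrm (2 ^+ k : C)^-1 = (1 / 2) ^+ k by rewrite nrmV nrmX nrm_nat div1r exprVn.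
have hb : nrm (\prod_(k < K) ((1 + ee (g x / 2 ^+ k.+1)) / 2)) <= B.
  rewrite nrm_prod; apply: le_trans (_ : \prod_(k < K) expR (2 * pi * M * (1 / 2) ^+ k.+1) <= _).
    apply: ler_prod => k _; rewrite nrm_ge0 andTb nrmM nrmV nrm_nat.
    have h1 : nrm (ee (g x / 2 ^+ k.+1)) <= expR (2 * pi * M * (1 / 2) ^+ k.+1).
      apply: le_trans (nrm_ee_le _) _; rewrite ler_expR nrmM n2 mulrA ler_wpM2r ?hp //.
      by rewrite ler_wpM2l // ltW.
    have h2 : 1 <= expR (2 * pi * M * (1 / 2) ^+ k.+1).
      have h0 : 0 <= 2 * pi * M * (1 / 2) ^+ k.+1 by rewrite mulr_ge0 // exprn_ge0 //; lra.
      have := expR_ge1Dx (2 * pi * M * (1 / 2) ^+ k.+1); lra.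
    have := nrmD 1 (ee (g x / 2 ^+ k.+1)); rewrite nrm1; lra.
  rewrite -expR_sum ler_expR -mulr_sumr -[leRHS]mulr1 ler_wpM2l //.
  under eq_bigr do rewrite exprS; rewrite -mulr_sumr.
  have := geo_sum_le0 K hh; rewrite (_ : (1 - 1 / 2)^-1 = 2); last by field.
  lra.
have hv : 2 * pi * nrm (g x / 2 ^+ K) <= 1 / 2.
  apply: le_trans (ltW HK2); rewrite nrmM n2 mulrA ler_wpM2r ?hp //.
  by rewrite ler_wpM2l // ltW.
apply: le_trans (ler_pM (nrm_ge0 _) (nrm_ge0 _) hb (Vf_near0 hv)) _.
apply: le_trans (ltW HK1); rewrite nrmM n2 /D.
have c0 : 0 <= 8 * (2 * pi) ^+ 2 * B * (1 / 2) ^+ K.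
  by rewrite mulr_ge0 ?hp // mulr_ge0 ?expR_ge0 // mulr_ge0 // exprn_ge0 // ltW.
have := ler_wpM2l c0 hg; rewrite mulrAC [leRHS]mulrAC => h; apply: le_trans (le_trans _ h) _;
  rewrite le_eqVlt; apply/orP; left; apply/eqP; ring.
Qed.

End UnifExp.

(** * The theta function and Klein forms *)
Section Theta.
Variable R : realType.
Local Notation C := R[i].
Implicit Types (u z : C).

(** The quotient of the theta function [th] by u, written so that u = 0 is not
    exceptional: the factor 1 - e(u) is replaced by [Vf]. *)
Definition tht u z := Vf u * ee (- u / 2) * (poch (ee u * ee z) (ee z) * poch (ee z / ee u) (ee z)) / poch (ee z) (ee z) ^+ 2.
(** An odd theta function, normalized by its behaviour 2 pi i u at u = 0, so that
    the inversion formula has no constant. *)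
Definition th u z := - ee (- u / 2) * jt (ee u) (ee z) / poch (ee z) (ee z) ^+ 2.

Lemma nrm_ee_lt1 z : 0 < complex.Im z -> nrm (ee z) < 1.
Proof. by move=> z0; rewrite nrm_ee expR_lt1 oppr_lt0 !mulr_gt0 // pi_gt0. Qed.

Lemma poch_ee z : 0 < complex.Im z -> poch (ee z) (ee z) != 0.
Proof.
move=> z0; apply: poch_neq0 => [|n]; first exact: nrm_ee_lt1.
rewrite -exprS; apply/eqP => /(congr1 (fun x => nrm x)); rewrite nrmX nrm1 => /eqP.
by rewrite pexpr_eq1 ?nrm_ge0 // lt_eqF // nrm_ee_lt1.
Qed.

Lemma th_tht u z : 0 < complex.Im z -> th u z = u * tht u z.
Proof.
move=> z0; rewrite /th /tht jt_rec ?nrm_ee_lt1 // /Vf; case: eqVneq => [->|u0].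
  by rewrite ee0 subrr !mul0r mulr0 mul0r.
by move: (poch _ _ * _) (ee (- u / 2)) (poch (ee z) _) (poch_ee z0) => A B D D0; field; rewrite D0.
Qed.

Lemma unif_tht (T : Type) (S : T -> Prop) gen (g : T -> C) z : (forall f, gen f -> bddS S f) ->
  0 < complex.Im z -> unif S gen g -> unif S gen (fun x => tht (g x) z).
Proof.
move=> gb z0 ug; have q1 := nrm_itv (nrm_ee_lt1 z0).
have cst c : unif S gen (fun _ => c) by exact: unif_cst.
have uee : unif S gen (fun x => ee (g x)) by exact: unif_ee.
have uen : unif S gen (fun x => ee (- g x)) by apply: unif_ee => //; exact: unifN.
apply: (unifM gb) => //; apply: (unifM gb).
  apply: (unifM gb); first exact: unif_Vf.
  by apply: unif_ee => //; apply: (unifM gb) => //; exact: unifN.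
apply: (unifM gb); apply: (unif_poch gb q1) => //; apply: (unifM gb) => //.
by apply: unif_ext uen => x _; rewrite eeN.
Qed.

Definition lat z u := exists m n : int, u = m%:~R + n%:~R * z.

Lemma lat_add z u v : lat z u -> lat z v -> lat z (u + v).
Proof. by case=> m [n ->] [k [l ->]]; exists (m + k), (n + l); rewrite !intrD; ring. Qed.
Lemma lat_opp z u : lat z u -> lat z (- u).
Proof. by case=> m [n ->]; exists (- m), (- n); rewrite !mulrNz; ring. Qed.
Lemma lat1 z : lat z 1.
Proof. by exists 1, 0; rewrite mul0r addr0. Qed.
Lemma latz z : lat z z.
Proof. by exists 0, 1; rewrite mul1r add0r. Qed.
Lemma lat0 z : lat z 0.
Proof. by exists 0, 0; rewrite mul0r add0r. Qed.

Lemma eeXz (u : C) (n : int) : ee u ^ n = ee (n%:~R * u).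
Proof.
by case: n => n; [exact: eeX | rewrite NegzE mulrNz mulNr eeN -eeX].
Qed.

Lemma th_eq0 u z : 0 < complex.Im z -> th u z = 0 <-> lat z u.
Proof.
move=> z0; have q1 := nrm_ee_lt1 z0; split; last first.
  case=> m [n ->]; rewrite /th; suff -> : jt (ee (m%:~R + n%:~R * z)) (ee z) = 0 by rewrite mulr0 mul0r.
  rewrite eeD ee_int mul1r -eeXz /jt; case: n => n.
    case: n => [|n]; first by rewrite expr0z (poch_eq0 (n := 0)) ?mul0r // expr0 mulr1.
    rewrite [X in _ * X](poch_eq0 (n := n)) ?mulr0 // -[ee z ^ Posz n.+1]/(ee z ^+ n.+1) exprS.
    by field; rewrite ?expf_neq0 ee_neq0.
  rewrite (poch_eq0 (n := n.+1)) ?mul0r //; rewrite -[ee z ^ Negz n]/((ee z ^+ n.+1)^-1).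
  by rewrite mulVf // expf_neq0 // ee_neq0.
move=> h; apply: contrapT => nl; move: h; apply/eqP; rewrite /th.
have nz n : u + n%:~R * z = u + n%:~R * z -> ee (u + n%:~R * z) != 1.
  move=> _; apply/eqP => /ee_eq1 [m hm]; apply: nl; exists m, (- n).
  by rewrite mulrNz -hm; ring.
apply: mulf_neq0; last by rewrite invr_neq0 // expf_neq0 // poch_ee.
apply: mulf_neq0; first by rewrite oppr_eq0 ee_neq0.
apply: mulf_neq0; apply: poch_neq0 => // n.
  by have := nz n erefl; rewrite eeD -[n%:~R]/(n%:R) -eeX.
have := nz (- (n.+1)%:Z) erefl; rewrite eeD mulrNz mulNr eeN -[(n.+1)%:~R]/(n.+1%:R) -eeX => h.
apply: contra h => /eqP h; apply/eqP; rewrite exprS invfM mulrA.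
have := congr1 (fun x => x^-1) h; rewrite invr1 => <-; field.
by rewrite ee_neq0 ?expf_neq0 // ee_neq0.
Qed.

Lemma th_1 u z : th (u + 1) z = - th u z.
Proof.
rewrite /th eeD ee1 mulr1 opprD mulrDl eeD mulNr.
have -> : ee (- 1 / 2) = -1 :> C by rewrite mulNr eeN ee_half invrN invr1.
ring.
Qed.

Lemma th_z u z : 0 < complex.Im z -> th (u + z) z = - ee (- u - z / 2) * th u z.
Proof.
move=> z0; rewrite /th eeD (mulrC (ee u)) jt_shift ?ee_neq0 ?nrm_ee_lt1 //.
have -> : - (u + z) / 2 = - u / 2 + - (z / 2) by field.
by rewrite !eeD -eeN; ring.
Qed.

Lemma th_zN u z : 0 < complex.Im z -> th (u - z) z = - ee (u - z / 2) * th u z.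
Proof.
move=> z0; have := th_z (u - z) z0; rewrite subrK => ->.
rewrite mulrA -[LHS]mul1r; congr (_ * _); rewrite mulrNN -eeD.
by rewrite (_ : u - z / 2 + _ = 0) ?ee0 //; field.
Qed.

Lemma th_z1 u z : th u (z + 1) = th u z.
Proof. by rewrite /th eeD ee1 mulr1. Qed.

Lemma Im_frac (a b c d : int) z : (a * d - b * c = 1)%R -> 0 < complex.Im z ->
  0 < complex.Im ((a%:~R * z + b%:~R) / (c%:~R * z + d%:~R)) /\ c%:~R * z + d%:~R != 0.
Proof.
move=> det; case: z => x y y0.
have ic (k : int) : k%:~R = (k%:~R : R)%:C :> C by rewrite rmorph_int.
rewrite !ic; have detR : a%:~R * d%:~R - b%:~R * c%:~R = 1 :> R by rewrite -!intrM -intrB det.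
have N0 : 0 < (c%:~R * x + d%:~R) ^+ 2 + (c%:~R * y) ^+ 2 :> R.
  move: y0 detR => /= y0; move: (a%:~R) (b%:~R) (c%:~R) (d%:~R) => a' b' c' d' det'.
  have [c0|c0] := eqVneq c' 0.
    rewrite c0 in det' *; have : d' != 0 by apply/eqP => d0; move: det'; rewrite d0; lra.
    by move=> d0; rewrite !mul0r add0r expr0n addr0 exprn_even_gt0.
  have : 0 < (c' * y) ^+ 2 by rewrite exprn_even_gt0 //= mulf_neq0 // gt_eqF.
  have := sqr_ge0 (c' * x + d'); lra.
split.
  have -> : complex.Im ((a%:~R%:C * (x +i* y) + b%:~R%:C) / (c%:~R%:C * (x +i* y) + d%:~R%:C)) =
     y / ((c%:~R * x + d%:~R) ^+ 2 + (c%:~R * y) ^+ 2).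
    move: (a%:~R) (b%:~R) (c%:~R) (d%:~R) detR N0 => a' b' c' d' detR N0.
    transitivity (y * (a' * d' - b' * c') / ((c' * x + d') ^+ 2 + (c' * y) ^+ 2)); last by rewrite detR mulr1.
    by rewrite /= !mul0r !subr0 !addr0; field; rewrite gt_eqF.
  by rewrite divr_gt0.
apply/eqP; case; rewrite !mul0r !addr0 subr0 => h1 h2; move: N0.
by rewrite h1 h2 expr0n add0r ltxx.
Qed.

Lemma Im_opp_inv z : 0 < complex.Im z -> 0 < complex.Im (- z^-1).
Proof.
move=> z0; have [|h _] := @Im_frac 0 (-1) 1 0 z _ z0; first by [].
by move: h; rewrite mul0r add0r mul1r addr0 mulrNz mulNr mul1r.
Qed.

Lemma uhp_neq0 z : 0 < complex.Im z -> z != 0.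
Proof. by move=> z0; apply/eqP => e; move: z0; rewrite e ltxx. Qed.

Lemma locU_ext (f g : C -> C) u : (exists d : R, 0 < d /\ forall h, nrm h <= d -> f (u + h) = g (u + h)) ->
  locU f u -> locU g u.
Proof.
case=> d [d0 fg] [r [r0 uf]]; exists (Num.min r d); split; first by rewrite lt_min r0.
apply: (unif_ext (f := fun h => f (u + h))) => [h|].
  by rewrite /disc le_min => /andP[_]; exact: fg.
by apply: unif_sub uf => h; rewrite /disc le_min => /andP[].
Qed.

Let aff (a b : C) (r : R) : unif (disc r) (@gid R) (fun h => a * h + b).
Proof.
apply: unifD; last exact: unif_cst.
by apply: (unifM (@gid_bdd R r)); [exact: unif_cst | exact: unif_gen].
Qed.

Lemma locU_tht a z u : 0 < complex.Im z -> locU (fun x => tht (a * x) z) u.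
Proof.
move=> z0; exists 1; split=> //; apply: unif_ext (unif_tht (@gid_bdd R 1) z0 (aff a (a * u) 1)) => h _.
by congr tht; ring.
Qed.

Lemma locU_lin a u : locU (fun x => a * x) u.
Proof. by exists 1; split=> //; apply: unif_ext (aff a (a * u) 1) => h _; ring. Qed.

Lemma locU_th a z u : 0 < complex.Im z -> locU (fun x => th (a * x) z) u.
Proof.
move=> z0; apply: locU_ext (locU_M (locU_lin a u) (locU_tht a u z0)).
by exists 1; split=> // h _; rewrite th_tht.
Qed.

Lemma locU_gauss c u : locU (fun x => ee (c * x ^+ 2)) u.
Proof.
exists 1; split=> //; have gb := @gid_bdd R 1.
apply: (unif_ee gb (g := fun h => c * (u + h) ^+ 2)); apply: (unifM gb); first exact: unif_cst.
by apply: (unifX gb); apply: unif_ext (aff 1 u 1) => h _; ring.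
Qed.

Lemma tht0 z : 0 < complex.Im z -> tht 0 z = 2 * (pi : R)%:C * 'i%C.
Proof.
move=> z0; rewrite /tht /Vf eqxx oppr0 mul0r !ee0 mulr1 mul1r divr1 expr2 mulfK //.
by rewrite mulf_neq0 // poch_ee.
Qed.

(** The quotient of the two sides of [th_S], with its limit at lattice points. *)
Definition rho z u := if `[< lat z u >] then 1 else
  z * th (z^-1 * u) (- z^-1) * ee (- (2 * z)^-1 * u ^+ 2) / th u z.

Lemma rho_per z w u : lat z w -> th (z^-1 * (u + w)) (- z^-1) * ee (- (2 * z)^-1 * (u + w) ^+ 2) / th (u + w) z =
    th (z^-1 * u) (- z^-1) * ee (- (2 * z)^-1 * u ^+ 2) / th u z -> rho z (u + w) = rho z u.
Proof.
move=> lw h; rewrite /rho; have [lu|nlu] := pselect (lat z u).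
  by rewrite !asboolT //; exact: lat_add.
rewrite !asboolF //; first by move: h; rewrite -!mulrA => ->.
by move=> l; apply: nlu; rewrite -[u](addrK w); apply: lat_add => //; exact: lat_opp.
Qed.

Lemma rho_1 z u : 0 < complex.Im z -> rho z (u + 1) = rho z u.
Proof.
move=> z0; have zn := uhp_neq0 z0; apply: rho_per; first exact: lat1.
rewrite th_1 mulrDr mulr1 -[z^-1 * u + z^-1]/(z^-1 * u + z^-1).
have -> : z^-1 * u + z^-1 = z^-1 * u - (- z^-1) by rewrite opprK.
rewrite th_zN ?Im_opp_inv //.
have -> : ee (- (2 * z)^-1 * (u + 1) ^+ 2) = ee (- (2 * z)^-1 * u ^+ 2) / ee (z^-1 * u - - z^-1 / 2).
  by rewrite -eeB; congr ee; field; rewrite zn.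
rewrite invrN; move: (ee_neq0 (z^-1 * u - - z^-1 / 2)); move: (ee (z^-1 * u - _)) ((th u z)^-1) => A B A0.
by field.
Qed.

Lemma rho_z z u : 0 < complex.Im z -> rho z (u + z) = rho z u.
Proof.
move=> z0; have zn := uhp_neq0 z0; apply: rho_per; first exact: latz.
rewrite th_z // mulrDr mulVf // th_1.
have -> : ee (- (2 * z)^-1 * (u + z) ^+ 2) = ee (- (2 * z)^-1 * u ^+ 2) * ee (- u - z / 2).
  by rewrite -eeD; congr ee; field; rewrite zn.
rewrite (invfM (- ee (- u - z / 2))) invrN; move: (ee_neq0 (- u - z / 2)); move: (ee (- u - _)) ((th u z)^-1) => A B A0.
by field.
Qed.

(** Numerator and denominator have the same zeros, the lattice points; there,
    periodicity reduces to the point 0, where both zeros are simple and the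
    factor u cancels. *)
Lemma locU_rho z u : 0 < complex.Im z -> locU (rho z) u.
Proof.
move=> z0; have zn := uhp_neq0 z0; have z0' := Im_opp_inv z0.
have [[m [n hu]]|nl] := pselect (lat z u).
  suff [r [r0 H]] : locU (rho z) 0.
    exists r; split=> //; apply: unif_ext H => h _; rewrite add0r hu.
    have -> : m%:~R + n%:~R * z + h = h + m%:~R + n%:~R * z by ring.
    by rewrite periodic_int // => v; [exact: rho_1 | exact: rho_z].
  have lg : locU (fun x => tht (z^-1 * x) (- z^-1) * ee (- (2 * z)^-1 * x ^+ 2) * (tht (1 * x) z)^-1) 0.
    apply: locU_M; first by apply: locU_M; [exact: locU_tht | exact: locU_gauss].
    apply: locU_inv; last exact: locU_tht.
    by rewrite mulr0 tht0 // -nrm_gt0 !nrmM nrm_nat nrm_real gtr0_norm ?pi_gt0 // (_ : nrm 'i%C = 1) ?mulr1 ?mulr_gt0 ?pi_gt0 //= expr0n /= add0r expr1n sqrtr1.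
  apply: locU_ext lg; have c0 : 0 < nrm (tht 0 z : C) / 2.
    by rewrite divr_gt0 // tht0 // !nrmM nrm_nat nrm_real gtr0_norm ?pi_gt0 // (_ : nrm 'i%C = 1) ?mulr1 ?mulr_gt0 ?pi_gt0 //= expr0n /= add0r expr1n sqrtr1.
  have [d [d0 hd]] := locU_cont (locU_tht 1 0 z0) c0.
  exists d; split=> // h /hd; rewrite !add0r mulr0 !mul1r => hh.
  have tn : tht h z != 0.
    by apply/eqP => e; move: hh; rewrite e sub0r nrmN; lra.
  rewrite /rho; case: (asboolP (lat z h)) => [/(th_eq0 h z0)|nlh].
    rewrite th_tht // => /eqP; rewrite mulf_eq0 (negbTE tn) orbF => /eqP ->.
    by rewrite mulr0 expr0n mulr0 ee0 mulr1 !tht0 // divff // -(tht0 z0); move: c0; rewrite ltr_pdivlMr // mul0r nrm_gt0.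
  have h0 : h != 0 by apply/eqP => e; apply: nlh; rewrite e; exact: lat0.
  rewrite !th_tht //; move: (tht _ _) (ee _) => A B; field.
  by rewrite tn h0 zn.
have tn : th u z != 0 by apply/eqP => /(th_eq0 u z0).
have lf : locU (fun x => z * th (z^-1 * x) (- z^-1) * ee (- (2 * z)^-1 * x ^+ 2) * (th (1 * x) z)^-1) u.
  apply: locU_M; last by apply: locU_inv; [rewrite mul1r | exact: locU_th].
  apply: locU_M; last exact: locU_gauss.
  by apply: locU_M; [exists 1; split=> //; exact: unif_cst | exact: locU_th].
apply: locU_ext lf; have c0 : 0 < nrm (th u z) / 2 by rewrite divr_gt0 // nrm_gt0.
have [d [d0 hd]] := locU_cont (locU_th 1 u z0) c0.
exists d; split=> // h /hd; rewrite !mul1r => hh.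
rewrite /rho; case: (asboolP (lat z (u + h))) => [/(th_eq0 (u + h) z0) e|//].
by exfalso; move: hh; rewrite e sub0r nrmN; lra.
Qed.

(** The quotient [rho] is an entire elliptic function, hence constant, and its
    value at 0 is 1. *)
Lemma th_S u z : 0 < complex.Im z -> th (u / z) (- z^-1) = z^-1 * ee (u ^+ 2 / (2 * z)) * th u z.
Proof.
move=> z0; have zn := uhp_neq0 z0; have [[m [n hu]]|nl] := pselect (lat z u).
  have -> : th u z = 0 by apply/th_eq0 => //; exists m, n.
  rewrite mulr0; apply/th_eq0; first exact: Im_opp_inv.
  by exists n, (- m); rewrite hu mulrNz; field.
have : rho z u = rho z 0.
  apply: (doubly_periodic_const z0) => [v|v|v]; [exact: locU_rho | exact: rho_1 | exact: rho_z].
rewrite /rho asboolF // asboolT; last exact: lat0.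
have tn : th u z != 0 by apply/eqP => /(th_eq0 u z0).
have -> : - (2 * z)^-1 * u ^+ 2 = - (u ^+ 2 / (2 * z)) by rewrite mulNr mulrC.
move/(congr1 (fun x => x * th u z)); rewrite divfK // mul1r => <-.
rewrite eeN (mulrC z^-1 u); move: (ee_neq0 (u ^+ 2 / (2 * z))) => A0.
by field; rewrite A0.
Qed.

(** The Klein form of the vector (X/p, Y/p).  The exponential prefactor turns the
    quasi-periodicity of theta and the Gaussian factor of [th_S] into an exact
    action of SL2(Z) on index vectors. *)
Definition kl (p : nat) (X Y : int) z :=
  ee (X%:~R * (X%:~R * z + Y%:~R) / (2 * p%:R ^+ 2)) * th ((X%:~R * z + Y%:~R) / p%:R) z.

Lemma kl_eq p X Y X' Y' z : X = X' -> Y = Y' -> kl p X Y z = kl p X' Y' z.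
Proof. by move=> -> ->. Qed.

Lemma kl_T p X Y z : kl p X Y (z + 1) = kl p X (X + Y) z.
Proof.
have e : X%:~R * (z + 1) + Y%:~R = X%:~R * z + (X + Y)%:~R by rewrite intrD; ring.
by rewrite /kl th_z1 e.
Qed.

Lemma kl_S p X Y z : (0 < p)%N -> 0 < complex.Im z -> kl p X Y (- z^-1) = z^-1 * kl p Y (- X) z.
Proof.
move=> p0 z0; have zn := uhp_neq0 z0; have pn : p%:R != 0 :> C by rewrite pnatr_eq0 -lt0n.
rewrite /kl mulrNz; have -> : (X%:~R * - z^-1 + Y%:~R) / p%:R = (Y%:~R * z + - X%:~R) / p%:R / z :> C.
  by field; rewrite zn pn.
set u := (_ / p%:R); rewrite th_S //.
have -> : ee (Y%:~R * (Y%:~R * z + - X%:~R) / (2 * p%:R ^+ 2)) =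
    ee (X%:~R * (X%:~R * - z^-1 + Y%:~R) / (2 * p%:R ^+ 2)) * ee (u ^+ 2 / (2 * z)) :> C.
  by rewrite -eeD; congr ee; rewrite /u; field; rewrite zn pn.
by move: (ee _) (ee _) (th u z) => A B D; ring.
Qed.

(** The matrices T and S generate SL2(Z): the Euclidean algorithm on the first
    column (a, c) writes the matrix as T^k S times a matrix with smaller |c|. *)
Lemma kl_SL2 p (a b c d X Y : int) z : (0 < p)%N -> 0 < complex.Im z -> (a * d - b * c = 1)%R ->
  kl p X Y ((a%:~R * z + b%:~R) / (c%:~R * z + d%:~R)) =
  (c%:~R * z + d%:~R)^-1 * kl p (X * a + Y * c) (X * b + Y * d) z.
Proof.
move=> p0 z0; have [n] := ubnP (absz c); elim: n => // n IH in a b c d X Y *; move=> hc det.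
have trans (k : int) w V W : kl p V W (w + k%:~R) = kl p V (V * k + W) w.
  have tn (j : nat) w' W' : kl p V W' (w' + j%:R) = kl p V (V * j%:Z + W') w'.
    elim: j W' => [|j IHj] W'; first by rewrite addr0 mulr0 add0r.
    have -> : w' + j.+1%:R = w' + j%:R + 1 :> C by rewrite -natr1 addrA.
    rewrite (kl_T p V W' (w' + j%:R)) IHj.
    have -> // : V * Posz j + (V + W') = V * Posz j.+1 + W'.
    by rewrite (_ : Posz j.+1 = Posz j + 1) ?mulrDr ?mulr1 ?addrA // -PoszD addn1.
  case: k => k; first exact: tn.
  have -> : w = (w + (Negz k)%:~R) + k.+1%:R by rewrite NegzE mulrNz; ring.
  rewrite (tn k.+1 (w + (Negz k)%:~R)) NegzE mulrNz addrK.
  by rewrite (_ : V * k.+1%:Z + _ = W) //; ring.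
(* S applied twice acts as -1 on vectors and trivially on z. *)
have neg V W : kl p (- V) (- W) z = - kl p V W z.
  have zn := uhp_neq0 z0; have := kl_S V W p0 (Im_opp_inv z0).
  rewrite (kl_S W (- V) p0 z0) invrN invrK opprK => ->; by field.
have [c0|c0] := eqVneq c 0.
  have ad : (a * d = 1)%R by rewrite -det c0 mulr0 subr0.
  have [[-> ->]|[-> ->]] : (a = 1 /\ d = 1) \/ (a = -1 /\ d = -1).
    have := congr1 absz ad; rewrite abszM => /eqP; rewrite muln_eq1 => /andP[/eqP h1 _].
    have [ea|ea] : a = 1 \/ a = -1 by clear -h1; lia.
      by left; rewrite ea mul1r in ad.
    by right; rewrite ea mulN1r in ad; split=> //; rewrite -ad opprK.
    rewrite c0 mul0r add0r mul1r divr1 invr1 mul1r trans !mulr1 !mulr0 !addr0.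
    by apply: kl_eq; ring.
  rewrite c0 mul0r add0r (_ : (-1)%:~R * z + b%:~R = - (z + (- b)%:~R)); last by rewrite mulrNz; ring.
  rewrite (_ : (-1)%:~R = -1) // invrN invr1 mulrNN mulr1 trans mulN1r -neg.
  by apply: kl_eq; ring.
pose k := (a %/ c)%Z; pose r := (a %% c)%Z.
have ar : a = k * c + r by exact: divz_eq.
have rc : (absz (- r) < n)%N.
  rewrite abszN; apply: (@leq_trans (absz c)) => //.
  by have := ltz_mod a c0; have := modz_ge0 a c0; rewrite -/r; clear; lia.
have det' : (c * (- (b - k * d)) - d * (- r) = 1)%R by rewrite -det ar; ring.
have [y0 yn] := Im_frac det' z0; have [_ cn] := Im_frac det z0.
set y := (_ / _) in y0.
have hy : (a%:~R * z + b%:~R) / (c%:~R * z + d%:~R) = - y^-1 + k%:~R.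
  rewrite /y invf_div ar !mulrNz !intrD !mulrNz !intrM; field; exact: cn.
rewrite hy trans (kl_S _ _ p0 y0) (IH _ _ _ _ _ _ rc det') mulrA.
have -> : y^-1 * ((- r)%:~R * z + (- (b - k * d))%:~R)^-1 = (c%:~R * z + d%:~R)^-1.
  by rewrite /y invf_div mulrAC mulfV // mul1r.
by congr (_ * _); apply: kl_eq; rewrite ?ar; ring.
Qed.

End Theta.

(** * Shifts of Klein forms by p times integer vectors *)
Lemma int_ind2 (P : int -> Prop) : P 0 -> (forall n, P n -> P (n + 1)) -> (forall n, P n -> P (n - 1)) -> forall n, P n.
Proof.
move=> P0 Pp Pm; case=> n.
  by elim: n => // n IH; have := Pp _ IH; rewrite -PoszD addn1.
elim: n => [|n IH]; first by have := Pm _ P0; rewrite sub0r.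
by have := Pm _ IH; rewrite !NegzE -opprD -PoszD addn1.
Qed.

(** Modulo 2 this is 0 exactly if X and Y are both even, a condition invariant
    under SL2(Z); it is the exponent of the sign in the shift formula for Klein
    forms. *)
Definition sig (X Y : int) : int := X * Y + X + Y.
Definition symp (X Y X' Y' : int) : int := X * Y' - Y * X'.

Lemma sig_even X Y : (2 %| sig X Y)%Z = (2 %| X)%Z && (2 %| Y)%Z.
Proof.
have par (x : int) : exists k (b : bool), x = 2 * k + b%:Z.
  by exists (x %/ 2)%Z, ((x %% 2)%Z == 1); rewrite {1}(divz_eq x 2); case: eqP; lia.
have [k [b ->]] := par X; have [l [c ->]] := par Y.
have -> : sig (2 * k + b%:Z) (2 * l + c%:Z) = 2 * (2 * k * l + k * c%:Z + l * b%:Z + k + l) + (b%:Z * c%:Z + b%:Z + c%:Z).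
  by rewrite /sig; ring.
move: (_ + k + l) => t; case: b; case: c; rewrite /=; lia.
Qed.

Lemma sig_SL2 (a b c d X Y : int) : a * d - b * c = 1 ->
  exists N, sig (X * a + Y * c) (X * b + Y * d) = sig X Y + 2 * N.
Proof.
move=> det; have imp (a' b' c' d' X' Y' : int) : (2 %| X')%Z && (2 %| Y')%Z -> (2 %| X' * a' + Y' * c')%Z && (2 %| X' * b' + Y' * d')%Z.
  by move=> /andP[hX hY]; rewrite !rpredD // dvdz_mulr.
have e : (2 %| sig (X * a + Y * c) (X * b + Y * d))%Z = (2 %| sig X Y)%Z.
  rewrite !sig_even; apply/idP/idP; last exact: imp.
  move=> /(imp d (- b) (- c) a); congr ((2 %| _)%Z && (2 %| _)%Z).
    by rewrite -[RHS]mulr1 -det; ring.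
  by rewrite -[RHS]mulr1 -det; ring.
exists ((sig (X * a + Y * c) (X * b + Y * d) - sig X Y) %/ 2)%Z; move: e.
by move: (sig _ _) (sig _ _) => u v; lia.
Qed.

Section KleinShift.
Variable R : realType.
Local Notation C := R[i].
Implicit Types (u z : C).

Lemma ee_congr u v (n : int) : u = v + n%:~R -> ee u = ee v :> C.
Proof. by move=> ->; rewrite eeDint. Qed.

Lemma th_n u z (n : int) : th (u + n%:~R) z = ee (n%:~R / 2) * th u z.
Proof.
have hN : ee (- (1 / 2)) = -1 :> C by rewrite eeN ee_half invrN invr1.
elim/int_ind2: n => [|n IH|n IH]; first by rewrite addr0 mul0r ee0 mul1r.
  by rewrite intrD addrA th_1 IH mulrDl eeD ee_half; ring.
have -> : (n - 1)%:~R / 2 = n%:~R / 2 + - (1 / 2) :> C by rewrite intrB; field.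
rewrite eeD hN; have := th_1 (u + (n - 1)%:~R) z.
have -> : u + (n - 1)%:~R + 1 = u + n%:~R by rewrite intrB; ring.
by rewrite IH => h; rewrite -[LHS]opprK -h; ring.
Qed.

Lemma opp_ee u : - ee u = ee (1 / 2 + u) :> C.
Proof. by rewrite eeD ee_half mulN1r. Qed.

Lemma ee_collect (a b c d e t : C) (n : int) : a + b + c = d + e + n%:~R -> ee a * (ee b * (ee c * t)) = ee d * (ee e * t).
Proof. by move=> /(congr1 (@ee R)); rewrite eeDint !eeD !mulrA => ->. Qed.

Lemma th_mz u z (m : int) : 0 < complex.Im z ->
  th (u + m%:~R * z) z = ee (m%:~R / 2 - m%:~R * u - m%:~R ^+ 2 * z / 2) * th u z.
Proof.
move=> z0; elim/int_ind2: m u => [|m IH|m IH] u.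
- by rewrite !mul0r addr0 expr0n !mul0r !subr0 ee0 mul1r.
- have -> : u + (m + 1)%:~R * z = (u + z) + m%:~R * z by rewrite intrD; ring.
  rewrite IH th_z // opp_ee (mulrA (ee _) (ee _)) -eeD; congr (_ * _).
  by apply: (@ee_congr _ _ 0); rewrite !intrD; field.
have -> : u + (m - 1)%:~R * z = (u - z) + m%:~R * z by rewrite intrB; ring.
rewrite IH th_zN // opp_ee (mulrA (ee _) (ee _)) -eeD; congr (_ * _).
by apply: (@ee_congr _ _ 1); rewrite intrB; field.
Qed.

(** The quasi-periods of theta, used m and n times; the phase is a 2p-th root of
    unity. *)
Lemma kl_shift p (m n X Y : int) z : (0 < p)%N -> 0 < complex.Im z ->
  kl p (X + p%:Z * m) (Y + p%:Z * n) z =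
  ee ((sig m n)%:~R / 2 - (symp m n X Y)%:~R / (2 * p%:R)) * kl p X Y z.
Proof.
move=> p0 z0; have pn : p%:R != 0 :> C by rewrite pnatr_eq0 -lt0n.
rewrite /kl.
have -> : ((X + p%:Z * m)%:~R * z + (Y + p%:Z * n)%:~R) / p%:R =
   (X%:~R * z + Y%:~R) / p%:R + n%:~R + m%:~R * z :> C.
  by rewrite !intrD !intrM -![(p%:Z)%:~R]/(p%:R); field; exact: pn.
rewrite th_mz // th_n; apply: (@ee_collect _ _ _ _ _ _ (- (m * n))).
rewrite /sig /symp !(intrD, intrM, intrB, mulrNz) -![(p%:Z)%:~R]/(p%:R); field; exact: pn.
Qed.

Lemma prod_ee (n : nat) (f : nat -> C) : \prod_(i < n) ee (f i) = ee (\sum_(i < n) f i).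
Proof. by elim: n => [|n IH]; rewrite ?big_ord0 ?ee0 // !big_ord_recr IH eeD. Qed.

(** With p = 2h + 1, the indices 1, ..., h represent the nonzero residues modulo p
    up to sign, so such products occur when (x;x) is split modulo p. *)
Definition klp p h (X Y : int) z := \prod_(i < h) kl p (i.+1%:Z * X) (i.+1%:Z * Y) z.

Lemma klp_shift p h (m n X Y : int) z : (0 < p)%N -> 0 < complex.Im z ->
  klp p h (X + p%:Z * m) (Y + p%:Z * n) z =
  ee ((\sum_(i < h) i.+1 ^ 2)%N%:R * ((m * n)%:~R / 2 - (symp m n X Y)%:~R / (2 * p%:R)) +
      (\sum_(i < h) i.+1)%N%:R * (m + n)%:~R / 2) * klp p h X Y z.
Proof.
move=> p0 z0; have pn : p%:R != 0 :> C by rewrite pnatr_eq0 -lt0n.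
elim: h => [|h IH]; first by rewrite /klp !big_ord0 !mul0r add0r ee0 mulr1.
rewrite /klp !big_ord_recr /= -!/(klp _ _ _ _ _) IH.
have -> : h.+1%:Z * (X + p%:Z * m) = h.+1%:Z * X + p%:Z * (h.+1%:Z * m) by ring.
have -> : h.+1%:Z * (Y + p%:Z * n) = h.+1%:Z * Y + p%:Z * (h.+1%:Z * n) by ring.
rewrite kl_shift // mulrACA -eeD; congr (ee _ * _).
rewrite /sig /symp !(natrD, natrX) !(intrD, intrM, intrB, mulrNz) -![(h.+1%:Z)%:~R]/(h.+1%:R).
by field; exact: pn.
Qed.

End KleinShift.

(** These sums evaluate the exponents in [klp_shift]. *)
Lemma sum1_half h s p : p = (2 * h + 1)%N -> (24 * s + 1 = p ^ 2)%N ->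
  (\sum_(i < h) i.+1 = 3 * s)%N /\ (\sum_(i < h) i.+1 ^ 2 = p * s)%N.
Proof.
move=> -> hs; have e1 n : (2 * \sum_(i < n) i.+1 = n * n.+1)%N.
  by elim: n => [|n IH]; rewrite ?big_ord0 // big_ord_recr mulnDr IH /=; lia.
have e2 n : (6 * \sum_(i < n) i.+1 ^ 2 = n * n.+1 * (2 * n + 1))%N.
  by elim: n => [|n IH]; rewrite ?big_ord0 // big_ord_recr /= mulnDr IH; nia.
have := e1 h; have := e2 h; move: (\sum_(i < h) i.+1)%N (\sum_(i < h) i.+1 ^ 2)%N => a b h2 h1.
by split; nia.
Qed.

(** * Quotients of Klein forms of weight 1 *)
Section Gfun.
Variables (R : realType) (p h mu s : nat).
Local Notation C := R[i].
Hypothesis hp : p = (2 * h + 1)%N.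
Hypothesis hmu : mu = (3 * h + 2)%N.
Hypothesis hs : (24 * s + 1 = p ^ 2)%N.
Implicit Types (z : C).

(** This phase compensates the factors from [kl_shift] and [klp_shift]; the sign
    exponents [sig] and the symplectic form keep it invariant under SL2(Z) up to
    integers. *)
Definition Gph (V1 V2 W1 W2 E1 E2 : int) : C :=
  ((sig V1 V2)%:~R + s%:R * (sig W1 W2)%:~R + (1 + s%:R) * (sig E1 E2)%:~R) / 2 +
  3 * (symp V1 V2 E1 E2)%:~R / (2 * p%:R).

(** The summands of the dissection formula correspond to V = k (1, j), W = (1, j)
    and E = (0, 1) or (0, -1).  The products [klp] have equal weights, and the
    single Klein forms leave the total weight 1. *)
Definition Gs (V1 V2 W1 W2 E1 E2 : int) z : C :=
  ee (Gph V1 V2 W1 W2 E1 E2) * (klp p h E1 E2 z / klp p h W1 W2 z) *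
  (kl p (V1 - 2 * E1) (V2 - 2 * E2) z ^+ mu * kl p V1 V2 z ^+ mu /
   (kl p (V1 - E1) (V2 - E2) z * kl p E1 E2 z ^+ (2 * mu))).

Let p0 : (0 < p)%N. Proof. by rewrite hp addn1. Qed.
Let pR : p%:R = 2 * h%:R + 1 :> C. Proof. by rewrite hp natrD natrM. Qed.
Let muR : mu%:R = 3 * h%:R + 2 :> C. Proof. by rewrite hmu natrD natrM. Qed.
Let pn : p%:R != 0 :> C. Proof. by rewrite pnatr_eq0 -lt0n. Qed.
Let pn' : 2 * h%:R + 1 != 0 :> C. Proof. by rewrite -pR. Qed.

Lemma Gs_phase (x y w v a b c d e f P Q A : C) :
  ee (A + mu%:R * a + mu%:R * b - c - (2 * mu)%:R * d + e - f) *
    (P / Q) * (x ^+ mu * y ^+ mu / (w * v ^+ (2 * mu))) =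
  ee A * (ee e * P / (ee f * Q)) * ((ee a * x) ^+ mu * (ee b * y) ^+ mu / ((ee c * w) * (ee d * v) ^+ (2 * mu))).
Proof.
rewrite (exprMn mu (ee a)) (exprMn mu (ee b)) (exprMn _ (ee d)) !eeX.
have -> : ee (A + mu%:R * a + mu%:R * b - c - (2 * mu)%:R * d + e - f) =
   ee A * ee (mu%:R * a) * ee (mu%:R * b) / ee c / ee ((2 * mu)%:R * d) * ee e / ee f :> C.
  by rewrite !eeD !eeN.
move: (ee A) (ee e) (ee f) (ee c) (ee (mu%:R * a)) (ee (mu%:R * b)) (ee ((2 * mu)%:R * d)) => *.
by rewrite !invfM; ring.
Qed.

(** As 2 mu - 1 = 3p, the symplectic phases of the three Klein forms involving V
    add up to half-integers, which the change of [Gph] compensates. *)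
Lemma Gs_perV (m n V1 V2 W1 W2 E1 E2 : int) z : 0 < complex.Im z ->
  Gs (V1 + p%:Z * m) (V2 + p%:Z * n) W1 W2 E1 E2 z = Gs V1 V2 W1 W2 E1 E2 z.
Proof.
move=> z0; rewrite /Gs.
have e1 (V E M k : int) : V + p%:Z * M - k * E = V - k * E + p%:Z * M by ring.
have e2 (V E M : int) : V + p%:Z * M - E = V - E + p%:Z * M by ring.
rewrite !e1 !e2 !kl_shift //.
have := Gs_phase (kl p (V1 - 2 * E1) (V2 - 2 * E2) z) (kl p V1 V2 z) (kl p (V1 - E1) (V2 - E2) z) (kl p E1 E2 z)
  ((sig m n)%:~R / 2 - (symp m n (V1 - 2 * E1) (V2 - 2 * E2))%:~R / (2 * p%:R))
  ((sig m n)%:~R / 2 - (symp m n V1 V2)%:~R / (2 * p%:R))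
  ((sig m n)%:~R / 2 - (symp m n (V1 - E1) (V2 - E2))%:~R / (2 * p%:R)) 0 0 0
  (klp p h E1 E2 z) (klp p h W1 W2 z) (Gph (V1 + p%:Z * m) (V2 + p%:Z * n) W1 W2 E1 E2).
rewrite !ee0 !mul1r => <-; congr (_ * _ * _).
apply: (@ee_congr _ _ _ (m * n * (2 * h%:Z + 1) * (h%:Z + 2) + 2 * (2 * h%:Z + 1) * (m + n) + (h%:Z - 1) * m * V2
   + (h%:Z + 2) * n * V1 + 3 * (m * E2 - n * E1))).
rewrite /Gph /sig /symp !(natrM, intrD, intrM, intrB, mulrNz) -![(p%:Z)%:~R]/(p%:R) -![(h%:Z)%:~R]/(h%:R) pR muR.
by field; exact: pn'.
Qed.

Lemma Gs_perW (m n V1 V2 W1 W2 E1 E2 : int) z : 0 < complex.Im z ->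
  Gs V1 V2 (W1 + p%:Z * m) (W2 + p%:Z * n) E1 E2 z = Gs V1 V2 W1 W2 E1 E2 z.
Proof.
move=> z0; rewrite /Gs klp_shift //.
have [-> ->] := sum1_half hp hs.
have := Gs_phase (kl p (V1 - 2 * E1) (V2 - 2 * E2) z) (kl p V1 V2 z) (kl p (V1 - E1) (V2 - E2) z) (kl p E1 E2 z)
  0 0 0 0 0 ((p * s)%:R * ((m * n)%:~R / 2 - (symp m n W1 W2)%:~R / (2 * p%:R)) + (3 * s)%:R * (m + n)%:~R / 2)
  (klp p h E1 E2 z) (klp p h W1 W2 z) (Gph V1 V2 (W1 + p%:Z * m) (W2 + p%:Z * n) E1 E2).
rewrite !ee0 !mul1r => <-; congr (_ * _ * _).
apply: (@ee_congr _ _ _ (s%:Z * (m * n * (2 * h%:Z + 1) * h%:Z + (m + n) * (h%:Z - 1) + W1 * n * h%:Z + m * W2 * (h%:Z + 1)))).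
rewrite /Gph /sig /symp !(natrM, intrD, intrM, intrB, mulrNz) -![(p%:Z)%:~R]/(p%:R) -![(h%:Z)%:~R]/(h%:R) -![(s%:Z)%:~R]/(s%:R) pR muR.
by field; exact: pn'.
Qed.

Lemma Gs_perE (m n V1 V2 W1 W2 E1 E2 : int) z : 0 < complex.Im z ->
  Gs V1 V2 W1 W2 (E1 + p%:Z * m) (E2 + p%:Z * n) z = Gs V1 V2 W1 W2 E1 E2 z.
Proof.
move=> z0; rewrite /Gs.
have e1 (V E M : int) : V - 2 * (E + p%:Z * M) = V - 2 * E + p%:Z * (-2 * M) by ring.
have e2 (V E M : int) : V - (E + p%:Z * M) = V - E + p%:Z * (- M) by ring.
rewrite !e1 !e2 !kl_shift // klp_shift //.
have [-> ->] := sum1_half hp hs.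
have := Gs_phase (kl p (V1 - 2 * E1) (V2 - 2 * E2) z) (kl p V1 V2 z) (kl p (V1 - E1) (V2 - E2) z) (kl p E1 E2 z)
  ((sig (-2 * m) (-2 * n))%:~R / 2 - (symp (-2 * m) (-2 * n) (V1 - 2 * E1) (V2 - 2 * E2))%:~R / (2 * p%:R))
  0
  ((sig (- m) (- n))%:~R / 2 - (symp (- m) (- n) (V1 - E1) (V2 - E2))%:~R / (2 * p%:R))
  ((sig m n)%:~R / 2 - (symp m n E1 E2)%:~R / (2 * p%:R))
  ((p * s)%:R * ((m * n)%:~R / 2 - (symp m n E1 E2)%:~R / (2 * p%:R)) + (3 * s)%:R * (m + n)%:~R / 2) 0
  (klp p h E1 E2 z) (klp p h W1 W2 z) (Gph V1 V2 W1 W2 (E1 + p%:Z * m) (E2 + p%:Z * n)).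
rewrite !ee0 !mul1r => <-; congr (_ * _ * _).
apply: (@ee_congr _ _ _ (m * n * (2 * h%:Z * h%:Z + 2 * h%:Z + 3 * h%:Z + 2 + s%:Z * (2 * h%:Z + 1) * (h%:Z + 1)) +
  (m + n) * (h%:Z + 1 + s%:Z * (h%:Z + 2) - 2 * (3 * h%:Z + 2)) + E1 * n * (h%:Z + 2 + s%:Z * (h%:Z + 1)) +
  m * E2 * (h%:Z - 1 + s%:Z * h%:Z))).
rewrite /Gph /sig /symp !(natrM, intrD, intrM, intrB, mulrNz) -![(p%:Z)%:~R]/(p%:R) -![(h%:Z)%:~R]/(h%:R) -![(s%:Z)%:~R]/(s%:R) pR muR.
by field; exact: pn'.
Qed.

Lemma klp_SL2 (a b c d X Y : int) z : 0 < complex.Im z -> a * d - b * c = 1 ->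
  klp p h X Y ((a%:~R * z + b%:~R) / (c%:~R * z + d%:~R)) =
  (c%:~R * z + d%:~R)^-1 ^+ h * klp p h (X * a + Y * c) (X * b + Y * d) z.
Proof.
move=> z0 det; rewrite /klp -[h in _ ^+ h](card_ord h) -prodr_const -big_split /=; apply: eq_bigr => i _.
rewrite kl_SL2 //; congr (_ * _); apply: kl_eq; ring.
Qed.

(** SL2(Z) acts on the three vectors simultaneously, so the symplectic form in the
    phase is unchanged and [sig] changes by even integers. *)
Lemma Gs_SL2 (a b c d V1 V2 W1 W2 E1 E2 : int) z : 0 < complex.Im z -> a * d - b * c = 1 ->
  Gs V1 V2 W1 W2 E1 E2 ((a%:~R * z + b%:~R) / (c%:~R * z + d%:~R)) =
  (c%:~R * z + d%:~R) * Gs (V1 * a + V2 * c) (V1 * b + V2 * d) (W1 * a + W2 * c) (W1 * b + W2 * d)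
    (E1 * a + E2 * c) (E1 * b + E2 * d) z.
Proof.
move=> z0 det; have [_ cz] := Im_frac det z0; rewrite /Gs !klp_SL2 // !kl_SL2 //.
have e1 (X Y x y t : int) : (X - 2 * x) * t + (Y - 2 * y) * b = X * t + Y * b - 2 * (x * t + y * b) by ring.
have -> : ee (Gph (V1 * a + V2 * c) (V1 * b + V2 * d) (W1 * a + W2 * c) (W1 * b + W2 * d)
    (E1 * a + E2 * c) (E1 * b + E2 * d)) = ee (Gph V1 V2 W1 W2 E1 E2).
  have [N1 h1] := sig_SL2 V1 V2 det; have [N2 h2] := sig_SL2 W1 W2 det; have [N3 h3] := sig_SL2 E1 E2 det.
  apply: (@ee_congr _ _ _ (N1 + s%:Z * N2 + (1 + s%:Z) * N3)).
  rewrite /Gph h1 h2 h3.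
  have -> : symp (V1 * a + V2 * c) (V1 * b + V2 * d) (E1 * a + E2 * c) (E1 * b + E2 * d) = symp V1 V2 E1 E2.
    by rewrite /symp -[RHS]mulr1 -det; ring.
  by rewrite !(intrD, intrM) -![(s%:Z)%:~R]/(s%:R); field; exact: pn.
have -> : (V1 - 2 * E1) * a + (V2 - 2 * E2) * c = V1 * a + V2 * c - 2 * (E1 * a + E2 * c) by ring.
have -> : (V1 - 2 * E1) * b + (V2 - 2 * E2) * d = V1 * b + V2 * d - 2 * (E1 * b + E2 * d) by ring.
have -> : (V1 - E1) * a + (V2 - E2) * c = V1 * a + V2 * c - (E1 * a + E2 * c) by ring.
have -> : (V1 - E1) * b + (V2 - E2) * d = V1 * b + V2 * d - (E1 * b + E2 * d) by ring.
move: (c%:~R * z + d%:~R) cz => J J0.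
have Jm0 : J ^+ mu != 0 by rewrite expf_neq0.
have Jh0 : J ^+ h != 0 by rewrite expf_neq0.
move: (ee _) (klp _ _ _ _ _) (klp _ _ _ _ _) (kl _ _ _ z) (kl _ _ _ z) (kl _ _ _ z) (kl _ _ _ z) => g1 g2 g3 g4 g5 g6 g7.
rewrite (mulnC 2 mu) !exprM !exprMn !exprVn.
move: (J ^+ mu) (J ^+ h) Jm0 Jh0 => Jm Jh Jm0 Jh0.
rewrite !invfM !invrK.
move: (g4 ^+ mu) => y; have [->|y0] := eqVneq y 0; [by rewrite ?expr0n /= ?invr0 ?mulr0 ?mul0r ?invr0 ?mulr0|]; move: (g2^-1) (g5^-1) => i2 i5; field.
by rewrite Jm0 Jh0 y0.
Qed.

End Gfun.

(** * Holomorphy and behaviour at the cusps *)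
Section Analytic.
Variable R : realType.
Local Notation C := R[i].
Implicit Types (u z : C) (f g : C -> C).

Lemma locU_cst (c : C) u : locU (fun _ => c) u.
Proof. by exists 1; split=> //; exact: unif_cst. Qed.

Lemma locU_D f g u : locU f u -> locU g u -> locU (fun x => f x + g x) u.
Proof.
case=> r [r0 uf] [s [s0 ug]]; exists (Num.min r s); split; first by rewrite lt_min r0.
apply: unifD.
  by apply: unif_sub uf => x; rewrite /disc le_min => /andP[].
by apply: unif_sub ug => x; rewrite /disc le_min => /andP[].
Qed.

Lemma locU_X f n u : locU f u -> locU (fun x => f x ^+ n) u.
Proof.
move=> lf; elim: n => [|n IH]; first exact: locU_cst.
by apply: locU_ext (locU_M lf IH); exists 1; split=> // h _; rewrite exprS.
Qed.

Lemma locU_prod (I : Type) (r : seq I) (F : I -> C -> C) u : (forall i, locU (F i) u) ->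
  locU (fun x => \prod_(i <- r) F i x) u.
Proof.
move=> lF; elim: r => [|i r IH].
  by apply: locU_ext (locU_cst 1 u); exists 1; split=> // h _; rewrite big_nil.
by apply: locU_ext (locU_M (lF i) IH); exists 1; split=> // h _; rewrite big_cons.
Qed.

Lemma locU_sum (I : Type) (r : seq I) (F : I -> C -> C) u : (forall i, locU (F i) u) ->
  locU (fun x => \sum_(i <- r) F i x) u.
Proof.
move=> lF; elim: r => [|i r IH].
  by apply: locU_ext (locU_cst 0 u); exists 1; split=> // h _; rewrite big_nil.
by apply: locU_ext (locU_D (lF i) IH); exists 1; split=> // h _; rewrite big_cons.
Qed.

Lemma Im_ball z h : 0 < complex.Im z -> nrm h <= complex.Im z / 2 -> complex.Im z / 2 <= complex.Im (z + h).
Proof.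
move=> z0 hh; have := le_trans (Im_le_nrm h) hh; rewrite ler_norml => /andP[h1 _].
have -> : complex.Im (z + h) = complex.Im z + complex.Im h by case: z h {z0 hh h1} => a b [].
lra.
Qed.

Lemma locU_kl p X Y z : 0 < complex.Im z -> locU (kl p X Y) z.
Proof.
move=> z0; pose r := complex.Im z / 2; have r0 : 0 < r by rewrite /r; lra.
exists r; split=> //; have gb := @gid_bdd R r.
pose t := expR (- (2 * pi * r)).
have t01 : 0 <= t < 1 by rewrite expR_ge0 expR_lt1 oppr_lt0 !mulr_gt0 // pi_gt0.
have cst c : unif (disc r) (@gid R) (fun _ => c) by exact: unif_cst.
have lin (a b : C) : unif (disc r) (@gid R) (fun h => a * (z + h) + b).
  by apply: unifD => //; apply: (unifM gb) => //; apply: unifD => //; exact: unif_gen.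
have elin (a b : C) : unif (disc r) (@gid R) (fun h => ee (a * (z + h) + b)) by exact: unif_ee.
have qt h : disc r h -> nrm (ee (z + h)) <= t.
  move=> hh; rewrite nrm_ee ler_expR lerN2 ler_wpM2l ?mulr_ge0 ?pi_ge0 //; exact: Im_ball.
have uq : unif (disc r) (@gid R) (fun h => ee (z + h)).
  by apply: unif_ext (elin 1 0) => h _; rewrite mul1r addr0.
have t1 : t < 1 by case/andP: t01.
rewrite /kl /th /jt; apply: (unifM gb).
  apply: unif_ext (elin (X%:~R ^+ 2 / (2 * p%:R ^+ 2)) (X%:~R * Y%:~R / (2 * p%:R ^+ 2))) => h _.
  by congr ee; move: (_^-1) => i; ring.
apply: (unifM gb); last first.
  apply: unif_ext (unifX gb 2 (unif_pochV gb t01 qt t1 qt uq uq)) => h _; by rewrite exprVn.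
apply: (unifM gb).
  apply: (unifN gb); apply: unif_ext (elin (- X%:~R / p%:R / 2) (- Y%:~R / p%:R / 2)) => h _.
  by congr ee; move: (p%:R^-1) => i; ring.
have u1 (s : C) : unif (disc r) (@gid R) (fun h => ee (s * ((X%:~R * (z + h) + Y%:~R) / p%:R))).
  apply: unif_ext (elin (s * X%:~R / p%:R) (s * Y%:~R / p%:R)) => h _.
  by congr ee; move: (p%:R^-1) => i; ring.
apply: (unifM gb).
  by apply: (unif_poch gb t01 qt _ uq); apply: unif_ext (u1 1) => h _; rewrite mul1r.
apply: (unif_poch gb t01 qt _ uq); apply: (unifM gb) => //.
by apply: unif_ext (u1 (-1)) => h _; rewrite mulN1r eeN.
Qed.

(** Torsion points in the lattice are the only zeros, so Klein forms of vectors
    not divisible by p have no zeros in the upper half plane. *)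
Lemma kl_eq0 p (X Y : int) z : (0 < p)%N -> 0 < complex.Im z ->
  (kl p X Y z == 0) = ((p%:Z %| X) && (p%:Z %| Y))%Z.
Proof.
move=> p0 z0; have pn : p%:R != 0 :> C by rewrite pnatr_eq0 -lt0n.
rewrite /kl mulf_eq0 (negbTE (ee_neq0 _)) /=; apply/eqP/andP.
  move/(th_eq0 _ z0) => [m [n hmn]].
  have {}hmn : X%:~R * z + Y%:~R = (p%:Z * m)%:~R + (p%:Z * n)%:~R * z.
    rewrite -[LHS](divfK pn) hmn !intrM -![(p%:Z)%:~R]/(p%:R); ring.
  have e0 : (X - p%:Z * n)%:~R * z = (p%:Z * m - Y)%:~R.
    by rewrite !intrB mulrBl; move/eqP: hmn; rewrite -subr_eq0 => /eqP h; apply/eqP; rewrite -subr_eq0 -[X in _ == X]h; apply/eqP; ring.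
  have ic (k : int) : k%:~R = (k%:~R : R)%:C :> C by rewrite rmorph_int.
  have hX : X = p%:Z * n.
    apply/eqP; rewrite -subr_eq0 -(intr_eq0 R); move: e0; rewrite !ic; case: z z0 {hmn} => x y /= y0.
    by case=> _ /eqP; rewrite mul0r addr0 mulf_eq0 (gt_eqF y0) orbF.
  have hY : Y = p%:Z * m.
    apply/eqP; rewrite eq_sym -subr_eq0 -(intr_eq0 C) -e0 hX subrr mul0r eqxx //.
  by rewrite hX hY !dvdz_mulr.
case=> /dvdzP [n ->] /dvdzP [m ->]; apply/th_eq0 => //; exists m, n.
by rewrite !intrM -![(p%:Z)%:~R]/(p%:R); field; exact: pn.
Qed.

(** Without zeros, [locU_inv] applies; otherwise the Klein form vanishes
    identically and its inverse is the constant 0. *)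
Lemma locU_klV p X Y z : (0 < p)%N -> 0 < complex.Im z -> locU (fun z => (kl p X Y z)^-1) z.
Proof.
move=> p0 z0; have [h|h] := boolP (kl p X Y z == 0); last by apply: locU_inv => //; exact: locU_kl.
apply: locU_ext (locU_cst 0 z); exists (complex.Im z / 2); split=> [|w hw]; first by lra.
have w0 : 0 < complex.Im (z + w) by have := Im_ball z0 hw; lra.
by move: h; rewrite (kl_eq0 _ _ p0 z0) -(kl_eq0 _ _ p0 w0) => /eqP ->; rewrite invr0.
Qed.

Lemma locU_Gs p h mu s V1 V2 W1 W2 E1 E2 z : (0 < p)%N -> 0 < complex.Im z ->
  locU (Gs p h mu s V1 V2 W1 W2 E1 E2) z.
Proof.
move=> p0 z0; apply: locU_M; first apply: locU_M; first exact: locU_cst.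
- apply: locU_M; first by apply: locU_prod => i; exact: locU_kl.
  apply: locU_ext (locU_prod _ (F := fun i : 'I_h => fun z => (kl p (i.+1%:Z * W1) (i.+1%:Z * W2) z)^-1) _).
    by exists 1; split=> // x _; rewrite prodfV.
  by move=> i; exact: locU_klV.
apply: locU_M; first by apply: locU_M; apply: locU_X; exact: locU_kl.
apply: (locU_ext (f := fun z => (kl p (V1 - E1) (V2 - E2) z)^-1 * (kl p E1 E2 z)^-1 ^+ (2 * mu))).
  have e (A B : C) n : A^-1 * B^-1 ^+ n = (A * B ^+ n)^-1 by rewrite invfM exprVn.
  by exists 1; split=> // x _; rewrite e.
by apply: locU_M; [|apply: locU_X]; exact: locU_klV.
Qed.

(** The expansion of the local power series to second order. *)
Lemma locU_quad f z : locU f z -> exists (a : C) (d M : R), 0 < d /\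
  forall h, nrm h <= d -> nrm (f (z + h) - f z - a * h) <= M * nrm h ^+ 2.
Proof.
case=> r [r0 uf]; pose g x := f (z + r%:C * x).
have ug : discU g.
  move=> s /andP[s0 s1] e /uf [k [ak hk]]; exists (fun x => k (r%:C * x)); split.
    have [p hp] := alg_poly ak.
    elim: ak {hk hp} => [c|k' ->|k1 k2 _ a1 _ a2|k1 k2 _ a1 _ a2].
    - exact: alg_cst.
    - by apply: alg_mul; [exact: alg_cst | exact: alg_gen].
    - exact: alg_add.
    - exact: alg_mul.
  move=> x hx; apply: hk; rewrite /disc nrmM nrm_real gtr0_norm //.
  rewrite -[leRHS]mulr1 ler_wpM2l ?(ltW r0) //; exact: le_trans hx (ltW s1).
have [a [ga ha]] := ps_exists ug.
have [|M HM] := ga (1 / 2); first by apply/andP; split; lra.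
have M0 : 0 <= M by apply: le_trans (HM 0); rewrite mulr_ge0 ?nrm_ge0 ?exprn_ge0 //; lra.
have g0 : f z = a 0%N.
  have := ha 0; rewrite nrm0 ltr01 /g mulr0 addr0 => /(_ isT) c1.
  apply: clim_uniq c1 _; apply: (@clim_unaddn _ 1); apply: clim_ext (clim_cst (a 0%N)) => n.
  by rewrite addn1 big_ord_recl expr0 mulr1 big1 ?addr0 // => i _; rewrite expr0n mulr0.
have key x : nrm x <= 1 / 4 -> nrm (g x - g 0 - a 1%N * x) <= 8 * M * nrm x ^+ 2.
  move=> hx; have x1 : nrm x < 1 by lra.
  have c1 : clim (fun n => \sum_(i < n) a i.+2 * x ^+ i.+2) (g x - g 0 - a 1%N * x).
    have := clim_addn 2 (ha x x1); rewrite /g mulr0 addr0 g0 => c2.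
    apply: clim_ext (climB (climB c2 (clim_cst (a 0%N))) (clim_cst (a 1%N * x))) => n.
    by rewrite addn2 !big_ord_recl /= expr0 expr1 mulr1; ring.
  apply: (clim_nrm_le (N := 0) _ c1) => n _; apply: le_trans (nrm_sum _ _ _) _.
  apply: le_trans (_ : \sum_(i < n) (4 * M * nrm x ^+ 2) * (1 / 2) ^+ i <= _).
    apply: ler_sum => i _; rewrite nrmM nrmX.
    have hM := HM i.+2; have p2 : 0 < (1 / 2 : R) ^+ i.+2 by rewrite exprn_gt0 //; lra.
    have -> : nrm x ^+ i.+2 = nrm x ^+ 2 * nrm x ^+ i by rewrite -exprD.
    have h4 : nrm x ^+ i <= (1 / 4) ^+ i by rewrite lerXn2r ?nnegrE ?nrm_ge0 //; lra.
    have -> : 4 * M * nrm x ^+ 2 * (1 / 2) ^+ i = (M / (1 / 2) ^+ i.+2) * (nrm x ^+ 2 * (1 / 4) ^+ i).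
      have -> : (1 / 4 : R) = (1 / 2) * (1 / 2) by field.
      have y0 : (1 / 2 : R) ^+ i != 0 by rewrite expf_neq0 //; lra.
      rewrite (exprMn i (1 / 2) (1 / 2)) !(exprS (1 / 2)); move: ((1 / 2) ^+ i) y0 => y y0.
      by field.
    apply: ler_pM; rewrite ?nrm_ge0 ?mulr_ge0 ?exprn_ge0 ?nrm_ge0 //.
      by rewrite ler_pdivlMr.
    by rewrite ler_wpM2l // exprn_ge0 // nrm_ge0.
  rewrite -mulr_sumr; have hh : 0 <= (1 / 2 : R) < 1 by apply/andP; split; lra.
  have := geo_sum_le0 n hh; rewrite (_ : (1 - 1 / 2)^-1 = 2); last by field.
  have : 0 <= 4 * M * nrm x ^+ 2 by rewrite !mulr_ge0 ?exprn_ge0 ?nrm_ge0.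
  move=> v0 hs; apply: le_trans (ler_wpM2l v0 hs) _; rewrite le_eqVlt; apply/orP; left; apply/eqP; ring.
exists (a 1%N / r%:C), (r / 4), (8 * M / r ^+ 2); split; first by lra.
have rn : r%:C != 0 :> C by rewrite -nrm_gt0 nrm_real gtr0_norm.
move=> h hh; have := key (h / r%:C); rewrite nrmM nrmV nrm_real gtr0_norm //.
rewrite /g mulr0 addr0 [r%:C * _]mulrC divfK // => /(_ _).
have -> : a 1%N * (h / r%:C) = a 1%N / r%:C * h by field.
have -> : 8 * M * (nrm h / r) ^+ 2 = 8 * M / r ^+ 2 * nrm h ^+ 2 by field; rewrite gt_eqF.
by apply; rewrite ler_pdivrMr //; lra.
Qed.

Lemma locU_derivable f z : locU f z -> derivable (f : C^o -> C^o) z 1.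
Proof.
case/locU_quad => a [d [M [d0 H]]].
have M0 : 0 <= M.
  have dn : nrm (d%:C : C) = d by rewrite nrm_real gtr0_norm.
  have := H d%:C; rewrite dn lexx => /(_ isT) h; have := le_trans (nrm_ge0 _) h.
  by rewrite pmulr_lge0 // exprn_gt0.
apply: (cvgP (a : C^o)); apply/cvgrPdist_le => -[e e'] /=; rewrite ltcE /= => /andP[/eqP -> e0].
have b0 : 0 < Num.min d (e / (M + 1)) by rewrite lt_min d0 divr_gt0 //; lra.
rewrite /dnbhs /=; exists (Num.min d (e / (M + 1)))%:C => /=.
  by rewrite -(rmorph0 (real_complex R)) ltcR.
move=> h /= hh hn; rewrite -[e +i* 0]/(e%:C) normE lecR.
move: hh; rewrite sub0r normrN normE ltcR lt_min => /andP[h1 h2].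
have hz : h != 0 by [].
rewrite /GRing.scale /= mulr1 [h + z]addrC.
have -> : a - h^-1 * (f (z + h) - f z) = - (f (z + h) - f z - a * h) / h by field.
rewrite nrmM nrmN nrmV ler_pdivrMr ?nrm_gt0 //; apply: le_trans (H h (ltW h1)) _.
rewrite expr2 mulrA ler_wpM2r ?nrm_ge0 //; move: h2; rewrite ltr_pdivlMr; last by lra.
have := nrm_ge0 h; nra.
Qed.

(** Meromorphic at infinity as a function of e(z/D). *)
Definition cuspU (D : nat) f := exists (N : nat) (g : C -> C), discU g /\
  forall z, 0 < complex.Im z -> f z = ee (- (N%:R * z / D%:R)) * g (ee (z / D%:R)).

Lemma discU_M f g : discU f -> discU g -> discU (fun x => f x * g x).
Proof. by move=> uf ug r hr; apply: (unifM (@gid_bdd R r)); [exact: uf|exact: ug]. Qed.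
Lemma discU_D f g : discU f -> discU g -> discU (fun x => f x + g x).
Proof. by move=> uf ug r hr; apply: unifD; [exact: uf|exact: ug]. Qed.
Lemma discU_cst (c : C) : discU (fun _ => c).
Proof. by move=> r _; exact: unif_cst. Qed.
Lemma discU_id : discU (fun x : C => x).
Proof. by move=> r _; exact: unif_gen. Qed.
Lemma discU_X f n : discU f -> discU (fun x => f x ^+ n).
Proof. by move=> uf r hr; apply: (unifX (@gid_bdd R r)); exact: uf. Qed.

Lemma cuspU_M D f g : cuspU D f -> cuspU D g -> cuspU D (fun x => f x * g x).
Proof.
case=> N [f' [uf hf]] [M [g' [ug hg]]]; exists (N + M)%N, (fun x => f' x * g' x); split; first exact: discU_M.
move=> z z0; rewrite hf // hg //; have -> : - ((N + M)%:R * z / D%:R) = - (N%:R * z / D%:R) + - (M%:R * z / D%:R) :> C.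
  by rewrite natrD; ring.
by rewrite eeD mulrACA.
Qed.

Lemma cuspU_raise D f N M g : discU g -> (forall z, 0 < complex.Im z -> f z = ee (- (N%:R * z / D%:R)) * g (ee (z / D%:R))) ->
  (N <= M)%N -> exists g', discU g' /\ forall z, 0 < complex.Im z -> f z = ee (- (M%:R * z / D%:R)) * g' (ee (z / D%:R)).
Proof.
move=> ug hf NM; exists (fun x => x ^+ (M - N) * g x); split.
  by apply: discU_M => //; apply: discU_X; exact: discU_id.
move=> z z0; rewrite hf // mulrA; congr (_ * _); rewrite eeX -eeD; congr ee.
by rewrite natrB //; ring.
Qed.

Lemma cuspU_D D f g : cuspU D f -> cuspU D g -> cuspU D (fun x => f x + g x).
Proof.
case=> N [f' [uf hf]] [M [g' [ug hg]]].
have [f2 [uf2 hf2]] := cuspU_raise uf hf (leq_addr M N).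
have [g2 [ug2 hg2]] := cuspU_raise ug hg (leq_addl N M).
exists (N + M)%N, (fun x => f2 x + g2 x); split; first exact: discU_D.
by move=> z z0; rewrite hf2 // hg2 // mulrDr.
Qed.

Lemma cuspU_cst D c : cuspU D (fun _ => c).
Proof.
exists 0%N, (fun _ => c); split; first exact: discU_cst.
by move=> z _; rewrite mul0r mul0r oppr0 ee0 mul1r.
Qed.

Lemma cuspU_ext D f g : (forall z, 0 < complex.Im z -> f z = g z) -> cuspU D f -> cuspU D g.
Proof. by move=> fg [N [f' [uf hf]]]; exists N, f'; split=> // z z0; rewrite -fg // hf. Qed.

Lemma cuspU_X D f n : cuspU D f -> cuspU D (fun x => f x ^+ n).
Proof.
move=> cf; elim: n => [|n IH]; first exact: cuspU_cst.
by apply: cuspU_ext (cuspU_M cf IH) => z _; rewrite exprS.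
Qed.

Lemma cuspU_prod D (I : Type) (r : seq I) (F : I -> C -> C) : (forall i, cuspU D (F i)) ->
  cuspU D (fun x => \prod_(i <- r) F i x).
Proof.
move=> cF; elim: r => [|i r IH]; first by apply: cuspU_ext (cuspU_cst D 1) => z _; rewrite big_nil.
by apply: cuspU_ext (cuspU_M (cF i) IH) => z _; rewrite big_cons.
Qed.

Lemma cuspU_sum D (I : Type) (r : seq I) (F : I -> C -> C) : (forall i, cuspU D (F i)) ->
  cuspU D (fun x => \sum_(i <- r) F i x).
Proof.
move=> cF; elim: r => [|i r IH]; first by apply: cuspU_ext (cuspU_cst D 0) => z _; rewrite big_nil.
by apply: cuspU_ext (cuspU_D (cF i) IH) => z _; rewrite big_cons.
Qed.

Lemma sum_mult (L M : nat) (F : nat -> C) : (0 < L)%N -> (forall i, ~~ (L %| i)%N -> F i = 0) ->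
  \sum_(i < L * M) F i = \sum_(j < M) F (L * j)%N.
Proof.
move=> L0 F0; elim: M => [|M IH]; first by rewrite muln0 !big_ord0.
have h : (L * M <= L * M.+1)%N by rewrite leq_mul2l leqnSn orbT.
rewrite (sum_ord_split F h) IH big_ord_recr /= mulnSr addKn; congr (_ + _).
case: L L0 F0 {IH h} => // L _ F0; rewrite big_ord_recl addn0 big1 ?addr0 // => i _.
apply: F0; rewrite dvdn_addr ?dvdn_mulr //; apply/negP => /dvdn_leq.
by rewrite /= /bump /= add1n => /(_ isT); have := ltn_ord i; lia.
Qed.

Lemma sum_roots (L i : nat) (w : C) : L.-primitive_root w ->
  \sum_(l < L) w ^+ (l * i) = if (L %| i)%N then L%:R else 0.
Proof.
move=> pw; have -> : \sum_(l < L) w ^+ (l * i) = \sum_(l < L) (w ^+ i) ^+ l.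
  by apply: eq_bigr => l _; rewrite -exprM mulnC.
case: ifP => h; last first.
  apply: geo_root; first by rewrite -exprM mulnC exprM (prim_expr_order pw) expr1n.
  by rewrite -(expr0 w) (eq_prim_root_expr pw) mod0n -[_ == _]/(L %| i)%N h.
rewrite (eq_bigr (fun=> 1)) ?sumr_const ?card_ord // => l _.
by have /dvdnP [k ->] := h; rewrite mulnC exprM (prim_expr_order pw) !expr1n.
Qed.

(** Averaging the expansion in e(z/2p^2) over the translates of z by multiples of
    p kills all powers that are not powers of e(z/p).  The pole order is first
    raised to a multiple of 2p, so that the prefactor is itself such a power. *)
Lemma cuspU_mero p f : (0 < p)%N -> cuspU (2 * p ^ 2) f ->
  (forall z, 0 < complex.Im z -> f (z + p%:R) = f z) -> meromorphic_at_infinity p f.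
Proof.
move=> p0 [N0 [g0 [ug0 hg0]]] per; pose L := (2 * p)%N; have L0 : (0 < L)%N by rewrite /L; lia.
pose D := (2 * p ^ 2)%N; have pn : p%:R != 0 :> C by rewrite pnatr_eq0 -lt0n.
have DE : D%:R = 2 * p%:R ^+ 2 :> C by rewrite natrM natrX.
have [g [ug hg]] := cuspU_raise ug0 hg0 (leq_pmull N0 L0).
have {}hg z : 0 < complex.Im z -> f z = ee (- (N0%:R * z / p%:R)) * g (ee (z / D%:R)).
  move=> z0; rewrite hg //; congr (ee _ * _); rewrite -/D DE natrM /L natrM; field; exact: pn.
have [a [_ ha]] := ps_exists ug.
have pw := ee_prim R L0; set w := ee _ in pw.
exists (- N0%:Z)%R, (fun j => a (L * j)%N) => z z0; apply/climP.
have yl l : ee ((z + p%:R * l%:R) / D%:R) = ee (z / D%:R) * w ^+ l.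
  rewrite /w eeX -eeD; congr ee; rewrite DE /L natrM; field; exact: pn.
have zl l : 0 < complex.Im (z + p%:R * l%:R).
  have -> : complex.Im (z + p%:R * l%:R) = complex.Im z; last by [].
  by rewrite -natrM (rt_natE R); case: (z) => x y; rewrite /= addr0.
have fl l : f (z + p%:R * l%:R) = f z.
  elim: l => [|l IH]; first by rewrite mulr0 addr0.
  by rewrite -IH -(per (z + p%:R * l%:R)) //; congr f; rewrite -natr1; ring.
have y1 l : nrm (ee (z / D%:R) * w ^+ l) < 1.
  rewrite -yl; apply: nrm_ee_lt1; rewrite (rt_natE R D).
  have D0 : 0 < D%:R :> R by rewrite ltr0n /D; nia.
  rewrite -fmorphV; have -> : complex.Im ((z + p%:R * l%:R) * (D%:R^-1)%:C) = complex.Im (z + p%:R * l%:R) / D%:R.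
    by case: (z + _) => x y /=; ring.
  by rewrite divr_gt0.
have gl l : g (ee (z / D%:R) * w ^+ l) = ee (N0%:R * z / p%:R) * f z.
  rewrite -(fl l) hg // yl mulrA -eeD.
  have -> : N0%:R * z / p%:R + - (N0%:R * (z + p%:R * l%:R) / p%:R) = 0 + (- (N0 * l)%N%:Z)%:~R :> C.
    by rewrite mulrNz -[(_ %:Z)%:~R]/((N0 * l)%:R) natrM; field; exact: pn.
  by rewrite eeDint ee0 mul1r.
have c1 : clim (fun n => L%:R^-1 * \sum_(l < L) \sum_(i < n) a i * (ee (z / D%:R) * w ^+ l) ^+ i) (ee (N0%:R * z / p%:R) * f z).
  have Ln : L%:R != 0 :> C by rewrite pnatr_eq0 -lt0n.
  have -> : ee (N0%:R * z / p%:R) * f z = L%:R^-1 * \sum_(l < L) g (ee (z / D%:R) * w ^+ l).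
    under eq_bigr => l _ do rewrite gl.
    by rewrite sumr_const card_ord -[X in _ = _ * X]mulr_natl mulKf.
  by apply: climZ; apply: clim_sum => l; exact: ha.
have c2 : clim (fun M => \sum_(j < M) a (L * j)%N * qexp p z ^+ j) (ee (N0%:R * z / p%:R) * f z).
  have c3 := clim_sub (f := fun M => (L * M)%N) _ c1.
  apply: clim_ext (c3 _) => [M|N]; last by exists N => n hn; apply: leq_trans hn (leq_pmull _ L0).
  rewrite exchange_big /= mulr_sumr.
  have -> : \sum_(i < L * M) L%:R^-1 * (\sum_(l < L) a i * (ee (z / D%:R) * w ^+ l) ^+ i) =
     \sum_(i < L * M) (if (L %| i)%N then a i * ee (z / D%:R) ^+ i else 0).
    apply: eq_bigr => i _.
    have -> : \sum_(l < L) a i * (ee (z / D%:R) * w ^+ l) ^+ i = a i * ee (z / D%:R) ^+ i * \sum_(l < L) w ^+ (l * i).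
      by rewrite mulr_sumr; apply: eq_bigr => l _; rewrite exprMn -exprM mulrA.
    rewrite sum_roots //; case: ifP => _; last by rewrite !mulr0.
    by rewrite mulrCA mulVf ?mulr1 // pnatr_eq0 -lt0n.
  rewrite (sum_mult M (F := fun i => if (L %| i)%N then a i * ee (z / D%:R) ^+ i else 0) L0) => [|i /negbTE -> //].
  apply: eq_bigr => j _; rewrite dvdn_mulr //; congr (_ * _).
  have -> : qexp p z = ee (z / p%:R) by rewrite /qexp /ee mulrA.
  rewrite exprM eeX; congr (ee _ ^+ _); rewrite DE /L natrM; field; exact: pn.
have c4 := climZ (ee (- (N0%:R * z / p%:R))) c2; rewrite mulrA -eeD addNr ee0 mul1r in c4.
apply: clim_ext c4 => M; rewrite big_mkord mulr_sumr; apply: eq_bigr => j _.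
have -> : qexp p z = ee (z / p%:R) by rewrite /qexp /ee mulrA.
rewrite mulrCA; congr (_ * _); rewrite expfzDr ?ee_neq0 // eeXz; congr (ee _ * _).
by rewrite mulrNz -[(N0%:Z)%:~R]/(N0%:R); ring.
Qed.

Lemma discU_poch (k e : nat) (c : C) : (0 < e)%N -> discU (fun y : C => poch (c * y ^+ k) (y ^+ e)).
Proof.
move=> e0 r /andP[r0 r1]; have gb := @gid_bdd R r.
have uid : unif (disc r) (@gid R) (fun y => y) by exact: unif_gen.
apply: (unif_poch gb (t := r ^+ e)).
- by rewrite exprn_ge0 ?(ltW r0) //= exprn_ilt1 ?ltW // -lt0n.
- by move=> x hx; rewrite nrmX lerXn2r ?nnegrE ?nrm_ge0 // ltW.
- by apply: (unifM gb); [exact: unif_cst | exact: unifX].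
exact: unifX.
Qed.

Lemma discU_pochV (k e : nat) (c : C) : (0 < e)%N -> (0 < k)%N -> nrm c = 1 ->
  discU (fun y : C => (poch (c * y ^+ k) (y ^+ e))^-1).
Proof.
move=> e0 k0 c1 r /andP[r0 r1]; have gb := @gid_bdd R r.
have uid : unif (disc r) (@gid R) (fun y => y) by exact: unif_gen.
have le x n : disc r x -> (0 < n)%N -> nrm (x ^+ n) <= r ^+ n.
  by move=> hx n0; rewrite nrmX lerXn2r ?nnegrE ?nrm_ge0 // ltW.
apply: (unif_pochV gb (t := r ^+ e) (th := r ^+ k)).
- by rewrite exprn_ge0 ?(ltW r0) //= exprn_ilt1 ?ltW // -lt0n.
- by move=> x hx; exact: le.
- by rewrite exprn_ilt1 ?ltW // -lt0n.
- by move=> x hx; rewrite nrmM c1 mul1r; exact: le.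
- by apply: (unifM gb); [exact: unif_cst | exact: unifX].
exact: unifX.
Qed.

Lemma nrm_ee_int_div (Y : int) (p : nat) : nrm (ee (Y%:~R / p%:R) : C) = 1.
Proof.
have ic (k : int) : k%:~R = (k%:~R : R)%:C :> C by rewrite rmorph_int.
rewrite ic (rt_natE R) -fmorphV -rmorphM nrm_ee /= mulr0 oppr0 expR0 //.
Qed.

(** The power series in y = e(z/2p^2) by which [kl_prod] expresses a Klein form
    whose first index x lies between 0 and p. *)
Definition klg p x (c0 c : C) y := c0 * (poch (c * y ^+ (2 * p * x)) (y ^+ (2 * p ^ 2)) *
  poch (c^-1 * y ^+ (2 * p * (p - x))) (y ^+ (2 * p ^ 2)) / poch (1 * y ^+ (2 * p ^ 2)) (y ^+ (2 * p ^ 2)) ^+ 2).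

Lemma kl_prod p (x : nat) (Y : int) z : (0 < p)%N -> (x < p)%N ->
  kl p x%:Z Y z = ee (- ((p * x - x * x)%N%:R * z / (2 * p ^ 2)%:R)) *
    klg p x (- ee (x%:R * Y%:~R / (2 * p%:R ^+ 2) - Y%:~R / (2 * p%:R))) (ee (Y%:~R / p%:R)) (ee (z / (2 * p ^ 2)%:R)).
Proof.
move=> p0 xp; have pn : p%:R != 0 :> C by rewrite pnatr_eq0 -lt0n.
have hD : (2 * p ^ 2)%:R = 2 * p%:R ^+ 2 :> C by rewrite natrM natrX.
rewrite /klg; have -> : ee (z / (2 * p ^ 2)%:R) ^+ (2 * p ^ 2) = ee z.
  by rewrite eeX hD; congr ee; field; exact: pn.
have -> : ee (Y%:~R / p%:R) * ee (z / (2 * p ^ 2)%:R) ^+ (2 * p * x) = ee ((x%:R * z + Y%:~R) / p%:R).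
  by rewrite eeX -eeD hD !natrM; congr ee; field; exact: pn.
have -> : (ee (Y%:~R / p%:R))^-1 * ee (z / (2 * p ^ 2)%:R) ^+ (2 * p * (p - x)) = ee z / ee ((x%:R * z + Y%:~R) / p%:R).
  by rewrite eeX -!eeN -!eeD hD !natrM natrB ?(ltnW xp) //; congr ee; field; exact: pn.
rewrite mul1r /kl /th /jt -[(x%:Z)%:~R]/(x%:R); set u := (_ + _) / p%:R.
have : ee (- ((p * x - x * x)%N%:R * z / (2 * p ^ 2)%:R)) * ee (x%:R * Y%:~R / (2 * p%:R ^+ 2) - Y%:~R / (2 * p%:R)) =
  ee (x%:R * (x%:R * z + Y%:~R) / (2 * p%:R ^+ 2)) * ee (- u / 2) :> C.
  rewrite -!eeD hD natrB ?leq_mul2r ?(ltnW xp) ?orbT // !natrM /u; congr ee; field; exact: pn.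
move: (poch _ _) (poch _ _) (poch _ _) => P1 P2 P3; rewrite !mulNr !mulrN !mulrA => ->.
by [].
Qed.

(** Shifting X by a multiple of p changes a Klein form by a constant.  [P] stands
    for the identity or the inverse, which both respect constant factors. *)
Lemma cuspU_kl_reduce p (P : (C -> C) -> C -> C) : (0 < p)%N ->
  (forall f c z, P (fun z => c * f z) z = P (fun _ => c) z * P f z) ->
  (forall f g z, f z = g z -> P f z = P g z) ->
  (forall c, cuspU (2 * p ^ 2) (P (fun _ => c))) ->
  (forall (x : nat) Y, (x < p)%N -> cuspU (2 * p ^ 2) (P (kl p x%:Z Y))) ->
  forall X Y, cuspU (2 * p ^ 2) (P (kl p X Y)).
Proof.
move=> p0 PM Pext Pc Px X Y.
have pz : p%:Z != 0 by rewrite -lt0n in p0 *; apply/eqP; lia.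
have [x hx xp] : exists2 x : nat, (X %% p%:Z)%Z = x%:Z & (x < p)%N.
  have h1 := modz_ge0 X pz; have h2 := ltz_pmod X (_ : 0 < p%:Z).
  exists (absz (X %% p%:Z)%Z); lia.
have hX : X = x%:Z + p%:Z * (X %/ p%:Z)%Z by rewrite -hx {1}(divz_eq X p%:Z); ring.
apply: cuspU_ext (cuspU_M (Pc _) (Px x Y xp)) => z z0.
rewrite -PM; apply: Pext.
by rewrite {2}hX -[Y in RHS]addr0 -(mulr0 p%:Z) (kl_shift (X %/ p%:Z)%Z 0 x%:Z Y p0 z0).
Qed.

Lemma cuspU_kl p X Y : (0 < p)%N -> cuspU (2 * p ^ 2) (kl p X Y).
Proof.
move=> p0; apply: (cuspU_kl_reduce (P := fun f => f)) => //; first by move=> c; exact: cuspU_cst.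
move=> x {}Y xp; have e0 : (0 < 2 * p ^ 2)%N by nia.
exists (p * x - x * x)%N; exists (klg p x (- ee (x%:R * Y%:~R / (2 * p%:R ^+ 2) - Y%:~R / (2 * p%:R))) (ee (Y%:~R / p%:R))).
split; last by move=> z z0; exact: kl_prod.
apply: discU_M; first exact: discU_cst.
apply: discU_M; first by apply: discU_M; exact: discU_poch.
have h := discU_X 2 (discU_pochV e0 e0 (nrm1 R)).
by move=> r hr; apply: unif_ext (h r hr) => y _; rewrite exprVn.
Qed.

Lemma discU_ext f g : (forall y, nrm y < 1 -> f y = g y) -> discU f -> discU g.
Proof.
move=> fg uf r hr; apply: unif_ext (uf r hr) => y; rewrite /disc => hy; apply: fg.
by apply: le_lt_trans hy _; case/andP: hr.
Qed.

(** For x = 0 the leading factor is the constant 1 - c.  It may vanish, but only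
    when the whole function vanishes. *)
Lemma discU_klgV p x (c0 c : C) : (0 < p)%N -> (x < p)%N -> nrm c = 1 -> discU (fun y => (klg p x c0 c y)^-1).
Proof.
move=> p0 xp nc; have e0 : (0 < 2 * p ^ 2)%N by nia.
have e1 : (0 < 2 * p * (p - x))%N by rewrite !muln_gt0 p0 subn_gt0 xp.
have ncV : nrm (c^-1) = 1 by rewrite nrmV nc invr1.
pose P1 y := (poch (c * y ^+ (2 * p * x)) (y ^+ (2 * p ^ 2)))^-1.
have d1 : discU P1.
  case: x xp e1 @P1 => [|x] xp e1 P1; last by apply: discU_pochV => //; nia.
  apply: discU_ext (discU_M (discU_cst (1 - c)^-1) (discU_pochV e0 e0 nc)) => y y1.
  rewrite /P1 muln0 expr0 mulr1 (poch_rec c) ?invfM //.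
  by rewrite nrmX exprn_ilt1 ?nrm_ge0 // ?(ltW y1) // -lt0n.
have := discU_M (discU_M (discU_cst c0^-1) d1) (discU_M (discU_pochV e0 e1 ncV) (discU_X 2 (discU_poch (2 * p ^ 2) 1 e0))).
by apply: discU_ext => y _; rewrite /klg !invfM invrK /P1 !mulrA.
Qed.

Lemma cuspU_klV p X Y : (0 < p)%N -> cuspU (2 * p ^ 2) (fun z => (kl p X Y z)^-1).
Proof.
move=> p0; apply: (cuspU_kl_reduce (P := fun f z => (f z)^-1)) => // [f c z|f g z ->|c|x {}Y xp] //.
- by rewrite invfM.
- exact: cuspU_cst.
exists 0%N, (fun y => y ^+ (p * x - x * x) * (klg p x (- ee (x%:R * Y%:~R / (2 * p%:R ^+ 2) - Y%:~R / (2 * p%:R))) (ee (Y%:~R / p%:R)) y)^-1).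
split; first by apply: discU_M; [apply: discU_X; exact: discU_id | apply: discU_klgV => //; exact: nrm_ee_int_div].
move=> z z0; rewrite kl_prod // mul0r mul0r oppr0 ee0 mul1r (invfM (ee _)) -eeN opprK eeX; congr (ee _ * _).
by rewrite mulrA.
Qed.

Lemma cuspU_Gs p h mu s V1 V2 W1 W2 E1 E2 : (0 < p)%N -> cuspU (2 * p ^ 2) (Gs p h mu s V1 V2 W1 W2 E1 E2).
Proof.
move=> p0; apply: cuspU_M; first apply: cuspU_M; first exact: cuspU_cst.
- apply: cuspU_M; first by apply: cuspU_prod => i; exact: cuspU_kl.
  apply: cuspU_ext (cuspU_prod _ (F := fun i : 'I_h => fun z => (kl p (i.+1%:Z * W1) (i.+1%:Z * W2) z)^-1) _).
    by move=> z _; rewrite prodfV.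
  by move=> i; exact: cuspU_klV.
apply: cuspU_M; first by apply: cuspU_M; apply: cuspU_X; exact: cuspU_kl.
apply: (cuspU_ext (f := fun z => (kl p (V1 - E1) (V2 - E2) z)^-1 * (kl p E1 E2 z)^-1 ^+ (2 * mu))).
  have e (A B : C) n : A^-1 * B^-1 ^+ n = (A * B ^+ n)^-1 by rewrite invfM exprVn.
  by move=> z _; rewrite e.
by apply: cuspU_M; [|apply: cuspU_X]; exact: cuspU_klV.
Qed.

End Analytic.

(** * The rank function as a sum of quotients of Klein forms *)
Lemma ceil_divP m d n : (0 < d)%N -> (ceil_div m d <= n)%N = (m <= d * n)%N.
Proof.
move=> d0; have dq : 0 < d%:R :> rat by rewrite ltr0n.
have c0 : 0 <= Num.ceil (m%:R / d%:R : rat) by rewrite ceil_ge0 (lt_le_trans (ltrN10 _)) // divr_ge0.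
rewrite /ceil_div -lez_nat gez0_abs // -(ler_int rat) ?ceil_le_int.
rewrite ler_int ceil_le_int ler_pdivrMr // -[(n%:Z)%:~R]/(n%:R) -natrM ler_nat mulnC //.
Qed.

Section FE.
Variables (R : realType) (p : nat).
Hypotheses (pp : prime p) (p3 : (3 < p)%N).
Local Notation C := R[i].
Implicit Types (z : C).
Let w : C := ee (p%:R^-1).
Let s := sp p.

Definition Ff z : C := let q := qexp 1 z in
       infinite_prod 1 (fun n => 1 - q ^+ (p * n)) *
       infinite_sum (ceil_div (sp p) p) (fun n =>
         (\sum_(0 <= k < p)
            (rank_count k p (p * n - sp p))%:R * zeta R p ^+ k) * q ^+ n).

Let p0 : (0 < p)%N. Proof. lia. Qed.
Let pn : p%:R != 0 :> C. Proof. by rewrite pnatr_eq0 -lt0n. Qed.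
Let pw : p.-primitive_root w. Proof. exact: ee_prim. Qed.

Lemma qexp1 z : qexp 1 z = ee z.
Proof. by rewrite /qexp /ee divr1. Qed.
Lemma Im_div z : 0 < complex.Im z -> 0 < complex.Im (z / p%:R).
Proof.
move=> z0; rewrite (rt_natE R) -fmorphV; have -> : complex.Im (z * (p%:R^-1)%:C) = complex.Im z / p%:R.
  by case: z z0 => x y /= _; ring.
by rewrite divr_gt0 // ltr0n.
Qed.

Lemma prod_gf z : 0 < complex.Im z ->
  infinite_prod 1 (fun n => 1 - ee z ^+ (p * n)) = poch (ee z ^+ p) (ee z ^+ p).
Proof.
move=> z0; have q1 : nrm (ee z ^+ p) < 1 by rewrite nrmX exprn_ilt1 ?nrm_ge0 ?(ltW (nrm_ee_lt1 z0)) ?nrm_ee_lt1 // -lt0n.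
apply: clim_lim; apply: (@clim_unaddn _ 1); apply: clim_ext (poch_clim (ee z ^+ p) q1) => n.
by rewrite addn1 big_add1 /= big_mkord /pochn; apply: eq_bigr => i _; rewrite exprM exprS.
Qed.

(** Substituting N = p n - s; the ceiling makes the truncated difference p n - s
    an honest one. *)
Lemma sum_class (rcf : nat -> C) (x : C) M : (ceil_div s p <= M)%N ->
  \sum_(N < p * M - s) (if (p %| N + s)%N then rcf N * x ^+ (N + s) else 0) =
  \sum_(ceil_div s p <= n < M) rcf (p * n - s)%N * (x ^+ p) ^+ n.
Proof.
move=> cM; rewrite -(subnKC cM); move: (M - _)%N => d {cM M}.
have sc d' : (s <= p * (ceil_div s p + d'))%N by rewrite -ceil_divP // leq_addr.
elim: d => [|d IH].
  rewrite addn0 big_geq // big1 // => N _; case: ifP => // /dvdnP [k hk].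
  have := ltn_ord N; rewrite ltn_subRL addnC hk mulnC ltn_pmul2l // ltnNge ceil_divP //.
  by rewrite mulnC -hk leq_addl.
rewrite addnS.
have -> : (p * (ceil_div s p + d).+1 - s = (p * (ceil_div s p + d) - s) + p)%N.
  by rewrite mulnS; have := sc d; lia.
rewrite big_split_ord /= IH big_nat_recr ?leq_addr //=; congr (_ + _).
have := sc d; move: (ceil_div s p + d)%N => M hM; rewrite (bigD1 (Ordinal p0)) //= big1 => [|i hi].
  by rewrite !addn0 subnK // dvdn_mulr // exprM addr0.
rewrite addnAC subnK // dvdn_addr ?dvdn_mulr // ifN //; apply: contra hi => h.
have [i0|i0] := posnP i; first exact/eqP/val_inj.
by have := dvdn_leq i0 h; have := ltn_ord i; lia.
Qed.

(** The mean over j of (e(z/p) w^j)^(N+s) is e(z/p)^(N+s) if p divides N + s, and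
    0 otherwise. *)
Lemma sum_gf z : 0 < complex.Im z ->
  infinite_sum (ceil_div s p) (fun n =>
         (\sum_(0 <= k < p) (rank_count k p (p * n - s))%:R * w ^+ k) * ee z ^+ n) =
  (1 - w) / p%:R * \sum_(j < p) dcoef p (ee (z / p%:R)) w j * Ap w (ee (z / p%:R) * w ^+ j).
Proof.
move=> z0; set x := ee (z / p%:R); have xp : x ^+ p = ee z by rewrite eeX mulrC divfK.
have nw := prim_nrm pw; have x1 : nrm x < 1 by apply: nrm_ee_lt1; exact: Im_div.
have x0 : x != 0 by exact: ee_neq0.
have wn1 : w != 1 by rewrite -[w]expr1 -(expr0 w) (eq_prim_root_expr pw) !modn_small //; lia.
have w0 : w != 0 by exact: ee_neq0.
have yj j : nrm (x * w ^+ j) < 1 by rewrite nrmM nrmX nw expr1n mulr1.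
have y0 j : x * w ^+ j != 0 by rewrite mulf_neq0 // expf_neq0.
have py j : poch (x * w ^+ j) (x * w ^+ j) != 0.
  apply: poch_neq0 => // n; rewrite -exprS; apply/eqP => /(congr1 (fun x => nrm x)).
  by rewrite nrmX nrm1 => /eqP; rewrite pexpr_eq1 ?nrm_ge0 // lt_eqF.
have -> : (1 - w) / p%:R * \sum_(j < p) dcoef p x w j * Ap w (x * w ^+ j) =
   p%:R^-1 * \sum_(j < p) (x * w ^+ j) ^+ s * psum (rc w) (x * w ^+ j).
  rewrite !mulr_sumr; apply: eq_bigr => j _.
  rewrite -[psum _ _](mulfK (py j)) rank_gf // /dcoef; move: (poch _ _) (Ap _ _) => P A.
  by rewrite -!mulrA; move: (p%:R^-1) (P^-1) => i1 i2; ring.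
apply: clim_lim; have c1 : clim (fun K => p%:R^-1 * \sum_(j < p) (x * w ^+ j) ^+ s * \sum_(N < K) rc w N * (x * w ^+ j) ^+ N)
    (p%:R^-1 * \sum_(j < p) (x * w ^+ j) ^+ s * psum (rc w) (x * w ^+ j)).
  apply: climZ; apply: clim_sum => j; apply: climZ; apply: psum_clim; [exact: yj | exact: gro_rc].
have c2 := clim_sub (f := fun M => (p * M - s)%N) _ c1.
apply: (clim_near (N := ceil_div s p) _ (c2 _)) => [M cM|N]; last first.
  by exists (N + s)%N => n hn; nia.
have -> : \sum_(ceil_div s p <= n < M) (\sum_(0 <= k < p) (rank_count k p (p * n - s))%:R * w ^+ k) * ee z ^+ n =
   \sum_(ceil_div s p <= n < M) rc w (p * n - s)%N * (x ^+ p) ^+ n.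
  by apply: eq_bigr => n _; rewrite rank_count_sum // ?(prim_expr_order pw) // xp.
rewrite -sum_class //.
transitivity (p%:R^-1 * \sum_(N < p * M - s) rc w N * x ^+ (N + s) * \sum_(j < p) w ^+ (j * (N + s))).
  congr (_ * _); under eq_bigr => j _ do rewrite mulr_sumr.
  rewrite exchange_big /=; apply: eq_bigr => N _; rewrite mulr_sumr; apply: eq_bigr => j _.
  by rewrite mulrCA -exprD addnC exprMn -exprM mulrA.
rewrite mulr_sumr; apply: eq_bigr => N _; rewrite sum_roots //; case: ifP => _; last by rewrite !mulr0.
by rewrite mulrCA mulVf ?mulr1.
Qed.

Lemma Ff_Ap z : 0 < complex.Im z -> Ff z = poch (ee z ^+ p) (ee z ^+ p) *
  ((1 - w) / p%:R * \sum_(j < p) dcoef p (ee (z / p%:R)) w j * Ap w (ee (z / p%:R) * w ^+ j)).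
Proof. by move=> z0; rewrite /Ff qexp1 -sum_gf // -prod_gf. Qed.

Lemma jt_kl (X Y : int) z : 0 < complex.Im z ->
  jt (ee ((X%:~R * z + Y%:~R) / p%:R)) (ee z) = - poch (ee z) (ee z) ^+ 2 *
    ee ((X%:~R * z + Y%:~R) / (2 * p%:R) * (1 - X%:~R / p%:R)) * kl p X Y z.
Proof.
move=> z0; rewrite /kl /th; set u := (_ / p%:R).
have : ee ((X%:~R * z + Y%:~R) / (2 * p%:R) * (1 - X%:~R / p%:R)) * ee (X%:~R * (X%:~R * z + Y%:~R) / (2 * p%:R ^+ 2)) * ee (- u / 2) = 1 :> C.
  by rewrite -!eeD -[RHS]ee0; congr ee; rewrite /u; field; exact: pn.
have hp := poch_ee z0; move: (ee _) (ee _) (ee _) (jt _ _) (poch _ _) hp => a b d J P P0 e.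
by transitivity (d * b * a * J); [rewrite e mul1r | field; exact: P0].
Qed.

Lemma prod_fold (G : nat -> C) h : \prod_(k < 2 * h) G k = \prod_(i < h) (G i * G (2 * h - i.+1)%N).
Proof.
rewrite mul2n -addnn big_split_ord big_split /=; congr (_ * _).
rewrite (reindex_inj rev_ord_inj) /=; apply: eq_bigr => i _; congr G.
by have := ltn_ord i; lia.
Qed.

Variables (h mu : nat).
Hypothesis hp : p = (2 * h + 1)%N.
Hypothesis hmu : mu = (3 * h + 2)%N.
Let hs : (24 * s + 1 = p ^ 2)%N := sp24 pp p3.
Let eta z : C := poch (ee z) (ee z) ^+ 2.
Let xz z : C := ee (z / p%:R).
Let yz z (j : nat) : C := xz z * w ^+ j.

Let yzE z j : yz z j = ee ((z + j%:R) / p%:R).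
Proof. by rewrite /yz /xz /w eeX -eeD; congr ee; field; exact: pn. Qed.
Let yzp z j : yz z j ^+ p = ee z.
Proof.
rewrite yzE eeX (_ : _ * _ = z + (j%:Z)%:~R) ?eeDint // -[(j%:Z)%:~R]/(j%:R).
by field; exact: pn.
Qed.
Let yz1 z j : 0 < complex.Im z -> nrm (yz z j) < 1.
Proof.
by move=> z0; rewrite nrmM nrmX (prim_nrm pw) expr1n mulr1 nrm_ee_lt1 // Im_div.
Qed.

Lemma poch_yz z j : 0 < complex.Im z -> poch (yz z j) (yz z j) != 0.
Proof.
move=> z0; apply: poch_neq0 => [|n]; first exact: yz1.
rewrite -exprS; apply/eqP => /(congr1 (fun x => nrm x)).
by rewrite nrmX nrm1 => /eqP; rewrite pexpr_eq1 ?nrm_ge0 // lt_eqF // yz1.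
Qed.

(** With y = e((z+j)/p) and y^p = e(z), split the exponents in (y;y) modulo p and
    pair the classes i and p - i. *)
Lemma prod_jt_W z j : 0 < complex.Im z ->
  \prod_(i < h) jt (yz z j ^+ i.+1) (ee z) * poch (ee z) (ee z) = poch (yz z j) (yz z j).
Proof.
move=> z0; rewrite (poch_res _ (yz1 j z0) p0) yzp.
have y0 : yz z j != 0 by rewrite yzE ee_neq0.
rewrite [in RHS]hp addn1 big_ord_recr /= -exprS (_ : (2 * h).+1 = p); last by rewrite hp addn1.
rewrite yzp; congr (_ * _); rewrite (prod_fold (fun k => poch (yz z j * yz z j ^+ k) (ee z))).
apply: eq_bigr => i _.
have e : ee z / yz z j ^+ i.+1 = yz z j ^+ (2 * h - i.+1).+1.
  apply: (mulIf (expf_neq0 i.+1 y0)); rewrite divfK ?expf_neq0 // -exprD -(yzp z j).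
  by have -> : ((2 * h - i.+1).+1 + i.+1 = p)%N by rewrite hp; have := ltn_ord i; clear; lia.
by rewrite /jt e !exprS.
Qed.

(** The right side does not depend on j.  The power s of y is exactly what the
    prefactors of the h Klein forms produce, by [sum1_half]. *)
Lemma dcoef_klp z j : 0 < complex.Im z ->
  dcoef p (xz z) w j * klp p h 1 j%:Z z = ((- eta z) ^+ h * poch (ee z) (ee z))^-1.
Proof.
move=> z0; have P0 := poch_yz j z0; have q0 := poch_ee z0.
have e0 : (- eta z) ^+ h != 0 by rewrite expf_neq0 // oppr_eq0 expf_neq0.
have [s1 s2] := sum1_half hp hs.
have key : \prod_(i < h) jt (yz z j ^+ i.+1) (ee z) = (- eta z) ^+ h * (yz z j ^+ s * klp p h 1 j%:Z z).
  have -> : yz z j ^+ s = \prod_(i < h) ee ((i.+1%:R * z + i.+1%:R * j%:R) / (2 * p%:R) * (1 - i.+1%:R / p%:R)).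
    rewrite (prod_ee h (fun i => (i.+1%:R * z + i.+1%:R * j%:R) / (2 * p%:R) * (1 - i.+1%:R / p%:R))) yzE eeX; congr ee.
    transitivity ((\sum_(i < h) i.+1)%N%:R * ((z + j%:R) / (2 * p%:R)) - (\sum_(i < h) i.+1 ^ 2)%N%:R * ((z + j%:R) / (2 * p%:R ^+ 2)) : C).
      by rewrite s1 s2 !natrM; field; exact: pn.
    rewrite !natr_sum !mulr_suml -sumrB; apply: eq_bigr => i _; rewrite natrX; field; exact: pn.
  rewrite /klp -[h in (- eta z) ^+ h](card_ord h) -prodr_const -!big_split; apply: eq_bigr => i _ /=.
  have -> : yz z j ^+ i.+1 = ee (((i.+1%:Z * 1)%:~R * z + (i.+1%:Z * j%:Z)%:~R) / p%:R).
    by rewrite yzE eeX mulr1 intrM -![(Posz _)%:~R]/(_%:R); congr ee; field; exact: pn.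
  rewrite jt_kl // !mulr1 intrM -![(Posz _)%:~R]/(_%:R) -mulrA; congr (_ * (ee _ * _)).
have e1 := prod_jt_W j z0; rewrite key in e1.
rewrite /dcoef -/(yz z j) -e1; apply: (mulIf (mulf_neq0 e0 q0)); rewrite mulVf ?mulf_neq0 //.
have : yz z j ^+ s * klp p h 1 j%:Z z != 0.
  by apply: contraNneq P0 => e2; rewrite -e1 e2 mulr0 mul0r.
rewrite mulf_eq0 negb_or => /andP[n1 n2].
by rewrite -/s; field; rewrite ?n1 ?n2 ?e0 ?q0.
Qed.

(** The constant relating [klp p h 0 1] to the factor (q^p;q^p) of the theorem. *)
Definition kappa : C := \prod_(i < h) ((1 - w ^+ i.+1) / ee (i.+1%:R / (2 * p%:R))).

(** Multiplying over all p-th roots of unity turns the factors 1 - w^i q^n into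
    1 - q^(pn), by [poch_prim]. *)
Lemma klp_E z : 0 < complex.Im z ->
  (- eta z) ^+ h * klp p h 0 1 z * poch (ee z) (ee z) = kappa * poch (ee z ^+ p) (ee z ^+ p).
Proof.
move=> z0; have q1 := nrm_ee_lt1 z0; rewrite -(poch_prim (ee z) q1 pw).
have w0 : w != 0 by exact: ee_neq0.
have -> : \prod_(k < p) poch (ee z * w ^+ k) (ee z) = poch (ee z) (ee z) * \prod_(k < 2 * h) poch (ee z * w ^+ k.+1) (ee z).
  have big (F : nat -> C) : \prod_(k < p) F k = F 0 * \prod_(k < 2 * h) F k.+1 by rewrite hp addn1 big_ord_recl.
  by rewrite (big (fun k => poch (ee z * w ^+ k) (ee z))) expr0 mulr1.
rewrite mulrC [RHS]mulrCA; congr (_ * _).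
rewrite (prod_fold (fun k => poch (ee z * w ^+ k.+1) (ee z))) /kappa -big_split /klp.
rewrite -[h in (- eta z) ^+ h](card_ord h) -prodr_const -big_split; apply: eq_bigr => i _ /=.
have e1 : w ^+ i.+1 = ee (((i.+1%:Z * 0)%:~R * z + (i.+1%:Z * 1)%:~R) / p%:R).
  by rewrite eeX mulr0 mulr1 mul0r add0r.
have := jt_kl (i.+1%:Z * 0) (i.+1%:Z * 1) z0; rewrite -e1.
have -> : ((i.+1%:Z * 0)%:~R * z + (i.+1%:Z * 1)%:~R) / (2 * p%:R) * (1 - (i.+1%:Z * 0)%:~R / p%:R) = i.+1%:R / (2 * p%:R) :> C.
  by rewrite mulr0 mulr1 !mul0r add0r subr0 mulr1.
rewrite jt_rec // -/(eta z) => e2.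
have -> : ee z * w ^+ (2 * h - i.+1).+1 = ee z / w ^+ i.+1.
  apply: (mulIf (expf_neq0 i.+1 w0)); rewrite divfK ?expf_neq0 // -mulrA -exprD.
  have -> : ((2 * h - i.+1).+1 + i.+1 = p)%N by rewrite hp; have := ltn_ord i; clear; lia.
  by rewrite (prim_expr_order pw) mulr1.
rewrite [ee z * w ^+ i.+1]mulrC mulrAC e2; have := ee_neq0 (i.+1%:R / (2 * p%:R) : C).
by move: (ee _) (kl _ _ _ _) (eta z) => a b d a0; field.
Qed.

Lemma kl_opp X Y z : 0 < complex.Im z -> kl p (- X) (- Y) z = - kl p X Y z.
Proof.
move=> z0; have := @kl_SL2 R p (-1) 0 0 (-1) X Y z p0 z0 erefl.
rewrite mul0r !add0r addr0 !mulr0 !mulrN1 addr0 add0r.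
have -> : (-1)%:~R * z / (-1)%:~R = z by rewrite mulrNz; field.
by move=> ->; rewrite mulrNz; field.
Qed.

Lemma klp_oppE z : 0 < complex.Im z -> klp p h 0 (-1) z = (-1) ^+ h * klp p h 0 1 z.
Proof.
move=> z0; rewrite /klp -[h in (-1) ^+ h](card_ord h) -prodr_const -big_split; apply: eq_bigr => i _ /=.
by rewrite mulN1r -kl_opp // !mulr0 oppr0 mulrN.
Qed.

Lemma kappa_neq0 : kappa != 0.
Proof.
apply/prodf_neq0 => i _; rewrite mulf_neq0 ?invr_neq0 ?ee_neq0 // subr_eq0 eq_sym.
rewrite -(expr0 w) (eq_prim_root_expr pw) !modn_small //; have := ltn_ord i; lia.
Qed.

Let pR : p%:R = 2 * h%:R + 1 :> C. Proof. by rewrite hp natrD natrM. Qed.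
Let muR : mu%:R = 3 * h%:R + 2 :> C. Proof. by rewrite hmu natrD natrM. Qed.
Let pn' : 2 * h%:R + 1 != 0 :> C. Proof. by rewrite -pR. Qed.

Lemma klpE_neq0 z : 0 < complex.Im z -> klp p h 0 1 z != 0.
Proof.
move=> z0; have := klp_E z0; have q1 : nrm (ee z ^+ p) < 1.
  by rewrite nrmX exprn_ilt1 ?nrm_ge0 ?(ltW (nrm_ee_lt1 z0)) ?nrm_ee_lt1 // -lt0n.
have pq : poch (ee z ^+ p) (ee z ^+ p) != 0.
  apply: poch_neq0 => // n; rewrite -exprS; apply/eqP => /(congr1 (fun x => nrm x)).
  by rewrite nrmX nrm1 => /eqP; rewrite pexpr_eq1 ?nrm_ge0 // lt_eqF.
move=> h1; have : kappa * poch (ee z ^+ p) (ee z ^+ p) != 0 by rewrite mulf_neq0 // kappa_neq0.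
by rewrite -h1 !mulf_eq0 !negb_or => /andP[/andP[_ ->]].
Qed.

Lemma klpW_neq0 z j : 0 < complex.Im z -> klp p h 1 j%:Z z != 0.
Proof.
move=> z0; have := dcoef_klp j z0 => h1.
have : ((- eta z) ^+ h * poch (ee z) (ee z))^-1 != 0.
  by rewrite invr_neq0 // mulf_neq0 ?poch_ee // expf_neq0 // oppr_eq0 expf_neq0 // poch_ee.
by rewrite -h1 mulf_eq0 negb_or => /andP[_].
Qed.

Lemma kl01_neq0 z : 0 < complex.Im z -> kl p 0 1 z != 0.
Proof.
move=> z0; by rewrite kl_eq0 // dvdz0 dvdz1 /=; apply/eqP; move: p3; clear; lia.
Qed.

Lemma Gs_E (k j : nat) (e : int) z : e = 1 \/ e = -1 ->
  Gs p h mu s k%:Z (k%:Z * j%:Z) 1 j%:Z 0 e z = - ee (k%:R / 2 + 3 * k%:R * e%:~R / (2 * p%:R)) *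
   (klp p h 0 e z / klp p h 1 j%:Z z) *
   (kl p k%:Z (k%:Z * j%:Z - 2 * e) z ^+ mu * kl p k%:Z (k%:Z * j%:Z) z ^+ mu /
    (kl p k%:Z (k%:Z * j%:Z - e) z * kl p 0 e z ^+ (2 * mu))).
Proof.
move=> he; rewrite /Gs mulr0 !subr0; congr (_ * _ * _).
have [c hc] : exists c, (k * k.+1 = 2 * c)%N.
  exists (k * k.+1)./2; have : ~~ odd (k * k.+1) by rewrite oddM /=; case: (odd k).
  by move: (k * k.+1)%N => t; lia.
have hcR : k%:R * (k%:R + 1) = 2 * c%:R :> C by rewrite natr1 -!natrM hc.
rewrite opp_ee; apply: (@ee_congr _ _ _ (j%:Z * c%:Z + s%:Z * j%:Z + (if e == 1 then s%:Z else -1))).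
rewrite /Gph /sig /symp !(intrD, intrM, intrB, mulrNz) -![(Posz _)%:~R]/(_%:R).
have -> : c%:R = k%:R * (k%:R + 1) / 2 :> C by rewrite hcR; field.
by case: he => ->; rewrite ?eqxx /= ?mulrNz -?[(Posz _)%:~R]/(_%:R); field; exact: pn.
Qed.

(** The two values of e treat the two values of [Hf] in [dsum] at once: e = 1
    gives w Hf(y^k / w), and e = -1 gives Hf(w y^k). *)
Lemma term_Gs (k j : nat) (e : int) z : e = 1 \/ e = -1 -> 0 < complex.Im z ->
  (-1) ^+ k * yz z j ^+ pe k * (ee ((1 + e%:~R) / (2 * p%:R)) *
    Hf p (xz z) w (ee ((k%:R * z + (k%:Z * j%:Z - e)%:~R) / p%:R))) =
  - (eta z ^+ (2 * mu) / eta z * (ee (1 / (2 * p%:R)) * ee (k%:R / 2 + 3 * k%:R * e%:~R / (2 * p%:R))) *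
  (kl p k%:Z (k%:Z * j%:Z - 2 * e) z ^+ mu * kl p k%:Z (k%:Z * j%:Z) z ^+ mu /
    kl p k%:Z (k%:Z * j%:Z - e) z)).
Proof.
move=> he z0; rewrite /Hf; have -> : xz z ^+ p = ee z by rewrite -[xz z]mulr1 -(expr0 w) -/(yz z 0) yzp.
have -> : ((3 * p).-1./2 = 3 * h + 1)%N by rewrite hp; clear; lia.
have -> : ((3 * h + 1).+1 = mu)%N by rewrite hmu; clear; lia.
set zt := ee (_ / p%:R).
pose J c := jt (ee ((k%:Z%:~R * z + c%:~R) / p%:R)) (ee z).
have hjj : jt (zt / w) (ee z) * jt (zt * w) (ee z) = J (k%:Z * j%:Z - 2 * e) * J (k%:Z * j%:Z).
  rewrite /J /zt /w -eeN -!eeD -![(Posz k)%:~R]/(k%:R); case: he => ->.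
    have -> : (k%:R * z + (k%:Z * j%:Z - 1)%:~R) / p%:R + - p%:R^-1 = (k%:R * z + (k%:Z * j%:Z - 2 * 1)%:~R) / p%:R :> C.
      by rewrite !intrB; field; exact: pn.
    have -> // : (k%:R * z + (k%:Z * j%:Z - 1)%:~R) / p%:R + p%:R^-1 = (k%:R * z + (k%:Z * j%:Z)%:~R) / p%:R :> C.
    by rewrite !intrB; field; exact: pn.
  rewrite mulrC.
  have -> : (k%:R * z + (k%:Z * j%:Z - -1)%:~R) / p%:R + - p%:R^-1 = (k%:R * z + (k%:Z * j%:Z)%:~R) / p%:R :> C.
    by rewrite !intrB mulrNz; field; exact: pn.
  have -> // : (k%:R * z + (k%:Z * j%:Z - -1)%:~R) / p%:R + p%:R^-1 = (k%:R * z + (k%:Z * j%:Z - 2 * -1)%:~R) / p%:R :> C.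
  by rewrite !intrB mulrNz; field; exact: pn.
have hj1 : jt zt (ee z) = J (k%:Z * j%:Z - e) by [].
have alg (S Y c Z a2 a0 a1 G A B D E : C) : a1 != 0 -> S * Y * c * Z * (a2 * a0) ^+ mu = a1 * G ->
   S * Y * (c * (Z * ((- E * a2 * A) * (- E * a0 * B)) ^+ mu / (- E * a1 * D))) = - (E ^+ (2 * mu) / E * G * (A ^+ mu * B ^+ mu / D)).
  move=> a10 h1.
  have -> : (- E * a2 * A) * (- E * a0 * B) = E ^+ 2 * (a2 * a0) * (A * B) by ring.
  rewrite exprM (exprMn mu (E ^+ 2 * (a2 * a0)) (A * B)) (exprMn mu (E ^+ 2) (a2 * a0)) (exprMn mu A B).
  transitivity (S * Y * c * Z * (a2 * a0) ^+ mu * ((E ^+ 2) ^+ mu * (A ^+ mu * B ^+ mu) / (- E * a1 * D))); first by ring.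
  rewrite h1 (invfM (- E * a1)) (invfM (- E)) invrN.
  by move: ((E ^+ 2) ^+ mu) (A ^+ mu) (B ^+ mu) (E^-1) (D^-1) => e' A' B' Ei Di; field.
rewrite hjj hj1 /J !jt_kl // -/(eta z); apply: alg; first exact: ee_neq0.
rewrite -{1}ee_half yzE /zt -[(Posz k)%:~R]/(k%:R) -eeD !eeX -eeN -!eeD; congr ee.
have hpe : (pe k)%:R = (3 * k%:R ^+ 2 - k%:R) / 2 :> C.
  have := congr1 (fun n : nat => n%:R : C) (peE k).
  by rewrite -muln2 natrD natrM [(3 * _)%:R]natrM natrX => <-; field.
rewrite hpe natrD natrM muR !(intrB, intrM) -![(Posz _)%:~R]/(_%:R) pR; field; exact: pn'.
Qed.

Definition Ssum z : C := \sum_(j < p) \sum_(k < p.-1)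
  (Gs p h mu s k.+1%:Z (k.+1%:Z * j%:Z) 1 j%:Z 0 1 z - (-1) ^+ h * Gs p h mu s k.+1%:Z (k.+1%:Z * j%:Z) 1 j%:Z 0 (-1) z).

(** Like [solve_dissection], a purely algebraic step of [Ff_Gs], stated with
    variables for the nonzero factors. *)
Lemma collect_term (H P W E E2 e1 p1 p2 X1 X2 D1 D2 L sg kk : C) : kk != 0 -> L != 0 -> sg = 1 \/ sg = -1 ->
  (H * P)^-1 / W * (- (E2 / E * (e1 * p1) * (X1 / D1)) - - (E2 / E * (e1 * p2) * (X2 / D2))) =
  E2 * e1 * kk / (H * P * E * L) * (- p1 * (L / W) * (X1 / (D1 * kk)) - sg * (- p2 * (sg * L / W) * (X2 / (D2 * kk)))).
Proof.
move=> k0 L0 hsg; rewrite !invfM; move: (H^-1) (P^-1) (W^-1) (E^-1) (D1^-1) (D2^-1) => a b c d f g.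
by case: hsg => ->; field; rewrite k0 L0.
Qed.

Lemma solve_dissection (sm E E2 kk e1 H P L Q Ss S1 ka : C) : sm != 0 -> E != 0 -> E2 != 0 -> kk != 0 -> H != 0 -> P != 0 ->
  L != 0 -> Q != 0 -> ka != 0 -> sm * E2 * kk / E * (2 * w * S1) = - (E2 * e1 * kk / (H * P * E * L) * Ss) ->
  H * L * P = ka * Q -> Q * ((1 - w) / p%:R * S1) = - ((1 - w) * e1 / (2 * w * p%:R * ka * sm)) * Ss.
Proof.
move=> s0 E0 E20 k0 H0 P0 L0 Q0 ka0 h1 h2; have w0 : w != 0 by exact: ee_neq0.
have -> : S1 = - (e1 * Ss) / (H * L * P * sm * 2 * w).
  have w2 : 2 * w != 0 by apply: mulf_neq0; [rewrite pnatr_eq0 | exact: w0].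
  have c0 : sm * E2 * kk / E * (2 * w) != 0 by apply: mulf_neq0 w2; rewrite !mulf_neq0 ?invr_neq0.
  apply: (mulfI c0); rewrite -[LHS]mulrA h1; field.
  by rewrite s0 E0 H0 P0 L0 w0.
by rewrite h2; field; rewrite s0 Q0 ka0 w0 pn.
Qed.

(** All factors that depend on z but not on j and k, namely powers of (q;q), of
    kl(0,1) and of the product of the kl(0,i), cancel between the dissection
    formula, [dcoef_klp] and [klp_E]. *)
Lemma Ff_Gs : exists K, forall z, 0 < complex.Im z -> Ff z = K * Ssum z.
Proof.
exists (- ((1 - w) * ee (1 / (2 * p%:R)) / (2 * w * p%:R * kappa * (-1) ^+ mu))) => z z0.
have w0 : w != 0 by exact: ee_neq0.
have nw := prim_nrm pw; have x1 : nrm (xz z) < 1 by apply: nrm_ee_lt1; exact: Im_div.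
have x0 : xz z != 0 by exact: ee_neq0.
have E0 : eta z != 0 by rewrite expf_neq0 // poch_ee.
have P0 := poch_ee z0; have kE := klpE_neq0 z0; have k1 := kl01_neq0 z0.
have := dissection pp p3 x0 x1 pw.
have -> : xz z ^+ p = ee z by rewrite -[xz z]mulr1 -(expr0 w) -/(yz z 0) yzp.
have -> : ((3 * p).-1./2.+1 = mu)%N by rewrite hmu hp; clear; lia.
have kn : kl p 0 (-1) z = - kl p 0 1 z by rewrite -kl_opp // oppr0.
have hJJ : jt w^-1 (ee z) * jt w (ee z) = - eta z ^+ 2 * kl p 0 1 z ^+ 2.
  have j1 := jt_kl 0 1 z0; have j2 := jt_kl 0 (-1) z0.
  rewrite !mul0r !add0r subr0 mulr1 div1r -/w -/(eta z) in j1.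
  have hA : (0%:~R * z + (-1)%:~R) / p%:R = - p%:R^-1 :> C by rewrite mulrNz; field; exact: pn.
  have hB : (0%:~R * z + (-1)%:~R) / (2 * p%:R) * (1 - 0%:~R / p%:R) = - (1 / (2 * p%:R)) :> C by rewrite mulrNz; field; exact: pn.
  rewrite hA hB !eeN -/w -/(eta z) kn in j2.
  have a0 := ee_neq0 (1 / (2 * p%:R) : C).
  by rewrite j1 j2; move: (ee _) (kl _ _ _ _) a0 => a b a0; field.
rewrite hJJ -/(eta z) => hd.
have hds : dsum p (xz z) w = (eta z ^+ (2 * mu) * ee (1 / (2 * p%:R)) * kl p 0 1 z ^+ (2 * mu)) /
   ((- eta z) ^+ h * poch (ee z) (ee z) * eta z * klp p h 0 1 z) * Ssum z.
  rewrite /dsum /Ssum mulr_sumr; apply: eq_bigr => j _; rewrite !mulr_sumr; apply: eq_bigr => k _.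
  have hw := klpW_neq0 j z0; have dk := dcoef_klp j z0.
  have -> : dcoef p (xz z) w j = ((- eta z) ^+ h * poch (ee z) (ee z))^-1 / klp p h 1 j%:Z z.
    by rewrite -dk mulfK.
  have t1 := @term_Gs k.+1 j 1 z (or_introl erefl) z0.
  have t2 := @term_Gs k.+1 j (-1) z (or_intror erefl) z0.
  have g1 := @Gs_E k.+1 j 1 z (or_introl erefl).
  have g2 := @Gs_E k.+1 j (-1) z (or_intror erefl).
  have z1 : ee ((k.+1%:R * z + (k.+1%:Z * j%:Z - 1)%:~R) / p%:R) = yz z j ^+ k.+1 / w.
    by rewrite yzE eeX -eeN -eeD intrB intrM -![(Posz _)%:~R]/(_%:R); congr ee; field; exact: pn.
  have z2 : ee ((k.+1%:R * z + (k.+1%:Z * j%:Z - -1)%:~R) / p%:R) = w * yz z j ^+ k.+1.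
    by rewrite yzE eeX -eeD intrB mulrNz intrM -![(Posz _)%:~R]/(_%:R); congr ee; field; exact: pn.
  have w1 : ee ((1 + 1%:~R) / (2 * p%:R)) = w.
    by congr ee; field; exact: pn.
  have w2 : ee ((1 + (-1)%:~R) / (2 * p%:R)) = 1 :> C by rewrite mulrNz subrr mul0r ee0.
  rewrite z1 w1 in t1; rewrite z2 w2 mul1r in t2.
  rewrite -/(yz z j) mulrBr t1 t2 g1 g2 klp_oppE //.
  have ke : (- kl p 0 1 z) ^+ (2 * mu) = kl p 0 1 z ^+ (2 * mu) by rewrite exprM sqrrN -exprM.
  rewrite kn ke.
  have k2 : kl p 0 1 z ^+ (2 * mu) != 0 by rewrite expf_neq0.
  have e2 : (- eta z) ^+ h != 0 by rewrite expf_neq0 // oppr_eq0.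
  have sg : (-1) ^+ h * (-1) ^+ h = 1 :> C by rewrite -exprD -signr_odd oddD addbb.
  apply: collect_term => //; rewrite -signr_odd; by case: (odd h); [right|left].
rewrite Ff_Ap //; apply: (@solve_dissection ((-1) ^+ mu) (eta z) (eta z ^+ (2 * mu)) (kl p 0 1 z ^+ (2 * mu)) _ ((- eta z) ^+ h) (poch (ee z) (ee z)) (klp p h 0 1 z)).
- by rewrite signr_eq0.
- exact: E0.
- by rewrite expf_neq0.
- by rewrite expf_neq0.
- by rewrite expf_neq0 // oppr_eq0.
- exact: P0.
- exact: kE.
- have := klp_E z0; apply: contra_eq_neq => ->; rewrite mulr0 !mulf_neq0 //.
  by rewrite expf_neq0 // oppr_eq0.
- exact: kappa_neq0.
- have pow2 (a b : C) : (- a ^+ 2 * b ^+ 2) ^+ mu = (-1) ^+ mu * a ^+ (2 * mu) * b ^+ (2 * mu).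
    by rewrite mulNr exprNn exprMn -!exprM mulrA.
  by rewrite -hds -hd pow2.
exact: klp_E.
Qed.

End FE.

(** * Modularity *)
Lemma lin_comb (F : comPzRingType) (A B a b u v : F) : A = u * a -> B = u * b -> A - v * B = u * (a - v * b).
Proof. by move=> -> ->; ring. Qed.

Lemma inv_cancel (F : comPzRingType) (u v a b c A B : F) : u * v = 1 -> A = v * a -> B = v * b ->
  u * (A - c * B) = a - c * b.
Proof. by move=> uv -> ->; rewrite mulrCA -mulrBr mulrA uv mul1r. Qed.

Section Final.
Variables (R : realType) (p h mu s : nat).
Local Notation C := R[i].
Hypothesis hp : p = (2 * h + 1)%N.
Hypothesis hmu : mu = (3 * h + 2)%N.
Hypothesis hs : (24 * s + 1 = p ^ 2)%N.
Implicit Types (z : C).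

Lemma periodic_sum (f : int -> C) (b : int) : (forall i, f (i + p%:Z) = f i) ->
  \sum_(j < p) f (j%:Z + b) = \sum_(j < p) f j%:Z.
Proof.
move=> per; have step (g : int -> C) : g p%:Z = g 0 -> \sum_(j < p) g (j%:Z + 1) = \sum_(j < p) g j%:Z.
  move=> g0; have h1 := big_ord_recr p (fun j : 'I_p.+1 => g j%:Z) (idx := 0) (op := +%R).
  have h2 := big_ord_recl p (fun j : 'I_p.+1 => g j%:Z) (idx := 0) (op := +%R).
  rewrite h1 /= g0 addrC in h2; move/addrI: h2 => ->; apply: eq_bigr => j _.
  by rewrite /bump /= add1n -addn1 PoszD.
elim/int_ind2: b => [|b IH|b IH].
- by apply: eq_bigr => j _; rewrite addr0.
- rewrite -IH -(step (fun i => f (i + b))) ?add0r ?[p%:Z + b]addrC ?per //.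
  by apply: eq_bigr => j _; rewrite -addrA (addrC 1).
rewrite -IH -(step (fun i => f (i + (b - 1)))) ?add0r ?[p%:Z + _]addrC ?per //.
by apply: eq_bigr => j _; rewrite -addrA (addrC 1) subrK.
Qed.

(** Here k is the scalar called k + 1 in [Ssum], and e is 1 or -1. *)
Definition Gj k e (i : int) z := Gs p h mu s k (k * i) 1 i 0 e z : C.

Lemma Gj_per k e i z : 0 < complex.Im z -> Gj k e (i + p%:Z) z = Gj k e i z.
Proof.
move=> z0; rewrite /Gj.
have -> : k * (i + p%:Z) = k * i + p%:Z * k by ring.
have e1 := Gs_perV s hp hmu 0 k k (k * i) 1 (i + p%:Z) 0 e z0.
have e2 := Gs_perW hp hmu hs 0 1 k (k * i) 1 i 0 e z0.
by rewrite mulr0 addr0 in e1; rewrite mulr0 addr0 mulr1 in e2; rewrite e1.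
Qed.

Lemma Gj_SL2 k e (a b c d i : int) z : 0 < complex.Im z -> a * d - b * c = 1 ->
  Gj k e i ((a%:~R * z + b%:~R) / (c%:~R * z + d%:~R)) = (c%:~R * z + d%:~R) *
  Gs p h mu s (k * a + k * i * c) (k * b + k * i * d) (a + i * c) (b + i * d) (e * c) (e * d) z.
Proof.
move=> z0 det; rewrite /Gj (Gs_SL2 mu s hp) // !mul1r !mul0r !add0r //.
Qed.

(** Modulo p the matrix is unipotent: (1, i) goes to (1, i + b), and (0, e) is
    fixed. *)
Lemma Gj_Gamma1 k e (a b c d i : int) z : 0 < complex.Im z -> a * d - b * c = 1 ->
  (p%:Z %| a - 1)%Z -> (p%:Z %| d - 1)%Z -> (p%:Z %| c)%Z ->
  Gj k e i ((a%:~R * z + b%:~R) / (c%:~R * z + d%:~R)) = (c%:~R * z + d%:~R) * Gj k e (i + b) z.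
Proof.
move=> z0 det /dvdzP [a' ha] /dvdzP [d' hd] /dvdzP [c' hc]; rewrite Gj_SL2 //; congr (_ * _).
have -> : k * a + k * i * c = k + p%:Z * (k * a' + k * i * c').
  by rewrite -[a](subrK 1) ha hc; ring.
have -> : k * b + k * i * d = k * (i + b) + p%:Z * (k * i * d').
  by rewrite -[d](subrK 1) hd; ring.
have -> : a + i * c = 1 + p%:Z * (a' + i * c') by rewrite -[a](subrK 1) ha hc; ring.
have -> : b + i * d = (i + b) + p%:Z * (i * d') by rewrite -[d](subrK 1) hd; ring.
have -> : e * c = 0 + p%:Z * (e * c') by rewrite hc; ring.
have -> : e * d = e + p%:Z * (e * d') by rewrite -[d](subrK 1) hd; ring.
by rewrite (Gs_perV s hp hmu) // (Gs_perW hp hmu hs) // (Gs_perE hp hmu hs).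
Qed.

Lemma Gj_sum_Gamma1 k e (a b c d : int) z : 0 < complex.Im z -> a * d - b * c = 1 ->
  (p%:Z %| a - 1)%Z -> (p%:Z %| d - 1)%Z -> (p%:Z %| c)%Z ->
  \sum_(j < p) Gj k e j%:Z ((a%:~R * z + b%:~R) / (c%:~R * z + d%:~R)) =
  (c%:~R * z + d%:~R) * \sum_(j < p) Gj k e j%:Z z.
Proof.
move=> z0 det ha hd hc; transitivity ((c%:~R * z + d%:~R) * \sum_(j < p) Gj k e (j%:Z + b) z).
  by rewrite mulr_sumr; apply: eq_bigr => j _; exact: Gj_Gamma1.
by congr (_ * _); apply: (periodic_sum (f := fun i => Gj k e i z)) => i; exact: Gj_per.
Qed.

(** Translation by p acts on vectors by a matrix congruent to 1 modulo p. *)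
Lemma Gs_addp V1 V2 W1 W2 E1 E2 z : 0 < complex.Im z ->
  Gs p h mu s V1 V2 W1 W2 E1 E2 (z + p%:R) = Gs p h mu s V1 V2 W1 W2 E1 E2 z :> C.
Proof.
move=> z0; have := @Gs_SL2 R p h mu s hp 1 p%:Z 0 1 V1 V2 W1 W2 E1 E2 z z0.
rewrite mulr0 subr0 => /(_ (mulr1 1)).
have -> : (1%:~R * z + p%:Z%:~R) / (0%:~R * z + 1%:~R) = z + p%:R by rewrite mul1r mul0r add0r divr1.
move=> ->; rewrite mul0r add0r mul1r !mulr1 !mulr0 !addr0.
have e (x y : int) : x * p%:Z + y = y + p%:Z * x by ring.
have e1 := Gs_perV s hp hmu 0 V1 V1 V2 W1 (W2 + p%:Z * W1) E1 (E2 + p%:Z * E1) z0.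
have e2 := Gs_perW hp hmu hs 0 W1 V1 V2 W1 W2 E1 (E2 + p%:Z * E1) z0.
have e3 := Gs_perE hp hmu hs 0 E1 V1 V2 W1 W2 E1 E2 z0.
rewrite mulr0 addr0 in e1; rewrite mulr0 addr0 in e2; rewrite mulr0 addr0 in e3.
by rewrite !e e1 e2 e3.
Qed.

End Final.

Lemma det_SL2 (g : 'M[int]_2) : \det g = g 0 0 * g 1 1 - g 0 1 * g 1 0.
Proof.
rewrite (expand_det_row _ 0) big_ord_recl big_ord1 /cofactor !det_mx11 !mxE /=.
rewrite /bump /= expr0 mul1r expr1 mulN1r mulrN; congr (g _ _ * g _ _ - g _ _ * g _ _); exact: val_inj.
Qed.

Theorem corollary1p3 (R : realType) (p : nat) (p_prime : prime p)
    (p_gt3 : (3 < p)%N) :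
  weakly_holomorphic_modular_form_Gamma1 p 1
    (fun z : R[i] =>
       let q := qexp 1 z in
       infinite_prod 1 (fun n => 1 - q ^+ (p * n)) *
       infinite_sum (ceil_div (sp p) p) (fun n =>
         (\sum_(0 <= k < p)
            (rank_count k p (p * n - sp p))%:R * zeta R p ^+ k) * q ^+ n)).
Proof.
pose h := p./2; pose mu := (3 * h + 2)%N.
have podd : odd p by have := even_prime p_prime; case=> // e; move: p_gt3; rewrite e.
have hp : p = (2 * h + 1)%N by rewrite /h -{1}(odd_double_half p) podd -mul2n addnC.
have p0 : (0 < p)%N by apply: leq_ltn_trans p_gt3.
have hs := sp24 p_prime p_gt3; set s := sp p in hs *.
have [K hK] := Ff_Gs R p_prime p_gt3 hp (erefl mu).
rewrite -/(@Ff R p).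
have hS z : @Ssum R p h mu z = \sum_(k < p.-1) (\sum_(j < p) Gj p h mu s k.+1%:Z 1 j%:Z z -
    (-1) ^+ h * \sum_(j < p) Gj p h mu s k.+1%:Z (-1) j%:Z z).
  rewrite /Ssum exchange_big /=; apply: eq_bigr => k _; rewrite mulr_sumr -sumrB; by apply: eq_bigr.
have lfr (g : 'M[int]_2) (z : R[i]) : \det g = 1 -> upper_half_plane z -> [/\ upper_half_plane (moebius g z), automorphy g z != 0 &
   g 0 0 * g 1 1 - g 0 1 * g 1 0 = 1].
  move=> dg z0; rewrite det_SL2 in dg; have [h1 h2] := Im_frac dg z0; by split.
split.
- move=> z z0; apply: locU_derivable.
  apply: (@locU_ext _ (fun z => K * Ssum p h mu z)).
    exists (complex.Im z / 2); split=> [|x hx]; first by move: z0; rewrite /upper_half_plane /=; lra.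
    by rewrite hK //; have := Im_ball z0 hx; move: z0; rewrite /upper_half_plane /=; lra.
  apply: locU_M; first exact: locU_cst.
  apply: locU_sum => j; apply: locU_sum => k; apply: locU_D; first exact: locU_Gs.
  apply: (@locU_ext _ (fun z => - (-1) ^+ h * Gs p h mu s k.+1%:Z (k.+1%:Z * j%:Z) 1 j%:Z 0 (-1) z)).
    by exists 1; split=> // x _; rewrite mulNr.
  by apply: locU_M; [exact: locU_cst | exact: locU_Gs].
- move=> g z [dg ha hd hc] z0; have [mz az det] := lfr g z dg z0.
  rewrite !hK // expr1z mulrCA; congr (_ * _); rewrite !hS mulr_sumr; apply: eq_bigr => k _.
  have key e : \sum_(j < p) Gj p h mu s k.+1%:Z e j%:Z (moebius g z) = automorphy g z * \sum_(j < p) Gj p h mu s k.+1%:Z e j%:Z z.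
    apply: (Gj_sum_Gamma1 hp erefl hs) => //.
    + by rewrite -eqz_mod_dvd; apply/eqP.
    + by rewrite -eqz_mod_dvd; apply/eqP.
    + by apply/dvdz_mod0P; rewrite hc mod0z.
  exact: lin_comb (key 1) (key (-1)).
move=> g dg; rewrite /SL2Z /= in dg.
(* The summands of the function slashed by g: the same quotients, with all
   index vectors multiplied by g. *)
pose G e (k j : nat) z : R[i] := Gs p h mu s (k.+1%:Z * g 0 0 + k.+1%:Z * j%:Z * g 1 0) (k.+1%:Z * g 0 1 + k.+1%:Z * j%:Z * g 1 1)
  (g 0 0 + j%:Z * g 1 0) (g 0 1 + j%:Z * g 1 1) (e * g 1 0) (e * g 1 1) z.
have hsl z : 0 < complex.Im z -> slash 1 (Ff p) g z = K * \sum_(k < p.-1) (\sum_(j < p) G 1 k j z - (-1) ^+ h * \sum_(j < p) G (-1) k j z).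
  move=> z0; have [mz az det] := lfr g z dg z0.
  rewrite /slash hK // hS mulrCA; congr (_ * _); rewrite mulr_sumr; apply: eq_bigr => k _.
  have key e : \sum_(j < p) Gj p h mu s k.+1%:Z e j%:Z (moebius g z) = automorphy g z * \sum_(j < p) G e k j z.
    by rewrite mulr_sumr; apply: eq_bigr => j _; rewrite /moebius Gj_SL2.
  have inv : automorphy g z ^ (-1) * automorphy g z = 1 by rewrite -[_ ^ (-1)]/((automorphy g z)^-1) mulVf.
  exact: inv_cancel inv (key 1) (key (-1)).
apply: (cuspU_mero p0).
  apply: (cuspU_ext (f := fun z => K * \sum_(k < p.-1) (\sum_(j < p) G 1 k j z + (- (-1) ^+ h) * \sum_(j < p) G (-1) k j z))).
    by move=> z z0; rewrite hsl //; congr (_ * _); apply: eq_bigr => k _; rewrite mulNr.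
  apply: cuspU_M; first exact: cuspU_cst.
  apply: cuspU_sum => k; apply: cuspU_D; first by apply: cuspU_sum => j; exact: cuspU_Gs.
  by apply: cuspU_M; [exact: cuspU_cst | apply: cuspU_sum => j; exact: cuspU_Gs].
move=> z z0; have z1 : 0 < complex.Im (z + p%:R).
  have -> : complex.Im (z + p%:R) = complex.Im z; last by [].
  by rewrite (rt_natE R); case: (z) => x y; rewrite /= addr0.
have GT e (k : nat) : \sum_(j < p) G e k j (z + p%:R) = \sum_(j < p) G e k j z.
  by apply: eq_bigr => j _; exact: (Gs_addp hp (erefl mu) hs).
rewrite (hsl _ z1) (hsl _ z0); apply: (congr1 (fun t => K * t)); apply: eq_bigr => k _.
exact: (f_equal2 (fun a b : R[i] => a - (-1) ^+ h * b) (GT 1 k) (GT (-1) k)).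
Qed.
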